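(* Let $\phi$ be a finite-range repulsive pair potential on $\mathbb{R}^d$ and suppose the Gibbs point processes with potential $\phi$ exhibit strong spatial mixing on $\mathbb{R}^d$ with activities bounded by $\lambda$. Then there exists $L_0>0$ such that for all $L\ge L_0$, all $n$ and all activity functions $\boldsymbol{\lambda}$ bounded by $\lambda$ and supported on $\Lambda_n=[-n,n]^d$, the block dynamics with update radius $L$ for $\mu_{\Lambda_n,\boldsymbol{\lambda}}$ has mixing time $\tau_{\mathrm{mix}}(\varepsilon)=O(N\log(N/\varepsilon))$, where $N=|\Lambda_n|$.
   Context: $\phi$ symmetric, $\phi\ge0$, $\phi(x)=0$ for $\|x\|>r$; $H=\sum_{i<j}\phi(x_i-x_j)$. For a bounded, boundedly supported activity function $\boldsymbol{\lambda}\ge0$, $\mu_{\boldsymbol{\lambda}}$ is the Gibbs point process with density $\prod\boldsymbol{\lambda}(x_i)e^{-H}/Z(\boldsymbol{\lambda})$ w.r.t. the Poisson process; $\mu_{\Lambda_n,\boldsymbol{\lambda}}=\mu_{\boldsymbol{\lambda}}$ for $\boldsymbol{\lambda}$ supported in $\Lambda_n$. Strong spatial mixing with activities bounded by $\lambda$: there exist $\alpha,\beta>0$ so that for all bounded measurable $\Lambda$ and activity functions $\boldsymbol{\lambda},\boldsymbol{\lambda}'\le\lambda$, the total variation distance between the restrictions to $\Lambda$ of $\mu_{\boldsymbol{\lambda}}$ and $\mu_{\boldsymbol{\lambda}'}$ is at most $\alpha|\Lambda|e^{-\beta\,\mathrm{dist}(\Lambda,\supp(\boldsymbol{\lambda}-\boldsymbol{\lambda}'))}$.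 Block dynamics with radius $L$: from $X_t\subset\Lambda_n$ pick $y\in\Lambda_n$ uniformly, and resample the points in $B_L(y)$ from the process with density $\exp(-\sum_{i<j}\phi(x_i-x_j)-\sum_i\sum_{x\in X_t\setminus B_L(y)}\phi(x_i-x))$ against the Poisson process of intensity $\boldsymbol{\lambda}$ on $B_L(y)$. Mixing time $\tau_{\mathrm{mix}}(\varepsilon)=\sup_{\mu_0}\min\{j:\|\mu_j-\mu_{\Lambda_n,\boldsymbol{\lambda}}\|_{TV}<\varepsilon\}$. *)

(* Defs.v *)
From HB Require Import structures.
From mathcomp Require Import all_boot all_order all_algebra.
From mathcomp Require Import all_classical all_reals all_analysis measurable_realfun.

Set Implicit Arguments.
Unset Strict Implicit.
Unset Printing Implicit Defensive.
Import Order.TTheory GRing.Theory Num.Theory.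
Import numFieldNormedType.Exports.

Local Open Scope classical_set_scope.
Local Open Scope ring_scope.

(** Points of R^d are d-tuples of reals; d.-tuple R carries the product
    (= Borel) sigma-algebra of the library. *)
Notation point R dim := (dim.-tuple R).

(** Finite point configurations, represented by finite sequences of points
    (events are required to be permutation invariant, see [conf_event]). *)
Definition conf (R : realType) (dim : nat) := seq (point R dim).
HB.instance Definition _ (R : realType) (dim : nat) :=
  Choice.on (conf R dim).
HB.instance Definition _ (R : realType) (dim : nat) :=
  isPointed.Build (conf R dim) [::].

Section Defs.
Context {R : realType} {dim : nat}.

Definition pdiff (x y : point R dim) : point R dim :=
  [tuple tnth x i - tnth y i | i < dim].

Definition popp (x : point R dim) : point R dim := [tuple - tnth x i | i < dim].

Definition pnorm (x : point R dim) : R := Num.sqrt (\sum_(i < dim) tnth x i ^+ 2).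

Fixpoint intR (m : nat) : (m.-tuple R -> \bar R) -> \bar R :=
  match m with
  | 0 => fun f => f [tuple]
  | m'.+1 => fun f =>
      (\int[lebesgue_measure]_(t in [set: R]) intR (fun v => f (cons_tuple t v)))%E
  end.

Fixpoint intpts (k : nat) (F : seq (point R dim) -> \bar R) : \bar R :=
  match k with
  | 0 => F [::]
  | k'.+1 => intR (fun x : point R dim => intpts k' (fun s => F (x :: s)))
  end.

Definition vol (A : set (point R dim)) : \bar R :=
  intR (fun x : point R dim => (\1_A x)%:E).

Definition box (n : nat) : set (point R dim) :=
  [set x | forall i : 'I_dim, - (n%:R) <= tnth x i <= n%:R].

Definition ball_pt (y : point R dim) (L : R) : set (point R dim) :=
  [set x | pnorm (pdiff x y) <= L].

Definition bounded_pt (A : set (point R dim)) : Prop :=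
  exists M : R, forall x, A x -> pnorm x <= M.

(** Distance between two subsets of R^d (+oo if one of them is empty). *)
Definition set_dist (A B : set (point R dim)) : \bar R :=
  ereal_inf [set (pnorm (pdiff xz.1 xz.2))%:E | xz in A `*` B].

(** phi is a repulsive pair potential of range r: measurable, symmetric,
    nonnegative (values in [0,+oo], hard cores allowed), vanishing beyond r. *)
Definition repulsive_range (phi : point R dim -> \bar R) (r : R) : Prop :=
  [/\ measurable_fun [set: point R dim] phi,
      (forall x, phi (popp x) = phi x),
      (forall x, (0 <= phi x)%E) &
      (forall x, r < pnorm x -> phi x = 0%E)].

Definition activity (lam : point R dim -> R) (lambda : R) : Prop :=
  [/\ measurable_fun [set: point R dim] lam,
      (forall x, 0 <= lam x <= lambda) &
      bounded_pt [set x | lam x != 0]].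

Fixpoint energy (phi : point R dim -> \bar R) (s : seq (point R dim)) : \bar R :=
  match s with
  | [::] => 0%E
  | x :: s' => ((\sum_(y <- s') phi (pdiff x y)) + energy phi s')%E
  end.

Definition cross (phi : point R dim -> \bar R) (s eta : seq (point R dim)) : \bar R :=
  (\sum_(x <- s) \sum_(z <- eta) phi (pdiff x z))%E.

(** Density of the (boundary-conditioned) Gibbs process w.r.t. the
    unit-intensity Poisson process, up to normalisation. *)
Definition weight (phi : point R dim -> \bar R) (lam : point R dim -> R)
  (eta s : seq (point R dim)) : \bar R :=
  ((\prod_(x <- s) lam x)%:E * expeR (- (energy phi s + cross phi s eta)))%E.

Definition mass (phi : point R dim -> \bar R) (lam : point R dim -> R)
  (eta : seq (point R dim)) (F : seq (point R dim) -> \bar R) : \bar R :=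
  (\sum_(0 <= k <oo) (k`!%:R^-1)%:E * intpts k (fun s => F s * weight phi lam eta s))%E.

Definition gexp (phi : point R dim -> \bar R) (lam : point R dim -> R)
  (eta : seq (point R dim)) (F : seq (point R dim) -> \bar R) : \bar R :=
  (mass phi lam eta F * ((fine (mass phi lam eta (fun=> 1%E)))^-1)%:E)%E.

Definition gibbs_prob (phi : point R dim -> \bar R) (lam : point R dim -> R)
  (A : set (seq (point R dim))) : R :=
  fine (gexp phi lam [::] (fun s => (\1_A s)%:E)).

Definition conf_measurable (A : set (seq (point R dim))) : Prop :=
  forall k : nat, measurable [set t : k.-tuple (point R dim) | A (tval t)].

Definition conf_event (A : set (seq (point R dim))) : Prop :=
  conf_measurable A /\ (forall s t, perm_eq s t -> A s -> A t).

Definition restr_event (Lam : set (point R dim)) (B : set (seq (point R dim))) :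
  set (seq (point R dim)) :=
  [set s | B [seq x <- s | `[< Lam x >]]].

Definition tv_restr (phi : point R dim -> \bar R) (Lam : set (point R dim))
  (lam lam' : point R dim -> R) : \bar R :=
  ereal_sup [set (`| gibbs_prob phi lam (restr_event Lam B)
                     - gibbs_prob phi lam' (restr_event Lam B) |)%:E
            | B in conf_event].

Definition strong_spatial_mixing (phi : point R dim -> \bar R) (lambda : R) : Prop :=
  exists alpha beta : R, [/\ 0 < alpha, 0 < beta &
    forall (Lam : set (point R dim)) (lam lam' : point R dim -> R),
      measurable Lam -> bounded_pt Lam ->
      activity lam lambda -> activity lam' lambda ->
      (tv_restr phi Lam lam lam' <=
        alpha%:E * vol Lam * expeR (- (beta%:E * set_dist Lam [set x | lam x != lam' x])))%E].

Definition boxvol (n : nat) : R := (2 * n)%:R ^+ dim.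

(** One step of the block dynamics with radius L acting on (nonnegative)
    functions of the configuration: pick y uniformly in Lambda_n and resample
    the points in B_L(y) from the Gibbs process on B_L(y) with activity lam and
    boundary condition X \ B_L(y).  (P f)(x) = E[f(X_1) | X_0 = x]. *)
Definition block_step (phi : point R dim -> \bar R) (lam : point R dim -> R)
  (n : nat) (L : R) (f : seq (point R dim) -> \bar R) (x : seq (point R dim)) : \bar R :=
  ((boxvol n)^-1%:E *
   intR (fun y : point R dim =>
     let out := [seq z <- x | ~~ `[< ball_pt y L z >]] in
     (\1_(box n) y)%:E *
     gexp phi (fun z => if `[< ball_pt y L z >] then lam z else 0%R) out
          (fun Z => f (out ++ Z))))%E.

Definition confT := g_sigma_algebraType (@conf_measurable : set (set (conf R dim))).

Definition block_law (phi : point R dim -> \bar R) (lam : point R dim -> R)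
  (n : nat) (L : R) (mu0 : probability confT R) (j : nat)
  (A : set (seq (point R dim))) : R :=
  fine (\int[mu0]_(x in [set: confT])
          iter j (block_step phi lam n L) (fun s => (\1_A s)%:E) x)%E.

Definition block_tv (phi : point R dim -> \bar R) (lam : point R dim -> R)
  (n : nat) (L : R) (mu0 : probability confT R) (j : nat) : \bar R :=
  ereal_sup [set (`| block_law phi lam n L mu0 j A - gibbs_prob phi lam A |)%:E
            | A in conf_event].

Definition mixing_time_le (phi : point R dim -> \bar R) (lam : point R dim -> R)
  (n : nat) (L : R) (eps T : R) : Prop :=
  forall mu0 : probability confT R,
    mu0 [set s : confT | forall x, x \in (s : seq (point R dim)) -> box n x] = 1%E ->
    exists j : nat, j%:R <= T /\ (block_tv phi lam n L mu0 j < eps%:E)%E.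

End Defs.

(* Main.v *)
Require Import Defs.
From HB Require Import structures.
From mathcomp Require Import all_boot all_order all_algebra.
From mathcomp Require Import all_classical all_reals all_analysis measurable_realfun.
From mathcomp Require Import ring lra zify.
Set Implicit Arguments.
Unset Strict Implicit.
Unset Printing Implicit Defensive.
Import Order.TTheory GRing.Theory Num.Theory.
Import numFieldNormedType.Exports.
Local Open Scope classical_set_scope.
Local Open Scope ring_scope.

(** There is no coupling: the argument bounds oscillations of [P^j f], where [P] is
    the block step and [f] the indicator of an event.

    Cut [box n] into unit cells. A vector [delta] certifies [f] when [f X] and [f Y]
    differ by at most [delta i] for any [X], [Y] that agree outside cell [i]. If [delta]
    certifies [f], compare [P f X] with [P f Y] for a fixed update centre [y].
    - If the ball around [y] covers cell [i], the two resamplings are identical.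
    - If the ball stays at distance more than [r] from cell [i], they use the same law
      and the difference is at most [delta i].
    - Otherwise [y] lies in a shell around cell [i]. The boundary conditions can be
      absorbed into the activities, which differ only within distance [r] of cell [i];
      strong spatial mixing therefore makes the two laws nearly equal at distance more
      than [m] from cell [i], so the difference exceeds [delta i] by at most
      [2 * (sum of delta over cells near i)] plus an error exponentially small in [m].
    The covered volume is of order [L^d] and the shell only [L^(d - 1/2)], so for
    large [L] the sum of [delta] shrinks by a factor [1 - 1/N] in each step. It starts
    at [N], so [P^j f] is constant up to [2 N (1 - 1/N)^j]. That constant is the Gibbs
    probability of the event: splitting the Poisson process over a ball and its
    complement shows that resampling leaves the Gibbs measure invariant. *)

(** * Measurability on the space of configurations *)

(** The block step is given as an operator on functions, so bounding oscillations requires only that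
    [P f] be measurable, never a measurable choice of couplings between configurations. Oscillations
    are indexed by cells because a cell may hold arbitrarily many points: erasing all of them costs
    [delta i] once.

    The contraction closes because every error is linear in [delta]. The spatial mixing error is
    multiplied by the oscillation of [f] over the resampled ball, that is, by the sum of [delta]
    over the cells within [M] of cell [i]; this comes from rescaling [f] to [0, 1] before mixing is
    applied. An error independent of [delta] would leave a floor that iteration could not remove.
    Summing over [i] and exchanging sums turns each error into a multiple of the sum of [delta].

    A technical obstacle is that [intR], [intpts] and [mass] are iterated integrals and series, not
    integrals against a measure. They are first represented by s-finite measures, for which
    linearity, monotonicity and Tonelli's theorem are available; this needs joint measurability in
    the update centre, the boundary condition and the sampled points. *)

Section ConfMeasurable.
Context {R : realType} {dim : nat}.
Notation pt := (dim.-tuple R).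
Notation cf := (@confT R dim).

(** The class [conf_measurable] is already closed under complements and countable unions, because
    preimages under [tval] commute with both; generating a sigma-algebra from it adds no set. *)
Lemma conf_measurableP (A : set cf) : measurable A <-> conf_measurable A.
Proof.
split; last by move=> mA; apply: sub_sigma_algebra.
apply: smallest_sub => //; split.
- by move=> k; rewrite (_ : [set t | _] = set0)//; exact: measurable0.
- move=> B mB k; rewrite setTD (_ : [set t | _] = ~` [set t : k.-tuple pt | B (tval t)])//.
  by apply: measurableC; exact: (mB k).
- move=> F mF k.
  rewrite (_ : [set t | _] = \bigcup_i [set t : k.-tuple pt | F i (tval t)])//.
  by apply: bigcup_measurable => i _; exact: (mF i k).
Qed.

Lemma measurable_tval k :
  measurable_fun [set: k.-tuple pt] (fun t => tval t : cf).
Proof. by move=> _ A /conf_measurableP mA; rewrite setTI; exact: mA. Qed.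

Definition to_tuple k (s : cf) : k.-tuple pt :=
  insubd (nseq_tuple k (nseq_tuple dim 0)) (s : seq pt).

Lemma measurable_to_tuple k : measurable_fun [set: cf] (@to_tuple k).
Proof.
move=> _ A mA; rewrite setTI; apply/conf_measurableP => l.
have [<-|kl] := eqVneq k l.
  rewrite (_ : [set t | _] = A)//; apply/seteqP.
  by split=> t /=; rewrite /to_tuple valKd.
have dflt (t : l.-tuple pt) : to_tuple k (tval t) = nseq_tuple k (nseq_tuple dim 0).
  by rewrite /to_tuple /insubd insubF// size_tuple eq_sym; apply/negbTE.
have [Ad|nAd] := pselect (A (nseq_tuple k (nseq_tuple dim 0))).
  rewrite (_ : [set t | _] = setT)//; apply/seteqP; split=> // t _ /=.
  by rewrite dflt.
rewrite (_ : [set t | _] = set0)//; apply/seteqP; split=> // t /=.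
by rewrite dflt.
Qed.

Lemma measurable_size_eq k : measurable [set s : cf | size (s : seq pt) = k].
Proof.
apply/conf_measurableP => l.
have [->|kl] := eqVneq l k.
  rewrite (_ : [set t | _] = setT)//; apply/seteqP; split=> // t _ /=.
  by rewrite size_tuple.
rewrite (_ : [set t | _] = set0)//; apply/seteqP; split=> // t /=.
by rewrite size_tuple => /eqP; rewrite (negbTE kl).
Qed.

Section param.
Context d (T : measurableType d).

(** The configuration space is the countable disjoint union of the sets of sequences of given
    length, and [to_tuple] identifies each of them measurably with a tuple space. A preimage under
    [G] is glued from its traces on these pieces. *)
Lemma measurable_conf_slices d' (U : measurableType d') (G : T * cf -> U) :
  (forall k, measurable_fun [set: T * k.-tuple pt]
     (fun p => G (p.1, tval p.2 : cf))) ->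
  measurable_fun [set: T * cf] G.
Proof.
move=> mG _ B mB; rewrite setTI.
rewrite (_ : G @^-1` B = \bigcup_k ((snd @^-1` [set s : cf | size (s : seq pt) = k])
   `&` ((fun p : T * cf => (p.1, to_tuple k p.2)) @^-1`
        ((fun p : T * k.-tuple pt => G (p.1, tval p.2 : cf)) @^-1` B)))).
  apply: bigcup_measurable => k _; apply: measurableI.
    by rewrite -[X in measurable X]setTI; apply: measurable_snd => //; exact: measurable_size_eq.
  rewrite -[X in measurable X]setTI.
  have : measurable_fun setT (fun p : T * cf => (p.1, to_tuple k p.2)).
    by apply/measurable_fun_pair => //; exact: measurableT_comp (@measurable_to_tuple k) _.
  by apply => //; rewrite -[X in measurable X]setTI; exact: mG.
have toK (s : cf) : tval (to_tuple (size (s : seq pt)) s) = s.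
  by rewrite /to_tuple /insubd insubT.
apply/seteqP; split => -[t s] /=.
  move=> Bs; exists (size (s : seq pt)) => //=; split=> //.
  by rewrite toK.
by move=> [k _ [/= sk]]; rewrite -sk toK.
Qed.

(** Induction on the length: each slice is [step] applied to the head, the tail and the preceding
    slice. Sums, products, filters and concatenations over a configuration are instances. *)
Lemma measurable_conf_rec d' (U : measurableType d') (G : T * cf -> U)
    (step : (T * (pt * cf)) * U -> U) :
  measurable_fun setT (fun t => G (t, [::])) ->
  measurable_fun setT step ->
  (forall t x (s : cf), G (t, x :: s : cf) = step ((t, (x, s)), G (t, s))) ->
  measurable_fun [set: T * cf] G.
Proof.
move=> m0 mstep Gcons; apply: measurable_conf_slices; elim=> [|k IH].
  rewrite (_ : (fun p => _) = (fun t => G (t, [::])) \o fst).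
    exact: measurableT_comp.
  by apply/funext => -[t v] /=; rewrite (tuple0 v).
rewrite (_ : (fun p => _) =
  step \o (fun p : T * k.+1.-tuple pt =>
    ((p.1, (thead p.2, tval [tuple of behead p.2] : cf)),
     G (p.1, tval [tuple of behead p.2] : cf)))).
  have mb : measurable_fun setT
      (fun p : T * k.+1.-tuple pt => [tuple of behead p.2]).
    exact: (measurableT_comp (@measurable_behead _ _ k)).
  apply: measurableT_comp => //; apply/measurable_fun_pair.
    apply/measurable_fun_pair => //; apply/measurable_fun_pair.
      exact: (measurableT_comp (@measurable_tnth _ pt _ ord0)).
    exact: (measurableT_comp (@measurable_tval k)).
  have m2 : measurable_fun setT
      (fun p : T * k.+1.-tuple pt => (p.1, [tuple of behead p.2])).
    exact/measurable_fun_pair.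
  exact: (measurableT_comp IH m2).
apply/funext => -[t v] /=; rewrite -Gcons.
by congr (G (_, _)); rewrite [in LHS](tuple_eta v).
Qed.

End param.

Lemma measurable_cons_conf d (T : measurableType d) (f : T -> pt) (g : T -> cf) :
  measurable_fun setT f -> measurable_fun setT g ->
  measurable_fun setT (fun t => f t :: g t : cf).
Proof.
move=> mf mg.
have mc : measurable_fun [set: pt * cf] (fun p => p.1 :: p.2 : cf).
  apply: measurable_conf_slices => k.
  rewrite (_ : (fun p => _) = (fun t : k.+1.-tuple pt => tval t : cf) \o
     (fun p : pt * k.-tuple pt => [the k.+1.-tuple pt of p.1 :: p.2]))//.
  apply: measurableT_comp; first exact: measurable_tval.
  exact: measurable_cons.
have mp : measurable_fun setT (fun t => (f t, g t)) by exact/measurable_fun_pair.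
exact: (measurableT_comp mc mp).
Qed.

Lemma measurable_cat_conf :
  measurable_fun [set: cf * cf] (fun p => p.2 ++ p.1 : cf).
Proof.
apply: (@measurable_conf_rec _ cf _ cf (fun p => p.2 ++ p.1 : cf)
  (fun q => q.1.2.1 :: q.2 : cf)) => //.
  exact: measurable_id.
apply: (@measurable_cons_conf _ _ (fun q => q.1.2.1) (fun q => q.2)).
  exact: (measurableT_comp measurable_fst (measurableT_comp measurable_snd measurable_fst)).
exact: measurable_snd.
Qed.

Lemma measurable_sum_conf d (T : measurableType d) (g : T * pt -> \bar R) :
  measurable_fun setT g ->
  measurable_fun [set: T * cf] (fun p => \sum_(x <- (p.2 : seq pt)) g (p.1, x))%E.
Proof.
move=> mg.
apply: (@measurable_conf_rec _ _ _ _ _ (fun q => g (q.1.1, q.1.2.1) + q.2)%E).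
- by under eq_fun do rewrite big_nil; exact: measurable_cst.
- apply: emeasurable_funD => //.
  have m : measurable_fun setT
      (fun q : (T * (pt * cf)) * \bar R => (q.1.1, q.1.2.1)).
    apply/measurable_fun_pair; first exact: measurableT_comp.
    exact: (measurableT_comp measurable_fst (measurableT_comp measurable_snd measurable_fst)).
  exact: (measurableT_comp mg m).
- by move=> t x s /=; rewrite big_cons.
Qed.

Lemma measurable_prod_conf d (T : measurableType d) (g : T * pt -> R) :
  measurable_fun setT g ->
  measurable_fun [set: T * cf] (fun p => \prod_(x <- (p.2 : seq pt)) g (p.1, x)).
Proof.
move=> mg.
apply: (@measurable_conf_rec _ _ _ _ _ (fun q => g (q.1.1, q.1.2.1) * q.2)).
- by under eq_fun do rewrite big_nil; exact: measurable_cst.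
- apply: measurable_funM => //.
  have m : measurable_fun setT
      (fun q : (T * (pt * cf)) * R => (q.1.1, q.1.2.1)).
    apply/measurable_fun_pair; first exact: measurableT_comp.
    exact: (measurableT_comp measurable_fst (measurableT_comp measurable_snd measurable_fst)).
  exact: (measurableT_comp mg m).
- by move=> t x s /=; rewrite big_cons.
Qed.

Lemma measurable_all_conf d (T : measurableType d) (g : T * pt -> bool) :
  measurable_fun setT g ->
  measurable_fun [set: T * cf] (fun p => all (fun x => g (p.1, x)) (p.2 : seq pt)).
Proof.
move=> mg.
apply: (@measurable_conf_rec _ _ _ _ _ (fun q => g (q.1.1, q.1.2.1) && q.2)) => //.
apply: measurable_and => //.
have m : measurable_fun setT
    (fun q : (T * (pt * cf)) * bool => (q.1.1, q.1.2.1)).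
  apply/measurable_fun_pair; first exact: measurableT_comp.
  exact: (measurableT_comp measurable_fst (measurableT_comp measurable_snd measurable_fst)).
exact: (measurableT_comp mg m).
Qed.

Lemma measurable_filter_conf d (T : measurableType d) (g : T * pt -> bool) :
  measurable_fun setT g ->
  measurable_fun [set: T * cf]
    (fun p => [seq x <- (p.2 : seq pt) | g (p.1, x)] : cf).
Proof.
move=> mg.
apply: (@measurable_conf_rec _ T _ cf
  (fun p => [seq x <- (p.2 : seq pt) | g (p.1, x)] : cf)
  (fun q : (T * (pt * cf)) * cf => (if g (q.1.1, q.1.2.1)
  then q.1.2.1 :: q.2 : cf else q.2))) => //.
have m1 : measurable_fun setT
    (fun q : (T * (pt * cf)) * cf => q.1.2.1).
  exact: (measurableT_comp measurable_fst (measurableT_comp measurable_snd measurable_fst)).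
apply: measurable_fun_ifT => //.
- have m : measurable_fun setT
      (fun q : (T * (pt * cf)) * cf => (q.1.1, q.1.2.1)).
    by apply/measurable_fun_pair => //; exact: measurableT_comp.
  exact: (measurableT_comp mg m).
- by apply: (@measurable_cons_conf _ _ (fun q => q.1.2.1) (fun q => q.2)) => //; exact: measurable_snd.
Qed.

Lemma measurable_size_fun (c : nat -> \bar R) :
  measurable_fun [set: cf] (fun s => c (size (s : seq pt))).
Proof.
move=> _ B mB; rewrite setTI; apply/conf_measurableP => k.
have [ck|nck] := pselect (B (c k)).
  rewrite (_ : [set t | _] = setT)//; apply/seteqP; split=> // t _ /=.
  by rewrite size_tuple.
rewrite (_ : [set t | _] = set0)//; apply/seteqP; split=> // t /=.
by rewrite size_tuple.
Qed.

End ConfMeasurable.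

(** * Iterated integrals as s-finite measures *)

Section kconst.
Local Open Scope ereal_scope.
Context d d' (X : measurableType d) (Y : measurableType d') (R : realType).

Section kconst_measure.
Variable mu : {measure set Y -> \bar R}.
(** A constant kernel lets an s-finite measure enter kernel composition and the measurability
    theorem for integrals with a parameter. [kconst], [kconst_fin] and [kconst_sfin] are the stages
    measure, finite and s-finite. *)
Definition kconst (x : X) : {measure set Y -> \bar R} := mu.
Let mkconst U : measurable U -> measurable_fun [set: X] (kconst ^~ U).
Proof. by move=> mU; exact: measurable_cst. Qed.
HB.instance Definition _ := isKernel.Build _ _ X Y R kconst mkconst.
End kconst_measure.

Section kconst_fin.
Variable mu : {finite_measure set Y -> \bar R}.
Definition kconst_fin (x : X) : {measure set Y -> \bar R} := mu.
HB.instance Definition _ := Kernel.copy kconst_fin (kconst mu).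
Let kconst_uub : measure_fam_uub kconst_fin.
Proof.
exists (fine (mu setT) + 1)%R => x.
have /fineK h : mu setT \is a fin_num by exact: fin_num_measure.
by rewrite -[X in X < _]h lte_fin ltrDl.
Qed.
HB.instance Definition _ := @Kernel_isFinite.Build _ _ X Y R kconst_fin kconst_uub.
End kconst_fin.

Section kconst_sfin.
Variable mu : {sfinite_measure set Y -> \bar R}.
Definition kconst_sfin (x : X) : {measure set Y -> \bar R} := mu.
HB.instance Definition _ := Kernel.copy kconst_sfin (kconst mu).
Let kconst_sf : exists s : (R.-fker X ~> Y)^nat,
    forall x U, measurable U -> kconst_sfin x U = kseries s x U.
Proof.
exists (fun n => kconst_fin (sfinite_measure_seq mu n)) => x U mU.
exact: sfinite_measure_seqP.
Qed.
HB.instance Definition _ := @Kernel_isSFinite.Build _ _ X Y R kconst_sfin kconst_sf.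
End kconst_sfin.

End kconst.

Lemma sfinite_pack d (T : measurableType d) (R : realType)
    (mu : {measure set T -> \bar R}) : sfinite_measure mu ->
  exists nu : {sfinite_measure set T -> \bar R}, mu = nu :> (set T -> \bar R).
Proof.
move=> smu.
pose S := isSFinite.Build d T R mu smu.
pose nu : {sfinite_measure set T -> \bar R} := HB.pack (mu : set T -> \bar R) S mu.
by exists nu.
Qed.

(** [mu] is the image under [h] of the product of [m1] and [m2], obtained by composing two constant
    kernels with the Dirac kernel of [h]; kernel composition keeps it s-finite. With [h] a cons, it
    adds one variable to an iterated integral. *)
Lemma sfinite_bind d1 d2 d3 (X : measurableType d1) (Y : measurableType d2)
    (Z : measurableType d3) (R : realType)
    (m1 : {sfinite_measure set X -> \bar R})
    (m2 : {sfinite_measure set Y -> \bar R}) (h : X * Y -> Z) :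
  measurable_fun setT h ->
  exists mu : {sfinite_measure set Z -> \bar R},
    forall f : Z -> \bar R, (forall z, 0 <= f z)%E -> measurable_fun setT f ->
      (\int[mu]_z f z = \int[m1]_x \int[m2]_y f (h (x, y)))%E.
Proof.
move=> mh.
have mh' : measurable_fun setT (fun p : (unit * X) * Y => h (p.1.2, p.2)).
  have m : measurable_fun setT (fun p : (unit * X) * Y => (p.1.2, p.2)).
    by apply/measurable_fun_pair => //; exact: (measurableT_comp measurable_snd measurable_fst).
  exact: (measurableT_comp mh m).
pose kd : R.-sfker _ ~> _ := kdirac mh'.
pose k2 : R.-sfker (unit * X)%type ~> Z :=
  mkcomp (kconst_sfin m2 : R.-sfker (unit * X)%type ~> Y) kd.
pose k : R.-sfker unit ~> Z := mkcomp (kconst_sfin m1 : R.-sfker unit ~> X) k2.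
have [nu nuE] := sfinite_pack (sfinite_kernel_measure k tt).
exists nu => f f0 mf; rewrite -nuE.
rewrite integral_kcomp//; apply: eq_integral => x _.
rewrite integral_kcomp//; apply: eq_integral => y _.
by rewrite /= integral_dirac// diracT mul1e.
Qed.

Lemma sfinite_sum d (T : measurableType d) (R : realType)
    (m : nat -> {sfinite_measure set T -> \bar R}) :
  exists mu : {sfinite_measure set T -> \bar R},
    forall f : T -> \bar R, (forall x, 0 <= f x)%E -> measurable_fun setT f ->
      (\int[mu]_x f x = \sum_(0 <= k <oo) \int[m k]_x f x)%E.
Proof.
pose k : R.-sfker unit ~> T :=
  kseries (fun n => kconst_sfin (m n) : R.-sfker unit ~> T).
have [nu nuE] := sfinite_pack (sfinite_kernel_measure k tt).
by exists nu => f f0 mf; rewrite -nuE integral_kseries.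
Qed.

Lemma measurable_integral_param d d' (T : measurableType d) (Y : measurableType d')
    (R : realType) (mu : {sfinite_measure set Y -> \bar R}) (f : T * Y -> \bar R) :
  (forall p, 0 <= f p)%E -> measurable_fun setT f ->
  measurable_fun setT (fun t => \int[mu]_y f (t, y))%E.
Proof.
by move=> f0 mf; exact: (measurable_fun_integral_sfinite_kernel f (kconst_sfin mu)).
Qed.

Section IntegralRepresentation.
Context {R : realType} {dim : nat}.
Notation pt := (dim.-tuple R).
Notation cf := (@confT R dim).

Lemma intR_sfinite (m : nat) :
  exists mu : {sfinite_measure set (m.-tuple R) -> \bar R},
    forall f : m.-tuple R -> \bar R, (forall z, 0 <= f z)%E ->
      measurable_fun setT f -> (intR f = \int[mu]_z f z)%E.
Proof.
elim: m => [|m [mu IH]].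
  exists (dirac ([tuple] : 0.-tuple R)) => f f0 mf.
  by rewrite integral_dirac// diracT mul1e.
have mc : measurable_fun setT (fun p : measurableTypeR R * m.-tuple R =>
    cons_tuple (p.1 : R) p.2 : m.+1.-tuple R).
  exact: (measurable_cons (T2 := R) (f := fun p : measurableTypeR R * m.-tuple R => p.1 : R)
    measurable_fst measurable_snd).
have [nu nuE] := sfinite_bind (lebesgue_measure : {sfinite_measure set (measurableTypeR R) -> \bar R}) mu mc.
exists nu => f f0 mf; rewrite nuE//=; apply: eq_integral => t _.
rewrite IH//; apply: measurableT_comp => //.
exact: (measurableT_comp mc (pair1_measurable t)).
Qed.

(** Lebesgue measure on R^dim, known only through [intR_ptmeas]. *)
Definition ptmeas : {sfinite_measure set pt -> \bar R} := sval (cid (intR_sfinite dim)).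

Lemma intR_ptmeas (f : pt -> \bar R) : (forall z, 0 <= f z)%E ->
  measurable_fun setT f -> (intR f = \int[ptmeas]_z f z)%E.
Proof. by rewrite /ptmeas; case: cid => mu /= h; exact: h. Qed.

Lemma intpts_sfinite (k : nat) :
  exists mu : {sfinite_measure set cf -> \bar R},
    forall f : cf -> \bar R, (forall z, 0 <= f z)%E ->
      measurable_fun setT f -> (intpts k f = \int[mu]_z f z)%E.
Proof.
elim: k => [|k [mu IH]].
  exists (dirac ([::] : cf)) => f f0 mf.
  by rewrite integral_dirac// diracT mul1e.
have mc : measurable_fun setT (fun p : pt * cf => p.1 :: p.2 : cf).
  by apply: (measurable_cons_conf (f := fst) (g := snd)).
have [nu nuE] := sfinite_bind ptmeas mu mc.
exists nu => f f0 mf; rewrite nuE//=.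
have mfc : measurable_fun setT (fun p : pt * cf => f (p.1 :: p.2 : cf)).
  exact: (measurableT_comp mf mc).
rewrite -intR_ptmeas; last 2 first.
- by move=> z; exact: integral_ge0.
- exact: (measurable_integral_param mu (f := fun p : pt * cf => f (p.1 :: p.2 : cf))).
congr intR; apply/funext => t.
rewrite IH//.
exact: (measurableT_comp mfc (pair1_measurable t)).
Qed.

Definition ptsmeas k : {sfinite_measure set cf -> \bar R} := sval (cid (intpts_sfinite k)).

Lemma intpts_ptsmeas k (f : cf -> \bar R) : (forall z, 0 <= f z)%E ->
  measurable_fun setT f -> (intpts k f = \int[ptsmeas k]_z f z)%E.
Proof. by rewrite /ptsmeas; case: cid => mu /= h; exact: h. Qed.

(** Sum over [k] of Lebesgue measure on [k] ordered points. The Poisson factor [1/k!] is left out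
    and returns as the density [ifact]. *)
Definition confmeas : {sfinite_measure set cf -> \bar R} := sval (cid (sfinite_sum ptsmeas)).

Lemma sum_intpts (f : cf -> \bar R) : (forall z, 0 <= f z)%E ->
  measurable_fun setT f ->
  (\sum_(0 <= k <oo) intpts k f = \int[confmeas]_z f z)%E.
Proof.
rewrite /confmeas; case: cid => mu /= h f0 mf; rewrite h//.
by apply: eq_eseriesr => k _; rewrite intpts_ptsmeas.
Qed.

Lemma eq_intpts k (f g : seq pt -> \bar R) :
  (forall s, size s = k -> f s = g s) -> intpts k f = intpts k g.
Proof.
elim: k f g => [|k IH] f g fg /=; first exact: fg.
by congr intR; apply/funext => x; apply: IH => s sk; apply: fg; rewrite /= sk.
Qed.

End IntegralRepresentation.

(** * Volumes of boxes and shells *)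

Section Indicators.
Context {R : realType}.

Lemma measurable_of_bool d d' (T : measurableType d) (U : measurableType d')
    (g : T -> bool) (c : bool -> U) :
  measurable_fun setT g -> measurable_fun setT (fun t => c (g t)).
Proof.
move=> mg; have mc : measurable_fun [set: bool] c by [].
exact: (measurableT_comp mc mg).
Qed.

Definition ind (b : bool) : \bar R := (b%:R)%:E.

Lemma ind_ge0 b : (0 <= ind b)%E. Proof. by rewrite lee_fin. Qed.

#[local] Hint Resolve ind_ge0 : core.

Lemma ind_le1 b : (ind b <= 1)%E. Proof. by rewrite lee_fin lern1; case: b. Qed.

Lemma measurable_ind d (T : measurableType d) (g : T -> bool) :
  measurable_fun setT g -> measurable_fun setT (fun t => ind (g t)).
Proof. exact: measurable_of_bool. Qed.

Lemma measurable_sum_seq d (T : measurableType d) (I : Type) (r : seq I)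
    (F : I -> T -> R) :
  (forall i, measurable_fun setT (F i)) ->
  measurable_fun setT (fun x => \sum_(i <- r) F i x).
Proof.
move=> mF; elim: r => [|i r IH]; first by under eq_fun do rewrite big_nil; exact: measurable_cst.
by under eq_fun do rewrite big_cons; exact: measurable_funD.
Qed.

Lemma le_intR m (f g : m.-tuple R -> \bar R) :
  measurable_fun setT f -> measurable_fun setT g ->
  (forall x, 0 <= f x)%E -> (forall x, f x <= g x)%E -> (intR f <= intR g)%E.
Proof.
move=> mf mg f0 fg; have [mu muE] := @intR_sfinite R m; rewrite !muE//.
  by apply: ge0_le_integral.
by move=> x; exact: le_trans (fg x).
Qed.

Lemma intR0 m : intR (fun _ : m.-tuple R => 0%E) = 0%E.
Proof.
elim: m => [//|m IH] /=; apply: integral0_eq => t _; exact: IH.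
Qed.

Lemma intR_box m (a b : 'I_m -> R) : (forall i, a i <= b i) ->
  intR (fun x : m.-tuple R => ind [forall i, a i <= tnth x i <= b i]) =
  (\prod_(i < m) (b i - a i))%:E.
Proof.
elim: m a b => [|m IH] a b ab /=.
  by rewrite big_ord0 /ind (_ : [forall i, _])//; apply/forallP => -[].
pose a' i := a (lift ord0 i); pose b' i := b (lift ord0 i).
have E (t : R) (v : m.-tuple R) :
    [forall i, a i <= tnth (cons_tuple t v) i <= b i] =
    (a ord0 <= t <= b ord0) && [forall i, a' i <= tnth v i <= b' i].
  apply/forallP/andP.
    move=> h; split; first exact: (h ord0).
    by apply/forallP => i; have := h (lift ord0 i); rewrite tnthS.
  move=> [h0 /forallP h] i.
  case: (unliftP ord0 i) => [j ->|-> //]; rewrite tnthS; exact: h.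
transitivity (\int[lebesgue_measure]_(t in `[a ord0, b ord0]%classic)
   (\prod_(i < m) (b' i - a' i))%:E)%E.
  rewrite [RHS]integral_mkcond; apply: eq_integral => t _; rewrite patchE.
  rewrite (_ : (fun v => _) = (fun v : m.-tuple R => ind ((a ord0 <= t <= b ord0) &&
      [forall i, a' i <= tnth v i <= b' i]))); last by apply/funext => v; rewrite E.
  rewrite mem_setE in_itv /=; case: ifPn => ht /=.
    by apply: IH => i; exact: ab.
  exact: intR0.
rewrite integral_cst//= lebesgue_measure_itv/= big_ord_recl mulrC EFinM.
rewrite lte_fin; have := ab ord0; rewrite le_eqVlt => /predU1P[->|->].
  by rewrite ltxx subrr.
by rewrite EFinB.
Qed.

Lemma measurable_sqdist m (c : m.-tuple R) :
  measurable_fun setT (fun x : m.-tuple R => \sum_(i < m) (tnth x i - tnth c i) ^+ 2).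
Proof.
apply: measurable_sum_seq => i; apply: measurable_funX.
by apply: measurable_funB; [exact: measurable_tnth|exact: measurable_cst].
Qed.

Lemma measurable_ind_itv (i : interval R) :
  measurable_fun [set: measurableTypeR R] (fun t : R => ind (t \in i)).
Proof.
apply: measurable_ind; apply: (@measurable_fun_bool _ _ _ _ true).
by rewrite setTI (_ : _ @^-1` _ = [set` i])//; apply/seteqP; split.
Qed.

Lemma integral_ind_itv (x y : R) : x <= y ->
  (\int[lebesgue_measure]_(t in [set: measurableTypeR R]) ind (t \in `[x, y])%R = (y - x)%:E)%E.
Proof.
move=> xy.
transitivity (\int[lebesgue_measure]_(t in [set: measurableTypeR R])
    (\1_(`[x, y]%classic : set (measurableTypeR R)) t)%:E)%E.
  by apply: eq_integral => t _; rewrite indicE mem_setE.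
rewrite integral_indic//= setIT lebesgue_measure_itv/= lte_fin.
by move: xy; rewrite le_eqVlt => /predU1P[->|->]; rewrite ?ltxx ?subrr// EFinB.
Qed.

(* Subadditivity of the square root gives [sqrt p - sqrt q <= sqrt (p - q)]. *)
Lemma annulus1_le (A B u c : R) : A <= B ->
  (\int[lebesgue_measure]_(t in [set: measurableTypeR R]) ind (A < u + (t - c) ^+ 2 <= B)%R
   <= (2 * Num.sqrt (B - A))%:E)%E.
Proof.
move=> AB.
set p := B - u; set q := A - u.
have pq : Num.sqrt p - Num.sqrt q <= Num.sqrt (B - A).
  have [p0|p0] := leP p 0; first by rewrite (ler0_sqrtr p0) sub0r (le_trans _ (sqrtr_ge0 _))// oppr_le0 sqrtr_ge0.
  rewrite lerBlDr -(@ler_pXn2r _ 2)// ?nnegrE ?addr_ge0 ?sqrtr_ge0//.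
  have s1 : Num.sqrt (B - A) ^+ 2 = B - A by rewrite sqr_sqrtr// subr_ge0.
  have s2 : Num.sqrt p ^+ 2 = p by rewrite sqr_sqrtr// ltW.
  have q2 : q <= Num.sqrt q ^+ 2.
    by have [q0|q0] := leP q 0; [rewrite (le_trans q0)// sqr_ge0|rewrite sqr_sqrtr// ltW].
  have s3 := mulr_ge0 (sqrtr_ge0 (B - A)) (sqrtr_ge0 q).
  rewrite s2 sqrrD s1 (_ : p = B - A + q); last by rewrite /p /q; ring.
  by lra.
have sp : Num.sqrt q <= Num.sqrt p by rewrite ler_wsqrtr// lerB.
(* [Num.sqrt] is 0 at negative arguments, so for [q < 0] the two intervals meet at [c] and no case
   split on the sign of [q] is needed. *)
pose f (t : R) : \bar R := (ind (t \in `[c + Num.sqrt q, c + Num.sqrt p])%R +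
   ind (t \in `[c - Num.sqrt p, c - Num.sqrt q])%R)%E.
apply: (@le_trans _ _ (\int[lebesgue_measure]_(t in [set: measurableTypeR R]) f t)%E).
  apply: ge0_le_integral => //.
  - have ms : measurable_fun [set: measurableTypeR R] (fun t : R => u + (t - c) ^+ 2).
      apply: measurable_funD => //; apply: measurable_funX.
      by apply: measurable_funB => //; exact: measurable_id.
    have mb : measurable_fun [set: measurableTypeR R] (fun t : R => A < u + (t - c) ^+ 2 <= B).
      by apply: measurable_and; [exact: measurable_fun_ltr|exact: measurable_fun_ler].
    exact: (measurable_ind mb).
  - by apply: emeasurable_funD; exact: measurable_ind_itv.
  - move=> t _; rewrite /f; case: (boolP (_ < _ <= _)); last first.
      by move=> _; rewrite adde_ge0// ind_ge0.
    move=> /andP[h1 h2].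
    have hp : `|t - c| <= Num.sqrt p.
      rewrite -sqrtr_sqr ler_wsqrtr// /p lerBrDl//.
    have hq : Num.sqrt q <= `|t - c|.
      by rewrite -sqrtr_sqr ler_wsqrtr// /q lerBlDl// ltW.
    rewrite /= !in_itv /=.
    have [tc|tc] := leP 0 (t - c).
      move: hp hq; rewrite ger0_norm// lerBlDl lerBrDl => -> ->.
      by rewrite /ind/= -EFinD lee_fin lerDl.
    move: hp hq; rewrite ltr0_norm// => hp hq.
    have -> : c - Num.sqrt p <= t <= c - Num.sqrt q by apply/andP; split; lra.
    by rewrite /ind/= -EFinD lee_fin lerDr.
rewrite ge0_integralD//; [|exact: measurable_ind_itv|exact: measurable_ind_itv].
rewrite !integral_ind_itv; [|by rewrite lerB//|by rewrite lerD2l].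
by rewrite -EFinD lee_fin; lra.
Qed.

Lemma intRS m (f : m.+1.-tuple R -> \bar R) : intR f =
  (\int[lebesgue_measure]_(t in [set: R]) intR (fun v : m.-tuple R => f (cons_tuple t v)))%E.
Proof. by []. Qed.

(** One coordinate is integrated out at a time, its square being moved into [u]. A slice is empty
    unless the coordinate lies within [sqrt B] of the centre, whence a factor [2 * sqrt B]; only the
    last coordinate sees the thickness. For radii of order [L] with bounded difference, [B - A] has
    order [L], which gives [L^(d - 1/2)]: cruder than the surface order [L^(d - 1)], but enough. *)
Lemma shell_le m (c : m.+1.-tuple R) (A B u : R) : 0 <= u -> 0 <= B -> A <= B ->
  (intR (fun x : m.+1.-tuple R =>
     ind (A < u + \sum_(i < m.+1) (tnth x i - tnth c i) ^+ 2 <= B)%R)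
   <= ((2 * Num.sqrt B) ^+ m * (2 * Num.sqrt (B - A)))%:E)%E.
Proof.
elim: m c u => [|m IH] c u u0 B0 AB.
  rewrite expr0 mul1r; apply: le_trans (annulus1_le u (tnth c ord0) AB).
  by rewrite /=; under eq_integral do rewrite big_ord1.
pose K : R := (2 * Num.sqrt B) ^+ m * (2 * Num.sqrt (B - A)).
have K0 : 0 <= K by rewrite mulr_ge0 ?exprn_ge0 ?mulr_ge0 ?sqrtr_ge0.
rewrite intRS.
pose c0 := tnth c ord0; pose c' := [tuple of behead c].
pose G (p : R * m.+1.-tuple R) : \bar R :=
  ind (A < (u + (p.1 - c0) ^+ 2) + \sum_(i < m.+1) (tnth p.2 i - tnth c' i) ^+ 2 <= B)%R.
have mG : measurable_fun [set: measurableTypeR R * m.+1.-tuple R] G.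
  have ms : measurable_fun [set: measurableTypeR R * m.+1.-tuple R]
     (fun p => (u + (p.1 - c0) ^+ 2) + \sum_(i < m.+1) (tnth p.2 i - tnth c' i) ^+ 2).
    apply: measurable_funD.
      apply: measurable_funD => //; apply: measurable_funX; apply: measurable_funB => //.
    exact: (measurableT_comp (measurable_sqdist c')).
  by apply: measurable_ind; apply: measurable_and;
    [exact: measurable_fun_ltr|exact: measurable_fun_ler].
have [mu muE] := @intR_sfinite R m.+1.
have mF : measurable_fun [set: measurableTypeR R] (fun t => intR (fun v => G (t, v))).
  rewrite (_ : (fun t => _) = (fun t => \int[mu]_v G (t, v))%E).
    by apply: measurable_integral_param => // p; exact: ind_ge0.
  apply/funext => t; apply: muE => [v|]; first exact: ind_ge0.
  exact: (measurableT_comp mG (pair1_measurable (t : measurableTypeR R))).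
apply: (@le_trans _ _ (\int[lebesgue_measure]_(t in [set: measurableTypeR R])
   (K%:E * ind (t \in `[c0 - Num.sqrt B, c0 + Num.sqrt B])%R))%E); last first.
  rewrite ge0_integralZl//=; last exact: measurable_ind_itv.
  rewrite integral_ind_itv; last by have := sqrtr_ge0 B; lra.
  by rewrite -EFinM lee_fin exprS -mulrA -/K mulrC ler_wpM2r//; lra.
have KmG : measurable_fun [set: measurableTypeR R]
    (fun t : R => K%:E * ind (t \in `[c0 - Num.sqrt B, c0 + Num.sqrt B])%R)%E.
  by apply: emeasurable_funM => //; exact: measurable_ind_itv.
have E (t : R) : (\int[mu]_v G (t, v))%E = intR (fun v => G (t, v)).
  apply/esym; apply: muE => [v|]; first exact: ind_ge0.
  exact: (measurableT_comp mG (pair1_measurable (t : measurableTypeR R))).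
rewrite (_ : (fun t => _) = (fun t => intR (fun v => G (t, v)))); last first.
  apply/funext => t; congr intR; apply/funext => v; rewrite /G/= big_ord_recl/= addrA.
  rewrite (eq_bigr (fun i => (tnth v i - tnth c' i) ^+ 2))// => i _.
  by rewrite tnthS [in LHS](tuple_eta c) tnthS.
apply: ge0_le_integral => //.
- by move=> t _; rewrite -E; apply: integral_ge0 => v _; exact: ind_ge0.
- move=> t _; case: (boolP (t \in _)) => ht.
    have u'0 : 0 <= u + (t - c0) ^+ 2 by rewrite addr_ge0// sqr_ge0.
    by have := IH c' _ u'0 B0 AB; rewrite [ind true]/ind mule1.
  have {}ht : ~~ (c0 - Num.sqrt B <= t <= c0 + Num.sqrt B) by move: ht; rewrite in_itv.
  rewrite [ind false]/ind mule0.
  suff G0 v : G (t, v) = 0%E.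
    rewrite -[leRHS](@intR0 m.+1) le_eqVlt; apply/orP; left; apply/eqP.
    by congr intR; apply/funext => v; exact: G0.
  rewrite /G/=; case: (boolP (_ < _ <= _)) => // /andP[_ h].
  exfalso; move/negP: ht; apply.
  have : `|t - c0| <= Num.sqrt B.
    rewrite -sqrtr_sqr ler_wsqrtr// (le_trans _ h)// -addrA addrC -addrA ler_wpDr// addr_ge0//.
    by apply: sumr_ge0 => i _; exact: sqr_ge0.
  by rewrite ler_norml => /andP[h1 h2]; apply/andP; split; lra.
Qed.

End Indicators.

(** * Gibbs weights *)

Section GibbsMeasurability.
Context {R : realType} {dim : nat}.
Notation pt := (dim.-tuple R).
Notation cf := (@confT R dim).

Lemma measurable_expeR : measurable_fun setT (@expeR R).
Proof.
rewrite (_ : @expeR R = fun x => if x == -oo%E then 0%E else er_map expR x); last first.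
  by apply/funext => -[x| |].
apply: measurable_fun_ifT => //.
- apply: (@measurable_fun_bool _ _ _ _ true); rewrite setTI.
  rewrite (_ : _ @^-1` _ = [set -oo%E]); first exact: emeasurable_set1.
  by apply/seteqP; split => x /eqP.
- exact: (@measurable_er_map _ R R expR (@measurable_expR R)).
Qed.

Lemma measurable_pdiff : measurable_fun setT (fun p : pt * pt => pdiff p.1 p.2).
Proof.
apply/measurable_fun_tnthP => i.
rewrite (_ : _ \o _ = fun p : pt * pt => tnth p.1 i - tnth p.2 i); last first.
  by apply/funext => p /=; rewrite tnth_mktuple.
apply: measurable_funB.
  exact: (measurableT_comp (@measurable_tnth _ R dim i) measurable_fst).
exact: (measurableT_comp (@measurable_tnth _ R dim i) measurable_snd).
Qed.

Lemma measurable_pnorm : measurable_fun setT (@pnorm R dim).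
Proof.
have ms : measurable_fun [set: pt] (fun x => \sum_(i < dim) tnth x i ^+ 2).
  apply: measurable_sum_seq => i; apply: measurable_funX; exact: measurable_tnth.
exact: (measurableT_comp (continuous_measurable_fun (@sqrt_continuous R)) ms).
Qed.

Lemma measurable_pdist : measurable_fun setT (fun p : pt * pt => pnorm (pdiff p.1 p.2)).
Proof. exact: (measurableT_comp measurable_pnorm measurable_pdiff). Qed.

Lemma measurable_in_ball (L : R) :
  measurable_fun setT (fun p : pt * pt => `[< ball_pt p.1 L p.2 >]).
Proof.
rewrite (_ : (fun p => _) = (fun p : pt * pt => pnorm (pdiff p.2 p.1) <= L)); last first.
  by apply/funext => p; rewrite /ball_pt; apply/asboolP/idP.
apply: measurable_fun_ler => //.
have m : measurable_fun setT (fun p : pt * pt => (p.2, p.1)) by exact/measurable_fun_pair.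
exact: (measurableT_comp measurable_pdist m).
Qed.

Variable phi : pt -> \bar R.
Hypothesis mphi : measurable_fun setT phi.

Lemma measurable_phi_pdiff : measurable_fun setT (fun p : pt * pt => phi (pdiff p.1 p.2)).
Proof. exact: (measurableT_comp mphi measurable_pdiff). Qed.

Lemma measurable_energy : measurable_fun setT (fun s : cf => energy phi s).
Proof.
have m : measurable_fun [set: unit * cf] (fun p => energy phi p.2).
  apply: (@measurable_conf_rec _ _ _ unit _ _ (fun p => energy phi p.2)
    (fun q => (\sum_(y <- (q.1.2.2 : seq pt)) phi (pdiff q.1.2.1 y) + q.2)%E)) => //=.
  apply: emeasurable_funD => //.
  have m1 : measurable_fun setT (fun q : (unit * (pt * cf)) * \bar R => q.1.2).
    exact: (measurableT_comp measurable_snd measurable_fst).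
  have := measurable_sum_conf measurable_phi_pdiff => /= m2.
  exact: (measurableT_comp m2 m1).
have mt : measurable_fun [set: cf] (fun s => (tt, s)) by exact: pair1_measurable.
exact: (measurableT_comp m mt).
Qed.

Lemma measurable_cross : measurable_fun setT (fun p : cf * cf => cross phi p.2 p.1).
Proof.
rewrite /cross; apply: (@measurable_sum_conf _ _ _ cf
  (fun q => \sum_(z <- (q.1 : seq pt)) phi (pdiff q.2 z))%E).
have m := measurable_sum_conf measurable_phi_pdiff.
have m2 : measurable_fun setT (fun q : cf * pt => (q.2, q.1)).
  exact/measurable_fun_pair.
exact: (measurableT_comp m m2).
Qed.

Lemma measurable_weight d (T : measurableType d) (lam : T * pt -> R) (eta : T -> cf) :
  measurable_fun setT lam -> measurable_fun setT eta ->
  measurable_fun setT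
    (fun p : T * cf => weight phi (fun z => lam (p.1, z)) (eta p.1) p.2).
Proof.
move=> mlam meta; rewrite /weight; apply: emeasurable_funM.
  by apply/measurable_EFinP; exact: (measurable_prod_conf mlam).
have me : measurable_fun setT (fun p : T * cf => energy phi p.2).
  exact: (measurableT_comp measurable_energy measurable_snd).
have mc : measurable_fun setT (fun p : T * cf => cross phi p.2 (eta p.1)).
  have m : measurable_fun setT (fun p : T * cf => (eta p.1, p.2)).
    by apply/measurable_fun_pair => //; exact: (measurableT_comp meta measurable_fst).
  exact: (measurableT_comp measurable_cross m).
apply: (measurableT_comp measurable_expeR); apply: measurableT_comp => //.
exact: emeasurable_funD.
Qed.

End GibbsMeasurability.

(** * Gibbs weights as densities, and bounds on the partition function *)

Section GibbsIntegral.
Context {R : realType} {dim : nat}.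
Notation pt := (dim.-tuple R).
Notation cf := (@confT R dim).
Variable phi : pt -> \bar R.
Hypothesis mphi : measurable_fun setT phi.
Hypothesis phi0 : forall x, (0 <= phi x)%E.

Lemma energy_ge0 s : (0 <= energy phi s)%E.
Proof. by elim: s => //= x s IH; rewrite adde_ge0// sume_ge0. Qed.

Lemma cross_ge0 s t : (0 <= cross phi s t)%E.
Proof. by apply: sume_ge0 => x _; apply: sume_ge0. Qed.

Lemma prod_act_ge0 (lam : pt -> R) (s : seq pt) :
  (forall x, 0 <= lam x) -> 0 <= \prod_(x <- s) lam x.
Proof. by move=> l0; apply: prodr_ge0. Qed.

Lemma weight_ge0 lam eta s : (forall x, 0 <= lam x) -> (0 <= weight phi lam eta s)%E.
Proof.
by move=> l0; rewrite /weight mule_ge0 ?expeR_ge0// lee_fin prod_act_ge0.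
Qed.

Lemma weight_le lam eta s : (forall x, 0 <= lam x) ->
  (weight phi lam eta s <= (\prod_(x <- s) lam x)%:E)%E.
Proof.
move=> l0; rewrite /weight -[leRHS]mule1 lee_wpmul2l ?lee_fin ?prod_act_ge0//.
by rewrite -expeR0 lee_expeR oppe_le0 adde_ge0 ?energy_ge0 ?cross_ge0.
Qed.

Lemma weight_eq0 lam eta s : ~~ all (fun x => lam x != 0) s ->
  weight phi lam eta s = 0%E.
Proof.
move=> /allPn[x xs]; rewrite negbK => /eqP lx.
by rewrite /weight (_ : \prod_(x <- s) lam x = 0) ?mul0e// (big_rem x)//= lx mul0r.
Qed.

Definition ifact (s : seq pt) : \bar R := ((size s)`!%:R^-1)%:E.

Lemma ifact_ge0 s : (0 <= ifact s)%E.
Proof. by rewrite lee_fin invr_ge0. Qed.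

Lemma measurable_ifact : measurable_fun setT (fun s : cf => ifact s).
Proof. exact: (measurable_size_fun (fun n => (n`!%:R^-1)%:E)). Qed.

Lemma sum_intpts_fact (G : cf -> \bar R) : (forall s, 0 <= G s)%E ->
  measurable_fun setT G ->
  (\sum_(0 <= k <oo) (k`!%:R^-1)%:E * intpts k G = \int[confmeas]_s (G s * ifact s))%E.
Proof.
move=> G0 mG; rewrite -sum_intpts; last 2 first.
- by move=> s; rewrite mule_ge0// ifact_ge0.
- by apply: emeasurable_funM => //; exact: measurable_ifact.
apply: eq_eseriesr => k _; rewrite intpts_ptsmeas// -ge0_integralZl//=.
rewrite -intpts_ptsmeas; last 2 first.
- by move=> s; rewrite mule_ge0// lee_fin invr_ge0.
- exact: emeasurable_funM.
by apply: eq_intpts => s sk; rewrite /ifact sk muleC.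
Qed.

Section fixed.
Variables (lam : pt -> R) (eta : cf).
Hypothesis mlam : measurable_fun setT lam.
Hypothesis lam0 : forall x, 0 <= lam x.

Lemma measurable_weight1 : measurable_fun setT (fun s : cf => weight phi lam eta s).
Proof.
have ml : measurable_fun setT (fun p : unit * pt => lam p.2).
  exact: (measurableT_comp mlam measurable_snd).
have m := measurable_weight mphi ml (measurable_cst eta).
exact: (measurableT_comp m (pair1_measurable tt)).
Qed.

Definition gdens (s : cf) : \bar R := (weight phi lam eta s * ifact s)%E.

Lemma gdens_ge0 s : (0 <= gdens s)%E.
Proof. by rewrite mule_ge0 ?weight_ge0// ifact_ge0. Qed.

Lemma measurable_gdens : measurable_fun setT gdens.
Proof.
by apply: emeasurable_funM; [exact: measurable_weight1|exact: measurable_ifact].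
Qed.

Lemma massE (F : cf -> \bar R) : (forall s, 0 <= F s)%E -> measurable_fun setT F ->
  mass phi lam eta F = (\int[confmeas]_s (F s * gdens s))%E.
Proof.
move=> F0 mF; rewrite /mass sum_intpts_fact.
- by apply: eq_integral => s _; rewrite /gdens -muleA.
- by move=> s; rewrite mule_ge0 ?weight_ge0//.
- by apply: emeasurable_funM => //; exact: measurable_weight1.
Qed.

(** The term [k = 0] is the empty configuration, of weight 1. *)
Lemma mass1_ge1 : (1 <= mass phi lam eta (fun=> 1))%E.
Proof.
rewrite /mass nneseries_recl//; last first.
  move=> k _; rewrite mule_ge0 ?lee_fin ?invr_ge0//.
  rewrite intpts_ptsmeas.
  - by apply: integral_ge0 => s _; rewrite mule_ge0 ?weight_ge0//.
  - by move=> s; rewrite mule_ge0 ?weight_ge0//.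
  - by apply: emeasurable_funM => //; exact: measurable_weight1.
rewrite /= /weight /cross !big_nil adde0 oppe0 expeR0 !mule1 invr1.
rewrite leeDl// nneseries_ge0// => k _ _; rewrite mule_ge0 ?lee_fin ?invr_ge0//.
rewrite intpts_ptsmeas.
- by apply: integral_ge0 => s _; rewrite mule_ge0 ?weight_ge0//.
- by move=> s; rewrite mule_ge0 ?weight_ge0//.
- by apply: emeasurable_funM => //; exact: measurable_weight1.
Qed.

Lemma intpts_prod (V : R) k : intR (fun x => (lam x)%:E) = V%:E ->
  intpts k (fun s => (\prod_(x <- s) lam x)%:E) = (V ^+ k)%:E.
Proof.
move=> VE; elim: k => [|k IH] /=; first by rewrite big_nil.
have V0 : 0 <= V.
  rewrite -lee_fin -VE intR_ptmeas; last by exact/measurable_EFinP.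
    by apply: integral_ge0 => x _; rewrite lee_fin.
  by move=> x; rewrite lee_fin.
have mprod : measurable_fun setT (fun s : cf => (\prod_(x <- (s : seq pt)) lam x)%:E).
  have ml : measurable_fun setT (fun p : unit * pt => lam p.2).
    exact: (measurableT_comp mlam measurable_snd).
  apply/measurable_EFinP.
  exact: (measurableT_comp (measurable_prod_conf ml) (pair1_measurable tt)).
transitivity (intR (fun x : pt => (V ^+ k)%:E * (lam x)%:E))%E.
  congr intR; apply/funext => x.
  under (@eq_fun _ _ (fun s => (\prod_(x <- x :: s) lam x)%:E)) do rewrite big_cons EFinM.
  rewrite intpts_ptsmeas; last 2 first.
  - by move=> s; rewrite -EFinM lee_fin mulr_ge0// prod_act_ge0.
  - exact: emeasurable_funM.
  rewrite ge0_integralZl//=; last 2 first.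
  - by move=> s _; rewrite lee_fin prod_act_ge0.
  - by rewrite lee_fin.
  by rewrite -intpts_ptsmeas ?IH 1?muleC// => s; rewrite lee_fin prod_act_ge0.
rewrite intR_ptmeas; last 2 first.
- by move=> x; rewrite -EFinM lee_fin mulr_ge0// exprn_ge0.
- by apply: emeasurable_funM => //; exact/measurable_EFinP.
rewrite ge0_integralZl//=; last 3 first.
- exact/measurable_EFinP.
- by move=> x _; rewrite lee_fin.
- by rewrite lee_fin exprn_ge0.
rewrite -intR_ptmeas ?VE -?EFinM ?exprSr//; last exact/measurable_EFinP.
Qed.

(** Repulsion bounds the weight by the product of the activities, so the series is dominated term by
    term by that of [expR V]. *)
Lemma mass1_lty (V : R) : intR (fun x => (lam x)%:E) = V%:E ->
  (mass phi lam eta (fun=> 1%E) < +oo)%E.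
Proof.
move=> VE.
have V0 : 0 <= V.
  rewrite -lee_fin -VE intR_ptmeas; last by exact/measurable_EFinP.
    by apply: integral_ge0 => x _; rewrite lee_fin.
  by move=> x; rewrite lee_fin.
apply: (@le_lt_trans _ _ (expR V)%:E); last exact: ltry.
have mprod : measurable_fun setT (fun s : cf => (\prod_(x <- (s : seq pt)) lam x)%:E).
  have ml : measurable_fun setT (fun p : unit * pt => lam p.2).
    exact: (measurableT_comp mlam measurable_snd).
  apply/measurable_EFinP.
  exact: (measurableT_comp (measurable_prod_conf ml) (pair1_measurable tt)).
apply: lime_le.
  apply: is_cvg_nneseries => k _ _; rewrite mule_ge0 ?lee_fin ?invr_ge0//.
  rewrite intpts_ptsmeas.
  - by apply: integral_ge0 => s _; rewrite mule_ge0 ?weight_ge0//.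
  - by move=> s; rewrite mule_ge0 ?weight_ge0//.
  - by apply: emeasurable_funM => //; exact: measurable_weight1.
apply: nearW => n.
apply: (@le_trans _ _ (series (exp_coeff V) n)%:E); last first.
  rewrite lee_fin; apply: nondecreasing_cvgn_le; last exact: is_cvg_series_exp_coeff.
  apply/nondecreasing_series => k _ _; rewrite /exp_coeff/= divr_ge0 ?exprn_ge0//.
rewrite /series/= -sumEFin; apply: lee_sum => k _.
rewrite /exp_coeff/= mulrC EFinM lee_wpmul2l ?lee_fin ?invr_ge0//.
rewrite -(intpts_prod k VE) !intpts_ptsmeas; last 4 first.
- by move=> s; rewrite lee_fin prod_act_ge0.
- by [].
- by move=> s; rewrite mule_ge0 ?weight_ge0//.
- by apply: emeasurable_funM => //; exact: measurable_weight1.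
apply: ge0_le_integral => //.
- by move=> s _; rewrite mule_ge0 ?weight_ge0//.
- by apply: emeasurable_funM => //; exact: measurable_weight1.
- by move=> s _; rewrite mul1e weight_le.
Qed.

End fixed.
End GibbsIntegral.

Section Geometry.
Context {R : realType} {dim : nat}.
Notation pt := (dim.-tuple R).

Lemma pnorm_ge0 (x : pt) : 0 <= pnorm x. Proof. exact: sqrtr_ge0. Qed.

Lemma pnorm_sqr (x : pt) : pnorm x ^+ 2 = \sum_(i < dim) tnth x i ^+ 2.
Proof. by rewrite sqr_sqrtr// sumr_ge0// => i _; exact: sqr_ge0. Qed.

Lemma coord_le_pnorm (x : pt) i : `|tnth x i| <= pnorm x.
Proof.
rewrite -sqrtr_sqr ler_wsqrtr// (bigD1 i)//= lerDl sumr_ge0// => j _.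
exact: sqr_ge0.
Qed.

Lemma measurable_box n : measurable (@box R dim n).
Proof.
have -> : @box R dim n = \bigcap_(i in [set: 'I_dim]) [set x | - n%:R <= tnth x i <= n%:R].
  by apply/seteqP; split => x /= h i; [move=> _; exact: h|exact: (h i I)].
apply: fin_bigcap_measurable => [|i _]; first exact: finite_finset.
have m : measurable_fun [set: pt] (fun x => - n%:R <= tnth x i <= n%:R).
  have mt := @measurable_tnth _ R dim i.
  by apply: measurable_and; apply: measurable_fun_ler => //; exact: measurable_cst.
have := m measurableT [set true] Logic.I; rewrite setTI.
by congr measurable; apply/seteqP; split.
Qed.

Lemma activity_int (lam : pt -> R) lambda : activity lam lambda ->
  exists V : R, intR (fun x => (lam x)%:E) = V%:E.
Proof.
move=> [mlam lam_b [M HM]].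
pose M' := `|M|.
have l0 x : 0 <= lam x by have /andP[] := lam_b x.
have lx x : lam x <= lambda by have /andP[] := lam_b x.
have ll : 0 <= lambda by exact: le_trans (l0 [tuple 0 | i < dim]) (lx _).
pose g (x : pt) : \bar R := ind [forall i, - M' <= tnth x i <= M'].
have mg : measurable_fun [set: pt] g.
  apply: measurable_ind; rewrite (_ : (fun x => _) =
     (fun x : pt => all (fun i => - M' <= tnth x i <= M') (enum 'I_dim))); last first.
    apply/funext => x; apply/forallP/allP => h i; first by move=> _; exact: h.
    by apply: h; rewrite mem_enum.
  elim: (enum 'I_dim) => [|i l IH] /=; first exact: measurable_cst.
  apply: measurable_and => //; apply: measurable_and.
    by apply: measurable_fun_ler; [exact: measurable_cst|exact: measurable_tnth].
  by apply: measurable_fun_ler; [exact: measurable_tnth|exact: measurable_cst].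
have h1 : (intR (fun x => (lam x)%:E) <= lambda%:E * intR g)%E.
  rewrite [in leRHS]intR_ptmeas//; last by move=> z; exact: ind_ge0.
  rewrite -ge0_integralZl//=; last by move=> z _; exact: ind_ge0.
  rewrite -intR_ptmeas; last 2 first.
  - by move=> z; rewrite mule_ge0//; exact: ind_ge0.
  - exact: emeasurable_funM.
  apply: le_intR.
  - exact/measurable_EFinP.
  - exact: emeasurable_funM.
  - by move=> x; rewrite lee_fin.
  move=> x; rewrite /g; case: (boolP [forall i, _]) => [_|/forallPn[i hi]].
    by rewrite mule1 lee_fin.
  rewrite mule0 lee_fin; have [->//|lx0] := eqVneq (lam x) 0.
  exfalso; move/negP: hi; apply; rewrite -ler_norml.
  by rewrite (le_trans (coord_le_pnorm _ _))// (le_trans (HM x lx0))// ler_norm.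
have M0 : - M' <= M' by rewrite ge0_cp// normr_ge0.
rewrite intR_box// -EFinM in h1.
have h0 : (0 <= intR (fun x => (lam x)%:E))%E.
  rewrite intR_ptmeas; last by exact/measurable_EFinP.
    by apply: integral_ge0 => x _; rewrite lee_fin.
  by move=> x; rewrite lee_fin.
exists (fine (intR (fun x => (lam x)%:E))).
by rewrite fineK// ge0_fin_numE// (le_lt_trans h1)// ltry.
Qed.

End Geometry.

(** * Normalised Gibbs expectations *)

Section GibbsExpectation.
Context {R : realType} {dim : nat}.
Notation pt := (dim.-tuple R).
Notation cf := (@confT R dim).
Variable phi : pt -> \bar R.
Hypothesis mphi : measurable_fun setT phi.
Hypothesis phi0 : forall x, (0 <= phi x)%E.
Variables (lam : pt -> R) (lambda : R).
Hypothesis alam : activity lam lambda.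
Variable eta : cf.

Let mlam : measurable_fun setT lam. Proof. by case: alam. Qed.
Let lam0 x : 0 <= lam x. Proof. by case: alam => _ /(_ x)/andP[]. Qed.

Definition partition_fun : R := fine (mass phi lam eta (fun=> 1%E)).

Lemma mass1E : mass phi lam eta (fun=> 1%E) = partition_fun%:E.
Proof.
rewrite fineK// fin_numElt.
have [V VE] := activity_int alam.
rewrite (mass1_lty mphi phi0 eta mlam lam0 VE) andbT.
exact: lt_le_trans (ltNyr 0) (le_trans (lee01) (mass1_ge1 mphi eta mlam lam0)).
Qed.

Lemma partition_fun_ge1 : 1 <= partition_fun.
Proof. by rewrite -lee_fin -mass1E; exact: mass1_ge1. Qed.

Let Z0 : 0 <= partition_fun^-1.
Proof. by rewrite invr_ge0 (le_trans _ partition_fun_ge1). Qed.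

Lemma gexpE (F : cf -> \bar R) : (forall s, 0 <= F s)%E -> measurable_fun setT F ->
  gexp phi lam eta F = (\int[confmeas]_s (F s * (gdens phi lam eta s * (partition_fun^-1)%:E)))%E.
Proof.
move=> F0 mF; rewrite /gexp -/partition_fun massE// -ge0_integralZr//.
- by apply: eq_integral => s _; rewrite -muleA.
- by apply: emeasurable_funM => //; exact: measurable_gdens.
- by move=> s _; rewrite mule_ge0// gdens_ge0.
Qed.

Let dens0 s : (0 <= gdens phi lam eta s * (partition_fun^-1)%:E)%E.
Proof. by rewrite mule_ge0 ?lee_fin// gdens_ge0. Qed.

Let mdens : measurable_fun setT (fun s : cf => gdens phi lam eta s * (partition_fun^-1)%:E)%E.
Proof. by apply: emeasurable_funM => //; exact: measurable_gdens. Qed.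

Lemma gexp_ge0 (F : cf -> \bar R) : (forall s, 0 <= F s)%E -> measurable_fun setT F ->
  (0 <= gexp phi lam eta F)%E.
Proof. by move=> F0 mF; rewrite gexpE//; apply: integral_ge0 => s _; rewrite mule_ge0. Qed.

Lemma gexpD (F G : cf -> \bar R) : (forall s, 0 <= F s)%E -> measurable_fun setT F ->
  (forall s, 0 <= G s)%E -> measurable_fun setT G ->
  gexp phi lam eta (fun s => F s + G s)%E = (gexp phi lam eta F + gexp phi lam eta G)%E.
Proof.
move=> F0 mF G0 mG; rewrite !gexpE//; last 2 first.
- by move=> s; rewrite adde_ge0.
- exact: emeasurable_funD.
rewrite -ge0_integralD//; last 4 first.
- by move=> s _; rewrite mule_ge0.
- exact: emeasurable_funM.
- by move=> s _; rewrite mule_ge0.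
- exact: emeasurable_funM.
by apply: eq_integral => s _; rewrite ge0_muleDl.
Qed.

Lemma gexpZ (k : R) (F : cf -> \bar R) : 0 <= k -> (forall s, 0 <= F s)%E ->
  measurable_fun setT F ->
  gexp phi lam eta (fun s => k%:E * F s)%E = (k%:E * gexp phi lam eta F)%E.
Proof.
move=> k0 F0 mF; rewrite !gexpE//; last 2 first.
- by move=> s; rewrite mule_ge0.
- exact: emeasurable_funM.
rewrite -ge0_integralZl//; last 2 first.
- exact: emeasurable_funM.
- by move=> s _; rewrite mule_ge0.
by apply: eq_integral => s _; rewrite -muleA.
Qed.

(** Configurations with a point of zero activity have weight 0, so the comparison is required only
    on the others. Through this, later arguments assume that sampled points lie in the box and in
    the resampled ball. *)
Lemma gexp_le (F G : cf -> \bar R) : (forall s, 0 <= F s)%E -> measurable_fun setT F ->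
  (forall s, 0 <= G s)%E -> measurable_fun setT G ->
  (forall s : cf, all (fun x => lam x != 0) (s : seq pt) -> (F s <= G s)%E) ->
  (gexp phi lam eta F <= gexp phi lam eta G)%E.
Proof.
move=> F0 mF G0 mG FG; rewrite !gexpE//; apply: ge0_le_integral => //.
- by move=> s _; rewrite mule_ge0.
- exact: emeasurable_funM.
- exact: emeasurable_funM.
move=> s _; have [h|h] := boolP (all (fun x => lam x != 0) (s : seq pt)).
  by apply: lee_wpmul2r => //; exact: FG.
by rewrite /gdens weight_eq0// !mul0e !mule0.
Qed.

Lemma gexp1 : gexp phi lam eta (fun=> 1%E) = 1%E.
Proof.
rewrite /gexp -/partition_fun mass1E -EFinM divff//.
by rewrite gt_eqF// (lt_le_trans _ partition_fun_ge1).
Qed.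

Lemma gexp_cst (c : R) : 0 <= c -> gexp phi lam eta (fun=> c%:E) = c%:E.
Proof.
move=> c0; rewrite (_ : (fun=> _) = (fun=> c%:E * 1)%E); last by apply/funext => s; rewrite mule1.
by rewrite gexpZ// ?gexp1 ?mule1.
Qed.

Lemma gexp_le1 (F : cf -> \bar R) : (forall s, 0 <= F s <= 1)%E -> measurable_fun setT F ->
  (gexp phi lam eta F <= 1)%E.
Proof.
move=> F01 mF; rewrite -gexp1; apply: gexp_le => //; by move=> s; case/andP: (F01 s).
Qed.

End GibbsExpectation.

(** * The resampling operator and the block step *)

Section BlockStep.
Context {R : realType} {dim : nat}.
Notation pt := (dim.-tuple R).
Notation cf := (@confT R dim).
Variable phi : pt -> \bar R.
Hypothesis mphi : measurable_fun setT phi.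
Hypothesis phi0 : forall x, (0 <= phi x)%E.
Variables (lam : pt -> R) (lambda : R).
Hypothesis alam : activity lam lambda.
Variables (n : nat) (L : R).

Definition ball_act (y z : pt) : R := if `[< ball_pt y L z >] then lam z else 0.

Definition outside (y : pt) (x : seq pt) : seq pt :=
  [seq z <- x | ~~ `[< ball_pt y L z >]].

Definition resample (f : seq pt -> \bar R) (y : pt) (x : seq pt) : \bar R :=
  gexp phi (ball_act y) (outside y x) (fun Z => f (outside y x ++ Z)).

Lemma block_stepE f x : block_step phi lam n L f x =
  ((@boxvol R dim n)^-1%:E * intR (fun y => (\1_(box n) y)%:E * resample f y x))%E.
Proof. by []. Qed.

Lemma ball_activity y : activity (ball_act y) lambda.
Proof.
case: alam => mlam lb [M HM]; split.
- apply: measurable_fun_ifT => //.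
  exact: (measurableT_comp (measurable_in_ball L) (pair1_measurable y)).
- move=> x; rewrite /ball_act; case: ifPn => // _.
  by rewrite lexx (le_trans _ (andP (lb x)).2)//; case/andP: (lb x).
- exists M => x; rewrite /ball_act/=; case: ifPn => // _; last by rewrite eqxx.
  exact: HM.
Qed.

Lemma measurable_outside :
  measurable_fun setT (fun p : pt * cf => outside p.1 p.2 : cf).
Proof.
apply: (@measurable_filter_conf _ _ _ pt (fun q => ~~ `[< ball_pt q.1 L q.2 >])).
by apply: measurable_neg; exact: measurable_in_ball.
Qed.

Lemma measurable_cat_fun d (T : measurableType d) (f g : T -> cf) :
  measurable_fun setT f -> measurable_fun setT g ->
  measurable_fun setT (fun t => (f t : seq pt) ++ g t : cf).
Proof.
move=> mf mg.
have m : measurable_fun setT (fun t => (g t, f t)) by exact/measurable_fun_pair.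
exact: (measurableT_comp measurable_cat_conf m).
Qed.

Lemma measurable_resample (f : cf -> \bar R) : (forall s, 0 <= f s)%E ->
  measurable_fun setT f ->
  measurable_fun setT (fun p : pt * cf => resample f p.1 p.2).
Proof.
move=> f0 mf.
have mlam : measurable_fun setT lam by case: alam.
have lam0 y x : 0 <= ball_act y x by case: (ball_activity y) => _ /(_ x)/andP[].
have ml y : measurable_fun setT (ball_act y) by case: (ball_activity y).
have mact : measurable_fun setT (fun q : (pt * cf) * pt => ball_act q.1.1 q.2).
  apply: measurable_fun_ifT => //.
  - have m : measurable_fun setT (fun q : (pt * cf) * pt => (q.1.1, q.2)).
      by apply/measurable_fun_pair => //; exact: (measurableT_comp measurable_fst measurable_fst).
    exact: (measurableT_comp (measurable_in_ball L) m).
  - exact: (measurableT_comp mlam measurable_snd).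
have mw := measurable_weight mphi mact measurable_outside.
(* Numerator and denominator of [gexp] are both of this form: the mass of a jointly measurable [F],
   with activity and boundary condition depending on the parameter. *)
have mmass (F : (pt * cf) * cf -> \bar R) : (forall q, 0 <= F q)%E -> measurable_fun setT F ->
    measurable_fun setT (fun p : pt * cf =>
      mass phi (ball_act p.1) (outside p.1 p.2) (fun Z => F (p, Z))).
  move=> F0 mF.
  rewrite (_ : (fun p => _) = (fun p : pt * cf => \int[confmeas]_Z
     (F (p, Z) * (weight phi (ball_act p.1) (outside p.1 p.2) Z * ifact Z)))%E); last first.
    apply/funext => p; rewrite massE//.
    exact: (measurableT_comp mF (pair1_measurable p)).
  apply: (measurable_integral_param confmeas
    (f := fun q : (pt * cf) * cf => (F q * (weight phi (ball_act q.1.1) (outside q.1.1 q.1.2) q.2 * ifact q.2))%E)).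
    move=> q; apply: mule_ge0 => //; apply: mule_ge0; last exact: ifact_ge0.
    by apply: weight_ge0.
  apply: emeasurable_funM => //; apply: emeasurable_funM => //.
  exact: (measurableT_comp measurable_ifact measurable_snd).
rewrite /resample /gexp.
apply: emeasurable_funM.
- apply: (mmass (fun q => f (outside q.1.1 q.1.2 ++ q.2))) => //.
  have m : measurable_fun setT (fun q : (pt * cf) * cf => (outside q.1.1 q.1.2 ++ q.2 : cf)).
    apply: measurable_cat_fun; last exact: measurable_snd.
    exact: (measurableT_comp measurable_outside measurable_fst).
  exact: (measurableT_comp mf m).
- have m1 := mmass (fun=> 1%E) (fun=> lee01) (measurable_cst _).
  have Zge1 p : 1 <= fine (mass phi (ball_act p.1) (outside p.1 p.2) (fun=> 1%E)).
    exact: (partition_fun_ge1 mphi phi0 (ball_activity p.1)).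
  (* The mass is at least 1, so its inverse equals [expR (- ln _)], a composition of measurable
     maps. *)
  rewrite (_ : (fun p => _) = (fun p : pt * cf =>
    (expR (- ln (fine (mass phi (ball_act p.1) (outside p.1 p.2) (fun=> 1%E)))))%:E)).
    apply/measurable_EFinP; apply: measurableT_comp => //; apply: measurable_funN.
    apply: (measurableT_comp (@measurable_ln R)).
    exact: (measurableT_comp (fine_measurable measurableT) m1).
  apply/funext => p; rewrite expRN lnK// posrE.
  exact: lt_le_trans (Zge1 p).
Qed.

Lemma measurable_cat_out (f : cf -> \bar R) (u : cf) : measurable_fun setT f ->
  measurable_fun setT (fun Z : cf => f ((u : seq pt) ++ Z)).
Proof.
move=> mf; have m : measurable_fun setT (fun Z : cf => (u : seq pt) ++ Z : cf).
  by apply: measurable_cat_fun; [exact: measurable_cst|exact: measurable_id].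
exact: (measurableT_comp mf m).
Qed.

Lemma resample_ge0 (f : cf -> \bar R) y x : (forall s, 0 <= f s)%E ->
  measurable_fun setT f -> (0 <= resample f y x)%E.
Proof.
move=> f0 mf; apply: (gexp_ge0 mphi phi0 (ball_activity y)) => //.
exact: measurable_cat_out.
Qed.

Lemma resample_le1 (f : cf -> \bar R) y x : (forall s, 0 <= f s <= 1)%E ->
  measurable_fun setT f -> (resample f y x <= 1)%E.
Proof.
move=> f01 mf; apply: (gexp_le1 mphi phi0 (ball_activity y)) => //.
exact: measurable_cat_out.
Qed.

Lemma measurable_ind_box : measurable_fun setT (fun y : pt => (\1_(box n) y)%:E : \bar R).
Proof. by apply/measurable_EFinP; apply: measurable_indic; exact: measurable_box. Qed.

Lemma intR_ind_box : intR (fun y : pt => (\1_(box n) y)%:E) = (@boxvol R dim n)%:E.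
Proof.
rewrite (_ : (fun y => _) = (fun y : pt => ind [forall i, - n%:R <= tnth y i <= n%:R])); last first.
  apply/funext => y; rewrite indicE /ind; congr (_%:R%:E); congr nat_of_bool.
  apply/idP/forallP => [|h]; first by rewrite inE => h i; exact: h.
  by rewrite inE => i; exact: h.
rewrite intR_box => [|i]; last by rewrite ge0_cp.
rewrite big_const card_ord iter_mulr_1 /boxvol; congr (_ ^+ _)%:E.
by rewrite natrM mulr_natl mulr2n opprK.
Qed.

Lemma measurable_block_step (f : cf -> \bar R) : (forall s, 0 <= f s)%E ->
  measurable_fun setT f ->
  measurable_fun setT (fun x : cf => block_step phi lam n L f x).
Proof.
move=> f0 mf; under eq_fun do rewrite block_stepE.
apply: emeasurable_funM => //.
have ms : measurable_fun setT (fun q : cf * pt => (\1_(box n) q.2)%:E * resample f q.2 q.1)%E.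
  apply: emeasurable_funM; first exact: (measurableT_comp measurable_ind_box measurable_snd).
  have m : measurable_fun setT (fun q : cf * pt => (q.2, q.1)) by exact/measurable_fun_pair.
  exact: (measurableT_comp (measurable_resample f0 mf) m).
rewrite (_ : (fun x => _) = (fun x : cf => \int[ptmeas]_y
  ((\1_(box n) y)%:E * resample f y x))%E).
  apply: (measurable_integral_param ptmeas (f := fun q : cf * pt => ((\1_(box n) q.2)%:E * resample f q.2 q.1)%E)) => //.
  by move=> q; rewrite mule_ge0// ?lee_fin// resample_ge0.
apply/funext => x; apply: intR_ptmeas => [y|].
  by rewrite mule_ge0// ?lee_fin// resample_ge0.
exact: (measurableT_comp ms (pair1_measurable x)).
Qed.

End BlockStep.

(** * Splitting the Poisson process over a set and its complement *)

(** Pascal's rule with weights: in [intpts_split], [T b] and [T b.+1] are the contributions of an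
    extra point outside and inside the set. *)
Lemma pascal_sum (R : realType) (T : nat -> \bar R) k : (forall b, 0 <= T b)%E ->
  (\sum_(b < k.+1) ('C(k, b)%:R%:E * (T b + T b.+1)) =
   \sum_(b < k.+2) ('C(k.+1, b)%:R%:E * T b))%E.
Proof.
move=> T0.
under eq_bigr do rewrite ge0_muleDr//.
rewrite big_split/= [RHS]big_ord_recl/= bin0.
under [in RHS]eq_bigr do rewrite /bump/= add1n binS natrD EFinD ge0_muleDl ?lee_fin//.
rewrite big_split/= addeA; congr (_ + _)%E.
transitivity (\sum_(b < k.+2) ('C(k, b)%:R%:E * T b))%E.
  by rewrite [RHS]big_ord_recr/= bin_small// mul0e adde0.
by rewrite big_ord_recl/= bin0.
Qed.

(** Cauchy product rearrangement for nonnegative terms: the inner sum is padded with zeros to a full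
    series, the sums are interchanged, and the outer index is shifted by [b]. *)
Lemma triangle_series (R : realType) (f : nat -> nat -> \bar R) :
  (forall a b, 0 <= f a b)%E ->
  (\sum_(0 <= k <oo) \sum_(b < k.+1) f (k - b)%N b =
   \sum_(0 <= a <oo) \sum_(0 <= b <oo) f a b)%E.
Proof.
move=> f0.
pose g k b : \bar R := if (b <= k)%N then f (k - b)%N b else 0%E.
have g0 k b : (0 <= g k b)%E by rewrite /g; case: ifP.
transitivity (\sum_(0 <= k <oo) \sum_(0 <= b <oo) g k b)%E.
  apply: eq_eseriesr => k _.
  rewrite [RHS](nneseries_split 0 k.+1)//= [X in (_ + X)%E]eseries0 ?adde0; last first.
    by move=> b kb _; rewrite /g leqNgt kb.
  rewrite add0n big_mkord; apply: eq_bigr => b _.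
  by rewrite /g -ltnS ltn_ord.
rewrite nneseries_interchange// [RHS]nneseries_interchange//.
apply: eq_eseriesr => b _.
rewrite (nneseries_split 0 b)//= big1_seq ?add0e; last first.
  by move=> k /andP[_]; rewrite mem_index_iota add0n => /andP[_ kb]; rewrite /g leqNgt kb.
rewrite add0n -[LHS](nneseries_addn b)//.
by apply: eq_eseriesr => a _; rewrite /g leq_addl addnK.
Qed.

Section Splitting.
Context {R : realType} {dim : nat}.
Notation pt := (dim.-tuple R).
Notation cf := (@confT R dim).

Lemma ptsmeas0 (F : cf -> \bar R) : (forall s, 0 <= F s)%E -> measurable_fun setT F ->
  (\int[ptsmeas 0]_s F s = F [::])%E.
Proof. by move=> F0 mF; rewrite -intpts_ptsmeas. Qed.

Lemma ptsmeasS k (F : cf -> \bar R) : (forall s, 0 <= F s)%E -> measurable_fun setT F ->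
  (\int[ptsmeas k.+1]_s F s = \int[ptmeas]_x \int[ptsmeas k]_s F (x :: (s : seq pt)))%E.
Proof.
move=> F0 mF.
have mFc : measurable_fun setT (fun p : pt * cf => F (p.1 :: (p.2 : seq pt))).
  exact: (measurableT_comp mF (measurable_cons_conf measurable_fst measurable_snd)).
have E x : intpts k (fun s => F (x :: s)) = (\int[ptsmeas k]_s F (x :: (s : seq pt)))%E.
  rewrite intpts_ptsmeas//; exact: (measurableT_comp mFc (pair1_measurable x)).
rewrite -intpts_ptsmeas//= -intR_ptmeas.
- by congr intR; apply/funext => x.
- by move=> x; exact: integral_ge0.
- exact: (measurable_integral_param (ptsmeas k) (f := fun p : pt * cf => F (p.1 :: (p.2 : seq pt)))).
Qed.

Variable B : pt -> bool.
Hypothesis mB : measurable_fun setT B.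

Lemma measurable_all_in : measurable_fun setT (fun Z : cf => ind (all B (Z : seq pt)) : \bar R).
Proof.
apply: measurable_ind.
have m : measurable_fun setT (fun p : unit * pt => B p.2) by exact: (measurableT_comp mB measurable_snd).
exact: (measurableT_comp (measurable_all_conf m) (pair1_measurable tt)).
Qed.

Lemma measurable_all_out :
  measurable_fun setT (fun Z : cf => ind (all (predC B) (Z : seq pt)) : \bar R).
Proof.
apply: measurable_ind.
have m : measurable_fun setT (fun p : unit * pt => predC B p.2).
  by apply: measurable_neg; exact: (measurableT_comp mB measurable_snd).
exact: (measurableT_comp (measurable_all_conf m) (pair1_measurable tt)).
Qed.

(** The inside integral is innermost so that it can be read conditionally on the outside points
    [U]. *)
Definition spl (F : cf * cf -> \bar R) a b : \bar R :=
  (\int[ptsmeas a]_U (ind (all (predC B) (U : seq pt)) *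
     \int[ptsmeas b]_Z (ind (all B (Z : seq pt)) * F (U, Z))))%E.

Lemma measurable_spl_inner d (T : measurableType d) (F : T * (cf * cf) -> \bar R)
    (mu : {sfinite_measure set cf -> \bar R}) (w : cf -> \bar R) :
  (forall q, 0 <= F q)%E -> measurable_fun setT F ->
  (forall q, 0 <= w q)%E -> measurable_fun setT w ->
  measurable_fun setT (fun p : T * cf => \int[mu]_Z (w Z * F (p.1, (p.2, Z))))%E.
Proof.
move=> F0 mF w0 mw.
apply: (measurable_integral_param mu (f := fun q : (T * cf) * cf => (w q.2 * F (q.1.1, (q.1.2, q.2)))%E)).
  by move=> q; rewrite mule_ge0.
apply: emeasurable_funM; first exact: (measurableT_comp mw measurable_snd).
have m : measurable_fun setT (fun q : (T * cf) * cf => (q.1.1, (q.1.2, q.2))).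
  apply/measurable_fun_pair; first exact: (measurableT_comp measurable_fst measurable_fst).
  by apply/measurable_fun_pair => //; exact: (measurableT_comp measurable_snd measurable_fst).
exact: (measurableT_comp mF m).
Qed.

Lemma measurable_spl d (T : measurableType d) (F : T * (cf * cf) -> \bar R) a b :
  (forall q, 0 <= F q)%E -> measurable_fun setT F ->
  measurable_fun setT (fun t => spl (fun q => F (t, q)) a b).
Proof.
move=> F0 mF; rewrite /spl.
apply: (measurable_integral_param (ptsmeas a) (f := fun p : T * cf =>
   (ind (all (predC B) (p.2 : seq pt)) *
     \int[ptsmeas b]_Z (ind (all B (Z : seq pt)) * F (p.1, (p.2, Z))))%E)).
  move=> p; rewrite mule_ge0 ?ind_ge0//; apply: integral_ge0 => Z _.
  by rewrite mule_ge0 ?ind_ge0.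
apply: emeasurable_funM; first exact: (measurableT_comp measurable_all_out measurable_snd).
apply: measurable_spl_inner => //; [by move=> q; exact: ind_ge0|exact: measurable_all_in].
Qed.

Lemma spl_ge0 F a b : (forall q, 0 <= F q)%E -> (0 <= spl F a b)%E.
Proof.
move=> F0; apply: integral_ge0 => U _; rewrite mule_ge0 ?ind_ge0//.
by apply: integral_ge0 => Z _; rewrite mule_ge0 ?ind_ge0.
Qed.

Lemma ind_and b c : ind (b && c) = (ind b * ind c)%E :> \bar R.
Proof. by rewrite /ind; case: b; case: c; rewrite ?mul1e ?mul0e. Qed.

Let inner_meas b (F : cf * cf -> \bar R) : (forall q, 0 <= F q)%E -> measurable_fun setT F ->
  measurable_fun setT (fun U : cf => \int[ptsmeas b]_Z (ind (all B (Z : seq pt)) * F (U, Z)))%E.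
Proof.
move=> F0 mF.
have mF' : measurable_fun setT (fun q : unit * (cf * cf) => F q.2) by exact: (measurableT_comp mF measurable_snd).
have m := measurable_spl_inner (ptsmeas b) (fun q => F0 q.2) mF' (w := fun Z : cf => ind (all B (Z : seq pt)))
  (fun Z => ind_ge0 _) measurable_all_in.
exact: (measurableT_comp m (pair1_measurable tt)).
Qed.

Lemma splSl (F : cf * cf -> \bar R) a b : (forall q, 0 <= F q)%E -> measurable_fun setT F ->
  (spl F a.+1 b = \int[ptmeas]_x (ind (~~ B x) * spl (fun q => F (x :: (q.1 : seq pt) : cf, q.2)) a b))%E.
Proof.
move=> F0 mF; rewrite /spl ptsmeasS; last 2 first.
- move=> U; rewrite mule_ge0 ?ind_ge0//; apply: integral_ge0 => Z _.
  by rewrite mule_ge0 ?ind_ge0.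
- apply: emeasurable_funM; [exact: measurable_all_out|exact: inner_meas].
apply: eq_integral => x _; rewrite -ge0_integralZl//=; last 3 first.
- apply: emeasurable_funM; first exact: measurable_all_out.
  apply: (@inner_meas b (fun q => F (x :: (q.1 : seq pt) : cf, q.2))) => //.
  have m : measurable_fun setT (fun q : cf * cf => (x :: (q.1 : seq pt) : cf, q.2)).
    apply/measurable_fun_pair => //.
    by apply: (measurable_cons_conf (f := cst x) (g := fst)).
  exact: (measurableT_comp mF m).
- move=> U _; rewrite mule_ge0 ?ind_ge0//; apply: integral_ge0 => Z _.
  by rewrite mule_ge0 ?ind_ge0.
- exact: ind_ge0.
by apply: eq_integral => U _; rewrite ind_and muleA.
Qed.

(** The new point belongs to the inner integral but must come out in front of both, hence Tonelli's
    theorem; in [splSl] it is outermost from the start. *)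
Lemma splSr (F : cf * cf -> \bar R) a b : (forall q, 0 <= F q)%E -> measurable_fun setT F ->
  (spl F a b.+1 = \int[ptmeas]_x (ind (B x) * spl (fun q => F (q.1, x :: (q.2 : seq pt) : cf)) a b))%E.
Proof.
move=> F0 mF.
pose Fx (q : pt * (cf * cf)) := F (q.2.1, q.1 :: (q.2.2 : seq pt) : cf).
have mFx : measurable_fun setT Fx.
  have m : measurable_fun setT (fun q : pt * (cf * cf) => (q.2.1, q.1 :: (q.2.2 : seq pt) : cf)).
    apply/measurable_fun_pair; first exact: (measurableT_comp measurable_fst measurable_snd).
    apply: (measurable_cons_conf (f := fst) (g := fun q : pt * (cf * cf) => q.2.2)) => //.
    exact: (measurableT_comp measurable_snd measurable_snd).
  exact: (measurableT_comp mF m).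
have Fx0 q : (0 <= Fx q)%E by exact: F0.
pose G (p : pt * cf) : \bar R :=
  (\int[ptsmeas b]_Z (ind (all B (Z : seq pt)) * Fx (p.1, (p.2, Z))))%E.
have mG : measurable_fun setT G.
  by apply: measurable_spl_inner => //; [move=> q; exact: ind_ge0|exact: measurable_all_in].
have G0 p : (0 <= G p)%E by apply: integral_ge0 => Z _; rewrite mule_ge0 ?ind_ge0.
have mBp : measurable_fun setT (fun p : pt * cf => ind (B p.1) : \bar R).
  by apply: measurable_ind; exact: (measurableT_comp mB measurable_fst).
have mout : measurable_fun setT (fun p : pt * cf => ind (all (predC B) (p.2 : seq pt)) : \bar R).
  exact: (measurableT_comp measurable_all_out measurable_snd).
transitivity (\int[ptsmeas a]_U \int[ptmeas]_x
   (ind (B x) * (ind (all (predC B) (U : seq pt)) * G (x, U))))%E.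
  rewrite /spl; apply: eq_integral => U _.
  rewrite ptsmeasS; last 2 first.
  - by move=> Z; rewrite mule_ge0 ?ind_ge0.
  - apply: emeasurable_funM; [exact: measurable_all_in|].
    exact: (measurableT_comp mF (pair1_measurable U)).
  rewrite -ge0_integralZl//=; last 3 first.
  - apply: (measurable_integral_param (ptsmeas b) (f := fun p : pt * cf =>
      (ind (B p.1 && all B (p.2 : seq pt)) * Fx (p.1, (U, p.2)))%E)).
      by move=> p; rewrite mule_ge0 ?ind_ge0.
    apply: emeasurable_funM.
      under eq_fun do rewrite ind_and; apply: emeasurable_funM => //.
      exact: (measurableT_comp measurable_all_in measurable_snd).
    have m : measurable_fun setT (fun p : pt * cf => (p.1, (U, p.2))).
      by apply/measurable_fun_pair => //; apply/measurable_fun_pair.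
    exact: (measurableT_comp mFx m).
  - by move=> x _; apply: integral_ge0 => Z _; rewrite mule_ge0 ?ind_ge0.
  - exact: ind_ge0.
  apply: eq_integral => x _; rewrite muleCA; congr (_ * _)%E.
  rewrite -ge0_integralZl//=; last 3 first.
  - apply: emeasurable_funM; first exact: measurable_all_in.
    have m : measurable_fun setT (fun Z : cf => (x, (U, Z))).
      by apply/measurable_fun_pair => //; apply/measurable_fun_pair.
    exact: (measurableT_comp mFx m).
  - by move=> Z _; rewrite mule_ge0 ?ind_ge0.
  - exact: ind_ge0.
  by apply: eq_integral => Z _; rewrite ind_and -muleA.
rewrite (@sfinite_Fubini _ _ cf pt R (ptsmeas a) ptmeas (fun q : cf * pt =>
   ind (B q.2) * (ind (all (predC B) (q.1 : seq pt)) * G (q.2, q.1)))%E)/=; last 2 first.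
- by move=> q; rewrite !mule_ge0 ?ind_ge0.
- have m : measurable_fun setT (fun q : cf * pt => (q.2, q.1)) by exact/measurable_fun_pair.
  have mp : measurable_fun setT (fun p : pt * cf =>
     ind (B p.1) * (ind (all (predC B) (p.2 : seq pt)) * G p))%E.
    by apply: emeasurable_funM => //; apply: emeasurable_funM.
  exact: (measurableT_comp mp m).
apply: eq_integral => x _; rewrite /spl -ge0_integralZl//=; last 3 first.
- apply: emeasurable_funM; first exact: measurable_all_out.
  exact: (measurableT_comp mG (pair1_measurable x)).
- move=> U _; rewrite mule_ge0 ?ind_ge0//; apply: integral_ge0 => Z _.
  by rewrite mule_ge0 ?ind_ge0.
- exact: ind_ge0.
Qed.

Definition perm_inv (H : seq pt -> \bar R) := forall s t, perm_eq s t -> H s = H t.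

(** A binomial formula: each of the [k] points is inside or outside, and by permutation invariance
    only the number [b] of inside points matters. In the induction the first point joins the outside
    points directly, or the inside ones after a permutation. *)
Lemma intpts_split k (H : cf -> \bar R) :
  (forall s, 0 <= H s)%E -> measurable_fun setT H -> perm_inv H ->
  intpts k H = (\sum_(b < k.+1) ('C(k, b)%:R%:E *
      spl (fun q => H ((q.1 : seq pt) ++ q.2)) (k - b) b))%E.
Proof.
elim: k H => [|k IH] H H0 mH pH.
  rewrite big_ord1 bin0 mul1e subnn /spl ptsmeas0; last 2 first.
  - move=> U; rewrite mule_ge0 ?ind_ge0//; apply: integral_ge0 => Z _.
    by rewrite mule_ge0 ?ind_ge0.
  - apply: emeasurable_funM; [exact: measurable_all_out|].
    apply: (@inner_meas 0 (fun q => H ((q.1 : seq pt) ++ q.2))) => //.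
    have m := measurable_cat_fun (f := fst) (g := snd) measurable_fst measurable_snd (T := (cf * cf)%type).
    exact: (measurableT_comp mH m).
  rewrite /= /ind/= mul1e ptsmeas0 ?mul1e//.
  - by move=> s; rewrite mule_ge0 ?lee_fin.
  - by apply: emeasurable_funM => //; exact: measurable_all_in.
pose Hx (p : pt * cf) := H (p.1 :: (p.2 : seq pt)).
have mHx : measurable_fun setT Hx.
  exact: (measurableT_comp mH (measurable_cons_conf measurable_fst measurable_snd)).
have mcat : measurable_fun setT (fun q : cf * cf => ((q.1 : seq pt) ++ q.2 : cf)).
  exact: measurable_cat_fun measurable_fst measurable_snd.
pose F (q : cf * cf) := H ((q.1 : seq pt) ++ q.2).
have mF : measurable_fun setT F by exact: (measurableT_comp mH mcat).
have F0 q : (0 <= F q)%E by exact: H0.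
pose T x b : \bar R := spl (fun q => Hx (x, (q.1 : seq pt) ++ q.2 : cf)) (k - b) b.
have mT b : measurable_fun setT (T ^~ b).
  apply: (measurable_spl (F := fun q : pt * (cf * cf) => Hx (q.1, (q.2.1 : seq pt) ++ q.2.2 : cf))).
    by move=> q; exact: H0.
  have m : measurable_fun setT (fun q : pt * (cf * cf) => (q.1, (q.2.1 : seq pt) ++ q.2.2 : cf)).
    by apply/measurable_fun_pair => //; exact: (measurableT_comp mcat measurable_snd).
  exact: (measurableT_comp mHx m).
have T0 x b : (0 <= T x b)%E by apply: spl_ge0 => q; exact: H0.
have E1 b : (b < k.+1)%N -> (spl F (k.+1 - b) b = \int[ptmeas]_x (ind (~~ B x) * T x b))%E.
  move=> bk; rewrite subSn// splSl//.
have E2 b : (b < k.+1)%N -> (spl F (k.+1 - b.+1) b.+1 = \int[ptmeas]_x (ind (B x) * T x b))%E.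
  move=> bk; rewrite subSS (splSr _ _ F0 mF); apply: eq_integral => x _.
  rewrite /T; congr (_ * _)%E.
  have -> // : (fun q : cf * cf => F (q.1, x :: (q.2 : seq pt) : cf)) =
     (fun q : cf * cf => Hx (x, (q.1 : seq pt) ++ q.2 : cf)).
  apply/funext => q; apply: pH => /=.
  by rewrite -cat1s perm_catCA.
transitivity (\int[ptmeas]_x \sum_(b < k.+1) ('C(k, b)%:R%:E * (ind (~~ B x) * T x b + ind (B x) * T x b)))%E.
  rewrite intpts_ptsmeas// ptsmeasS//; apply: eq_integral => x _.
  rewrite -intpts_ptsmeas//; last first.
    exact: (measurableT_comp mHx (pair1_measurable x)).
  rewrite (IH (fun s => H (x :: s))); last 3 first.
  - by move=> s; exact: H0.
  - exact: (measurableT_comp mHx (pair1_measurable x)).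
  - by move=> s t st; apply: pH; rewrite perm_cons.
  apply: eq_bigr => b _; congr (_ * _)%E.
  by rewrite /T /ind; case: (B x); rewrite /= !mul1e mul0e ?adde0 ?add0e.
rewrite ge0_integral_sum//; last 2 first.
- move=> b; apply: emeasurable_funM => //; apply: emeasurable_funD.
    by apply: emeasurable_funM => //; apply: measurable_ind; apply: measurable_neg.
  by apply: emeasurable_funM => //; apply: measurable_ind.
- by move=> b x _; rewrite mule_ge0 ?lee_fin// adde_ge0// mule_ge0 ?ind_ge0.
rewrite -(pascal_sum (T := fun b => spl F (k.+1 - b) b)); last by move=> b; exact: spl_ge0.
apply: eq_bigr => b _.
have m1 : measurable_fun setT (fun x => ind (~~ B x) * T x b)%E.
  by apply: emeasurable_funM => //; apply: measurable_ind; apply: measurable_neg.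
have m2 : measurable_fun setT (fun x => ind (B x) * T x b)%E.
  by apply: emeasurable_funM => //; apply: measurable_ind.
rewrite ge0_integralZl//; last 2 first.
- exact: emeasurable_funD.
- by move=> x _; rewrite adde_ge0// mule_ge0 ?ind_ge0.
rewrite ge0_integralD//; last 2 first.
- by move=> x _; rewrite mule_ge0 ?ind_ge0.
- by move=> x _; rewrite mule_ge0 ?ind_ge0.
by rewrite E1 ?E2.
Qed.

(** The identity [C(k, b) / k! = 1 / ((k - b)! b!)] turns the binomial formula into a double series
    over [a] and [b]. Up to normalisation this is the independence of the Poisson process on a set
    and on its complement. *)
Lemma confmeas_split (H : cf -> \bar R) :
  (forall s, 0 <= H s)%E -> measurable_fun setT H -> perm_inv H ->
  (\int[confmeas]_s (H s * ifact s) =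
   \int[confmeas]_U (ind (all (predC B) (U : seq pt)) * ifact U *
     \int[confmeas]_Z (ind (all B (Z : seq pt)) * ifact Z * H ((U : seq pt) ++ Z))))%E.
Proof.
move=> H0 mH pH.
have mcat : measurable_fun setT (fun q : cf * cf => ((q.1 : seq pt) ++ q.2 : cf)).
  exact: measurable_cat_fun measurable_fst measurable_snd.
pose F (q : cf * cf) := H ((q.1 : seq pt) ++ q.2).
have mF : measurable_fun setT F by exact: (measurableT_comp mH mcat).
have F0 q : (0 <= F q)%E by exact: H0.
pose v n : \bar R := (n`!%:R^-1)%:E.
have v0 n : (0 <= v n)%E by rewrite lee_fin invr_ge0.
rewrite -sum_intpts_fact//.
transitivity (\sum_(0 <= k <oo) \sum_(b < k.+1) (v (k - b)%N * v b * spl F (k - b) b))%E.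
  apply: eq_eseriesr => k _; rewrite intpts_split// ge0_sume_distrr; last first.
    by move=> b _; rewrite mule_ge0 ?lee_fin// spl_ge0.
  apply: eq_bigr => b _; rewrite muleA; congr (_ * _)%E.
  rewrite -!EFinM; congr _%:E; have bk : (b <= k)%N by rewrite -ltnS.
  rewrite -(bin_fact bk) !natrM !invfM mulrCA mulrA mulrC mulrA.
  have C0 : 'C(k, b)%:R != 0 :> R by rewrite pnatr_eq0 -lt0n bin_gt0.
  by rewrite -!mulrA [X in _ * X = _]mulrC; field; rewrite C0 !pnatr_eq0 -!lt0n !fact_gt0.
rewrite (triangle_series (f := fun a b => v a * v b * spl F a b)%E); last first.
  by move=> a b; rewrite !mule_ge0// spl_ge0.
have inb (U : cf) : (\int[confmeas]_Z (ind (all B (Z : seq pt)) * ifact Z * F (U, Z)) =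
    \sum_(0 <= b <oo) v b * \int[ptsmeas b]_Z (ind (all B (Z : seq pt)) * F (U, Z)))%E.
  have mi : measurable_fun setT (fun Z : cf => ind (all B (Z : seq pt)) * F (U, Z))%E.
    apply: emeasurable_funM; first exact: measurable_all_in.
    exact: (measurableT_comp mF (pair1_measurable U)).
  have i0 (Z : cf) : (0 <= ind (all B (Z : seq pt)) * F (U, Z))%E by rewrite mule_ge0 ?ind_ge0.
  transitivity (\int[confmeas]_Z ((ind (all B (Z : seq pt)) * F (U, Z)) * ifact Z))%E.
    by apply: eq_integral => Z _; rewrite muleAC.
  rewrite -sum_intpts_fact//; apply: eq_eseriesr => b _.
  by rewrite intpts_ptsmeas.
have mw : measurable_fun setT (fun Z : cf => (ind (all B (Z : seq pt)) * ifact Z)%E).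
  by apply: emeasurable_funM; [exact: measurable_all_in|exact: measurable_ifact].
have w0 (Z : cf) : (0 <= ind (all B (Z : seq pt)) * ifact Z)%E.
  by rewrite mule_ge0 ?ind_ge0 ?ifact_ge0.
have mI : measurable_fun setT (fun U : cf => \int[confmeas]_Z (ind (all B (Z : seq pt)) * ifact Z * F (U, Z)))%E.
  have mF' : measurable_fun setT (fun q : unit * (cf * cf) => F q.2) by exact: (measurableT_comp mF measurable_snd).
  have m := measurable_spl_inner confmeas (fun q => F0 q.2) mF' w0 mw.
  exact: (measurableT_comp m (pair1_measurable tt)).
have I0 (U : cf) : (0 <= \int[confmeas]_Z (ind (all B (Z : seq pt)) * ifact Z * F (U, Z)))%E.
  by apply: integral_ge0 => Z _; rewrite mule_ge0.
transitivity (\sum_(0 <= a <oo) v a * intpts a (fun U => ind (all (predC B) U) *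
   \int[confmeas]_Z (ind (all B (Z : seq pt)) * ifact Z * F (U, Z))))%E.
  apply: eq_eseriesr => a _.
  rewrite intpts_ptsmeas; last 2 first.
  - by move=> U; rewrite mule_ge0 ?ind_ge0.
  - by apply: emeasurable_funM => //; exact: measurable_all_out.
  under eq_eseriesr do rewrite -muleA.
  rewrite nneseriesZl; last by move=> b _; rewrite mule_ge0// spl_ge0.
  congr (_ * _)%E; rewrite /spl.
  under [RHS]eq_integral do rewrite inb.
  under [RHS]eq_integral.
    move=> U _; rewrite -nneseriesZl; last first.
      move=> b _; rewrite mule_ge0//; apply: integral_ge0 => Z _.
      by rewrite mule_ge0 ?ind_ge0.
    over.
  rewrite integral_nneseries//; last 2 first.
  - move=> b; apply: emeasurable_funM; first exact: measurable_all_out.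
    by apply: emeasurable_funM => //; exact: inner_meas.
  - move=> b U _; rewrite mule_ge0 ?ind_ge0// mule_ge0//; apply: integral_ge0 => Z _.
    by rewrite mule_ge0 ?ind_ge0.
  apply: eq_eseriesr => b _.
  rewrite -ge0_integralZl//; last 2 first.
  - by apply: emeasurable_funM; [exact: measurable_all_out|exact: inner_meas].
  - move=> U _; rewrite mule_ge0 ?ind_ge0//; apply: integral_ge0 => Z _.
    by rewrite mule_ge0 ?ind_ge0.
  by apply: eq_integral => U _; rewrite muleCA.
rewrite sum_intpts_fact.
- by apply: eq_integral => U _; rewrite -muleA muleAC muleA.
- by move=> U; rewrite mule_ge0 ?ind_ge0.
- by apply: emeasurable_funM => //; exact: measurable_all_out.
Qed.

End Splitting.

(** * Invariance of the Gibbs measure *)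

Section Stationarity.
Context {R : realType} {dim : nat}.
Notation pt := (dim.-tuple R).
Notation cf := (@confT R dim).
Variable phi : pt -> \bar R.
Hypothesis mphi : measurable_fun setT phi.
Hypothesis phi0 : forall x, (0 <= phi x)%E.
Hypothesis phiN : forall x, phi (popp x) = phi x.

Lemma pdiffC (x y : pt) : pdiff y x = popp (pdiff x y).
Proof. by apply: eq_from_tnth => i; rewrite !tnth_mktuple opprB. Qed.

Lemma phi_pdiffC (x y : pt) : phi (pdiff y x) = phi (pdiff x y).
Proof. by rewrite pdiffC phiN. Qed.

Lemma crossC s t : cross phi s t = cross phi t s.
Proof.
rewrite /cross exchange_big/=; apply: eq_bigr => x _; apply: eq_bigr => y _.
exact: phi_pdiffC.
Qed.

Lemma energy_cat s t :
  energy phi (s ++ t) = (energy phi s + energy phi t + cross phi s t)%E.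
Proof.
elim: s => [|x s IH] /=; first by rewrite add0e /cross big_nil adde0.
rewrite IH /cross big_cons big_cat/= -!addeA; congr (_ + _)%E.
by rewrite addeCA; congr (_ + _)%E; rewrite addeCA.
Qed.

Lemma energy_catC s t : energy phi (s ++ t) = energy phi (t ++ s).
Proof. by rewrite !energy_cat crossC; congr (_ + _)%E; rewrite addeC. Qed.

Lemma energy_perm s t : perm_eq s t -> energy phi s = energy phi t.
Proof.
elim: s t => [|x s IH] t st.
  by move: st; rewrite perm_sym => /perm_nilP ->.
have xt : x \in t by rewrite -(perm_mem st) mem_head.
case/splitPr: xt st => t1 t2 st.
have st' : perm_eq s (t2 ++ t1).
  move: st; rewrite perm_sym -cat1s perm_catCA /= perm_cons perm_sym => st.
  by rewrite (perm_trans st)// perm_catC.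
by rewrite energy_catC /= (IH _ st') (perm_big _ st').
Qed.

Lemma weight_perm lam eta eta' s s' : perm_eq eta eta' -> perm_eq s s' ->
  weight phi lam eta s = weight phi lam eta' s'.
Proof.
move=> ee ss; rewrite /weight (perm_big _ ss) (energy_perm ss).
congr (_ * expeR (- (_ + _)))%E; rewrite /cross (perm_big _ ss).
by apply: eq_bigr => x _; exact: perm_big.
Qed.

Lemma gexp_perm lam eta eta' (F F' : seq pt -> \bar R) : perm_eq eta eta' -> F =1 F' ->
  gexp phi lam eta F = gexp phi lam eta' F'.
Proof.
move=> ee /funext ->; have E : weight phi lam eta = weight phi lam eta'.
  by apply/funext => s; exact: weight_perm.
by rewrite /gexp /mass E.
Qed.

Lemma expeR_oppD (a b : \bar R) : (0 <= a)%E -> (0 <= b)%E ->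
  expeR (- (a + b)) = (expeR (- a) * expeR (- b))%E.
Proof. by move=> a0 b0; rewrite -expeRD oppeD// ge0_adde_def// inE. Qed.

(** The cross energy is attached to [Z], which makes the second factor the weight of a Gibbs process
    with boundary condition [U]; symmetry of [phi] exchanges the arguments of [cross]. *)
Lemma weight_cat lam U Z :
  weight phi lam [::] (U ++ Z) = (weight phi lam [::] U * weight phi lam U Z)%E.
Proof.
have c0 s : cross phi s [::] = 0%E by rewrite /cross big1// => x _; rewrite big_nil.
rewrite /weight !c0 !adde0 energy_cat big_cat/= EFinM -addeA.
rewrite expeR_oppD ?energy_ge0 ?adde_ge0 ?energy_ge0 ?cross_ge0//.
by rewrite [cross _ U Z]crossC muleACA.
Qed.

Variables (lam : pt -> R) (lambda : R).
Hypothesis alam : activity lam lambda.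

Let mlam : measurable_fun setT lam. Proof. by case: alam. Qed.
Let lam0 x : 0 <= lam x. Proof. by case: alam => _ /(_ x)/andP[]. Qed.

Section ball.
Variable L : R.

Let inb (y : pt) : pt -> bool := fun z => `[< ball_pt y L z >].

Lemma weight_ball_act y U Z : all (inb y) Z ->
  weight phi (ball_act lam L y) U Z = weight phi lam U Z.
Proof.
move=> /allP h; rewrite /weight; congr (_%:E * _)%E.
by apply: eq_big_seq => z /h; rewrite /ball_act /inb => ->.
Qed.

Lemma ind_weight_ball_act y U Z :
  (ind (all (inb y) Z) * weight phi (ball_act lam L y) U Z =
   weight phi (ball_act lam L y) U Z)%E.
Proof.
case: (boolP (all _ _)) => [_|/allPn[z zZ hz]]; first by rewrite /ind mul1e.
rewrite weight_eq0 ?mule0//; apply/allPn; exists z => //.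
by rewrite /ball_act; move/negbTE: hz; rewrite /inb => ->; rewrite eqxx.
Qed.

Lemma outside_cat y U Z : all (predC (inb y)) U -> all (inb y) Z ->
  outside L y (U ++ Z) = U.
Proof.
move=> hU hZ; rewrite /outside filter_cat.
rewrite (_ : [seq z <- U | _] = U); last by apply/all_filterP.
rewrite (_ : [seq z <- Z | _] = [::]) ?cats0//.
rewrite (eq_in_filter (a2 := pred0)) ?filter_pred0//.
by move=> z zZ; have /allP/(_ z zZ) := hZ; rewrite /inb => ->.
Qed.

Lemma resample_perm (f : seq pt -> \bar R) y : perm_inv f ->
  perm_inv (resample phi lam L f y).
Proof.
move=> pf s t st; rewrite /resample.
have out : perm_eq (outside L y s) (outside L y t) by exact: perm_filter.
apply: gexp_perm => // Z; apply: pf.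
by rewrite perm_cat2r.
Qed.

(** The Dobrushin-Lanford-Ruelle equation for a ball. Split the points into [U] outside and [Z]
    inside: the weight factors by [weight_cat], and for fixed [U] the resampled value is a constant
    [g]. Integrating [g] against the inside weight gives [g] times the inside partition function,
    which is the unnormalised inside integral of [f]. *)
Lemma mass_resample (f : cf -> \bar R) y : (forall s, 0 <= f s)%E ->
  measurable_fun setT f -> perm_inv f ->
  mass phi lam [::] (resample phi lam L f y) = mass phi lam [::] f.
Proof.
move=> f0 mf pf.
have aB := ball_activity alam L y.
have mB : measurable_fun setT (inb y).
  exact: (measurableT_comp (measurable_in_ball L) (pair1_measurable y)).
have mr : measurable_fun setT (fun x : cf => resample phi lam L f y x).
  have m := measurable_resample mphi phi0 alam L f0 mf.
  exact: (measurableT_comp m (pair1_measurable y)).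
have r0 x : (0 <= resample phi lam L f y x)%E by exact: (resample_ge0 mphi phi0 alam).
have mw : measurable_fun setT (fun s : cf => weight phi lam [::] s).
  exact: measurable_weight1.
have w0 s : (0 <= weight phi lam [::] s)%E by exact: weight_ge0.
have split (G : cf -> \bar R) : (forall s, 0 <= G s)%E -> measurable_fun setT G -> perm_inv G ->
    mass phi lam [::] G = (\int[confmeas]_U (ind (all (predC (inb y)) (U : seq pt)) * ifact U *
     \int[confmeas]_Z (ind (all (inb y) (Z : seq pt)) * ifact Z *
        (G ((U : seq pt) ++ Z) * weight phi lam [::] ((U : seq pt) ++ Z)))))%E.
  move=> G0 mG pG; rewrite massE//.
  rewrite -(confmeas_split mB (H := fun s : cf => (G s * weight phi lam [::] s)%E)).
  - by apply: eq_integral => s _; rewrite /gdens muleA.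
  - by move=> s; rewrite mule_ge0.
  - exact: emeasurable_funM.
  - by move=> s t st; rewrite (pG _ _ st) (weight_perm _ (perm_refl _) st).
rewrite split//; last exact: resample_perm.
rewrite [RHS]split//; apply: eq_integral => U _.
case: (boolP (all (predC (inb y)) (U : seq pt))) => hU; last by rewrite /ind !mul0e.
congr (_ * _)%E.
have mcatU : measurable_fun setT (fun Z : cf => f ((U : seq pt) ++ Z)) by exact: measurable_cat_out.
pose W Z := (weight phi (ball_act lam L y) U Z * ifact Z)%E.
have W0 Z : (0 <= W Z)%E.
  by rewrite mule_ge0 ?ifact_ge0// weight_ge0// => x; case: aB => _ /(_ x)/andP[].
have mW : measurable_fun setT (fun Z : cf => W Z).
  by apply: measurable_gdens; case: aB.
have key (h : \bar R) Z : (ind (all (inb y) Z) * ifact Z * (h * weight phi lam [::] (U ++ Z)) =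
    weight phi lam [::] U * (ind (all (inb y) Z) * (h * W Z)))%E.
  rewrite weight_cat /W; case: (boolP (all (inb y) Z)) => hZ; last by rewrite /ind !mul0e mule0.
  rewrite weight_ball_act// /ind !mul1e muleCA [RHS]muleCA; congr (_ * _)%E.
  by rewrite muleCA; congr (_ * _)%E; exact: muleC.
have massB (F : cf -> \bar R) : (forall s, 0 <= F s)%E -> measurable_fun setT F ->
   (\int[confmeas]_Z (ind (all (inb y) (Z : seq pt)) * (F Z * W Z)) =
     mass phi (ball_act lam L y) U F)%E.
  move=> F0 mF; rewrite massE//; last 2 first.
  - by case: aB.
  - by move=> x; case: aB => _ /(_ x)/andP[].
  apply: eq_integral => Z _; rewrite /W muleCA; congr (_ * _)%E.
  by rewrite muleA ind_weight_ball_act.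
have pull (F : cf -> \bar R) : (forall s, 0 <= F s)%E -> measurable_fun setT F ->
   (\int[confmeas]_Z (ind (all (inb y) (Z : seq pt)) * ifact Z * (F Z * weight phi lam [::] ((U : seq pt) ++ Z))) =
     weight phi lam [::] U * mass phi (ball_act lam L y) U F)%E.
  move=> F0 mF; rewrite -massB// -ge0_integralZl//.
  - by apply: eq_integral => Z _; rewrite key.
  - by apply: emeasurable_funM; [exact: measurable_all_in|exact: emeasurable_funM].
  - by move=> Z _; rewrite mule_ge0 ?ind_ge0// mule_ge0.
rewrite [RHS]pull//.
have fm0 : (0 <= mass phi (ball_act lam L y) U (fun Z => f (U ++ Z)))%E.
  by rewrite -massB//; apply: integral_ge0 => Z _; rewrite mule_ge0 ?ind_ge0// mule_ge0.
have Z1 := mass1E mphi phi0 aB U.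
have Zge1 := partition_fun_ge1 mphi phi0 aB U.
transitivity (\int[confmeas]_Z (ind (all (inb y) (Z : seq pt)) * ifact Z *
   (gexp phi (ball_act lam L y) U (fun Z => f (U ++ Z)) * weight phi lam [::] ((U : seq pt) ++ Z))))%E.
  apply: eq_integral => Z _; case: (boolP (all (inb y) (Z : seq pt))) => hZ; last by rewrite /ind !mul0e.
  by rewrite /resample outside_cat.
set g := gexp _ _ _ _.
have g0 : (0 <= g)%E by exact: (gexp_ge0 mphi phi0 aB).
rewrite (pull (fun=> g)) ?(measurable_cst)//; congr (_ * _)%E.
transitivity (g * mass phi (ball_act lam L y) U (fun=> 1%E))%E.
  rewrite -massB// -massB//.
  rewrite -ge0_integralZl//.
  - by apply: eq_integral => Z _; rewrite mul1e muleCA.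
  - by apply: emeasurable_funM; [exact: measurable_all_in|exact: emeasurable_funM].
  - by move=> Z _; rewrite mule_ge0 ?ind_ge0// mule_ge0.
rewrite Z1 /g /gexp -/(partition_fun _ _ _) -muleA -EFinM mulVf ?mule1//.
by rewrite gt_eqF// (lt_le_trans _ Zge1).
Qed.

Variable n : nat.
Hypothesis n0 : (0 < n)%N.

Lemma boxvol_gt0 : 0 < @boxvol R dim n.
Proof. by rewrite exprn_gt0// ltr0n muln_gt0. Qed.

Lemma block_step_perm (f : seq pt -> \bar R) : perm_inv f ->
  perm_inv (block_step phi lam n L f).
Proof.
move=> pf s t st; rewrite !block_stepE; congr (_ * intR _)%E.
by apply/funext => y; rewrite (resample_perm _ pf st).
Qed.

Lemma block_step_ge0 (f : cf -> \bar R) x : (forall s, 0 <= f s)%E ->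
  measurable_fun setT f -> (0 <= block_step phi lam n L f x)%E.
Proof.
move=> f0 mf; rewrite block_stepE; apply: mule_ge0.
  by rewrite lee_fin invr_ge0 ltW// boxvol_gt0.
have mr := measurable_resample mphi phi0 alam L f0 mf.
rewrite intR_ptmeas.
- apply: integral_ge0 => y _; rewrite mule_ge0 ?lee_fin//; exact: (resample_ge0 mphi phi0 alam).
- move=> y; rewrite mule_ge0 ?lee_fin//; exact: (resample_ge0 mphi phi0 alam).
- apply: emeasurable_funM; first exact: measurable_ind_box.
  have m : measurable_fun setT (fun y : pt => (y, x : cf)).
    by apply/measurable_fun_pair; [exact: measurable_id|exact: measurable_cst].
  exact: (measurableT_comp mr m).
Qed.

(** Tonelli's theorem moves the average over the centre [y] to the front, where [mass_resample]
    applies to each [y]. *)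
Lemma mass_block_step (f : cf -> \bar R) : (forall s, 0 <= f s)%E ->
  measurable_fun setT f -> perm_inv f ->
  mass phi lam [::] (block_step phi lam n L f) = mass phi lam [::] f.
Proof.
move=> f0 mf pf.
have mr := measurable_resample mphi phi0 alam L f0 mf.
have r0 y x : (0 <= resample phi lam L f y x)%E by exact: (resample_ge0 mphi phi0 alam).
have mg : measurable_fun setT (fun s : cf => gdens phi lam [::] s) by exact: measurable_gdens.
have g0 s : (0 <= gdens phi lam [::] s)%E by exact: gdens_ge0.
have N0 := boxvol_gt0.
have NV : (0 <= ((@boxvol R dim n)^-1)%:E :> \bar R)%E by rewrite lee_fin invr_ge0 ltW.
have mi := @measurable_ind_box R dim n.
have i0 (y : pt) : (0 <= (\1_(box n) y)%:E :> \bar R)%E by rewrite lee_fin.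
rewrite massE//; last 2 first.
- by move=> s; exact: block_step_ge0.
- exact: (measurable_block_step mphi phi0 alam).
have mF : measurable_fun setT (fun q : cf * pt =>
    (\1_(box n) q.2)%:E * resample phi lam L f q.2 q.1 * gdens phi lam [::] q.1)%E.
  apply: emeasurable_funM.
    apply: emeasurable_funM; first exact: (measurableT_comp mi measurable_snd).
    have m : measurable_fun setT (fun q : cf * pt => (q.2, q.1)) by exact/measurable_fun_pair.
    exact: (measurableT_comp mr m).
  exact: (measurableT_comp mg measurable_fst).
have mrx x : measurable_fun setT (fun y => (\1_(box n) y)%:E * resample phi lam L f y x)%E.
  apply: emeasurable_funM; first exact: mi.
  have m : measurable_fun setT (fun y : pt => (y, x : cf)).
    by apply/measurable_fun_pair; [exact: measurable_id|exact: measurable_cst].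
  exact: (measurableT_comp mr m).
transitivity (((@boxvol R dim n)^-1)%:E * \int[confmeas]_x \int[ptmeas]_y
   ((\1_(box n) y)%:E * resample phi lam L f y x * gdens phi lam [::] x))%E.
  rewrite -ge0_integralZl//; last 2 first.
  - exact: (measurable_integral_param ptmeas (f := fun q : cf * pt => ((\1_(box n) q.2)%:E * resample phi lam L f q.2 q.1 * gdens phi lam [::] q.1)%E)
      (fun q => mule_ge0 (mule_ge0 (i0 _) (r0 _ _)) (g0 _)) mF).
  - by move=> x _; apply: integral_ge0 => y _; rewrite mule_ge0// mule_ge0.
  apply: eq_integral => x _; rewrite block_stepE -muleA; congr (_ * _)%E.
  rewrite intR_ptmeas//; last by move=> y; rewrite mule_ge0.
  by rewrite -ge0_integralZr// => y _; rewrite mule_ge0.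
rewrite (@sfinite_Fubini _ _ cf pt R confmeas ptmeas (fun q : cf * pt =>
    (\1_(box n) q.2)%:E * resample phi lam L f q.2 q.1 * gdens phi lam [::] q.1)%E)//=; last first.
  by move=> q; rewrite mule_ge0// mule_ge0.
transitivity (((@boxvol R dim n)^-1)%:E * \int[ptmeas]_y ((\1_(@box R dim n) y)%:E * mass phi lam [::] f))%E.
  congr (_ * _)%E; apply: eq_integral => y _.
  have mry : measurable_fun setT (fun x : cf => resample phi lam L f y x).
    exact: (measurableT_comp mr (pair1_measurable y)).
  rewrite -(mass_resample y f0 mf pf) massE// -ge0_integralZl//.
  - by apply: eq_integral => x _; rewrite -muleA.
  - exact: emeasurable_funM.
  - by move=> x _; rewrite mule_ge0.
have m0 : (0 <= mass phi lam [::] f)%E.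
  by rewrite massE//; apply: integral_ge0 => x _; rewrite mule_ge0.
rewrite ge0_integralZr// -intR_ptmeas// intR_ind_box muleA -EFinM mulVf ?mul1e//.
by rewrite gt_eqF.
Qed.

Lemma gexp_block_step (f : cf -> \bar R) : (forall s, 0 <= f s)%E ->
  measurable_fun setT f -> perm_inv f ->
  gexp phi lam [::] (block_step phi lam n L f) = gexp phi lam [::] f.
Proof. by move=> f0 mf pf; rewrite /gexp mass_block_step. Qed.

End ball.
End Stationarity.

(** * Strong spatial mixing for functions *)

Section EuclideanNorm.
Context {R : realType} {dim : nat}.
Notation pt := (dim.-tuple R).

Lemma sum_mul_le (a b : pt) :
  \sum_(i < dim) tnth a i * tnth b i <= pnorm a * pnorm b.
Proof.
have [a0|a0] := eqVneq (pnorm a) 0.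
  rewrite a0 mul0r big1// => i _.
  have := coord_le_pnorm a i; rewrite a0 normr_le0 => /eqP ->; exact: mul0r.
have [b0|b0] := eqVneq (pnorm b) 0.
  rewrite b0 mulr0 big1// => i _.
  have := coord_le_pnorm b i; rewrite b0 normr_le0 => /eqP ->; exact: mulr0.
have {a0}a0 : 0 < pnorm a by rewrite lt_def a0 pnorm_ge0.
have {b0}b0 : 0 < pnorm b by rewrite lt_def b0 pnorm_ge0.
set A := pnorm a in a0 *; set B := pnorm b in b0 *.
(* AM-GM: [2 A B a_i b_i <= (a_i B)^2 + (b_i A)^2] *)
have : \sum_(i < dim) (2 * A * B) * (tnth a i * tnth b i) <=
   \sum_(i < dim) (B ^+ 2 * tnth a i ^+ 2 + A ^+ 2 * tnth b i ^+ 2).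
  by apply: ler_sum => i _; have := sqr_ge0 (B * tnth a i - A * tnth b i); nra.
rewrite -mulr_sumr big_split/= -!mulr_sumr -!pnorm_sqr -/A -/B => h.
have AB : 0 < A * B by rewrite mulr_gt0.
set S := \sum_(i < dim) _ in h *.
rewrite -(ler_pM2l AB); nra.
Qed.

Lemma pnorm_triangle (x y z : pt) :
  pnorm (pdiff x z) <= pnorm (pdiff x y) + pnorm (pdiff y z).
Proof.
rewrite -(@ler_pXn2r _ 2) ?nnegrE ?addr_ge0 ?pnorm_ge0//.
have := sum_mul_le (pdiff x y) (pdiff y z).
rewrite sqrrD !pnorm_sqr => h.
rewrite (_ : \sum_(i < dim) tnth (pdiff x z) i ^+ 2 =
   \sum_(i < dim) tnth (pdiff x y) i ^+ 2 +
   (\sum_(i < dim) tnth (pdiff x y) i * tnth (pdiff y z) i) *+ 2 +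
   \sum_(i < dim) tnth (pdiff y z) i ^+ 2).
  by rewrite lerD2r lerD2l lerMn2r h orbT.
rewrite -sumrMnl -!big_split/=; apply: eq_bigr => i _.
by rewrite !tnth_mktuple; ring.
Qed.

Lemma pnorm_pdiffC (x y : pt) : pnorm (pdiff x y) = pnorm (pdiff y x).
Proof.
by rewrite /pnorm; congr Num.sqrt; apply: eq_bigr => i _; rewrite !tnth_mktuple -sqrrN opprB.
Qed.

(** The factor [dim], in place of its square root, is a cheap bound; it accounts for [dim%:R] as the
    radius of a cell and for the cube of half-side [(L - dim) / dim] placed inside a ball. *)
Lemma pnorm_le_coord (x : pt) (s : R) : 0 <= s -> (forall i, `|tnth x i| <= s) ->
  pnorm x <= dim%:R * s.
Proof.
move=> s0 h; rewrite -(@ler_pXn2r _ 2) ?nnegrE ?pnorm_ge0 ?mulr_ge0//.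
rewrite pnorm_sqr (le_trans (y := \sum_(i < dim) s ^+ 2))//.
  by apply: ler_sum => i _; rewrite -real_normK ?num_real// ler_pXn2r ?nnegrE//.
rewrite sumr_const card_ord exprMn -[leLHS]mulr_natl ler_wpM2r ?sqr_ge0//.
by rewrite -natrX ler_nat -[X in (X <= _)%N]expn1; case: (dim) => // d; rewrite leq_pexp2l.
Qed.

Lemma coord_diff_le (x y : pt) i : `|tnth x i - tnth y i| <= pnorm (pdiff x y).
Proof. by have := coord_le_pnorm (pdiff x y) i; rewrite tnth_mktuple. Qed.

End EuclideanNorm.

(** * Absorbing a boundary condition into the activity; mixing for functions *)

Section Absorb.
Context {R : realType} {dim : nat}.
Notation pt := (dim.-tuple R).
Notation cf := (@confT R dim).
Variable phi : pt -> \bar R.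
Hypothesis mphi : measurable_fun setT phi.
Hypothesis phi0 : forall x, (0 <= phi x)%E.

(** The activity felt in the external field of [eta]. The mixing hypothesis concerns free boundary
    conditions and varying activities; this form makes it apply to boundary conditions. Since [phi]
    is nonnegative the factor is at most 1, so the bound [lambda] survives. *)
Definition field_act (lam : pt -> R) (eta : seq pt) (z : pt) : R :=
  lam z * fine (expeR (- \sum_(x <- eta) phi (pdiff z x))).

Let sum0 (eta : seq pt) z : (0 <= \sum_(x <- eta) phi (pdiff z x))%E.
Proof. exact: sume_ge0. Qed.

Let expo (a : \bar R) : (0 <= a)%E ->
  expeR (- a) = (fine (expeR (- a)))%:E /\ 0 <= fine (expeR (- a)) <= 1.
Proof.
move=> a0.
have e1 : (expeR (- a) <= 1)%E by rewrite -expeR0 lee_expeR oppe_le0.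
have e0 : (0 <= expeR (- a))%E by exact: expeR_ge0.
have ef : expeR (- a) \is a fin_num by rewrite ge0_fin_numE// (le_lt_trans e1)// ltry.
by split; [rewrite fineK|rewrite -!lee_fin fineK// e0 e1].
Qed.

Lemma field_activity lam lambda eta : activity lam lambda ->
  activity (field_act lam eta) lambda.
Proof.
move=> [mlam lb [M HM]]; split.
- apply: measurable_funM => //; apply: (measurableT_comp (fine_measurable measurableT)).
  apply: (measurableT_comp measurable_expeR); apply: measurableT_comp => //.
  have m := measurable_sum_conf (measurable_phi_pdiff mphi).
  have m2 : measurable_fun setT (fun z : pt => (z, eta : cf)).
    by apply/measurable_fun_pair; [exact: measurable_id|exact: measurable_cst].
  exact: (measurableT_comp m m2).
- move=> x; have [_ /andP[h0 h1]] := expo (sum0 eta x).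
  have /andP[l0 l1] := lb x.
  rewrite /field_act mulr_ge0//= (le_trans _ l1)//.
  by rewrite ler_piMr.
- exists M => x /=; rewrite /field_act mulf_eq0 negb_or => /andP[h _]; exact: HM.
Qed.

Lemma weight_field lam eta s :
  weight phi lam eta s = weight phi (field_act lam eta) [::] s.
Proof.
rewrite /weight /field_act big_split/= EFinM -muleA; congr (_ * _)%E.
have -> : cross phi s [::] = 0%E by rewrite /cross big1// => x _; rewrite big_nil.
rewrite adde0 expeR_oppD ?energy_ge0 ?cross_ge0// muleC; congr (_ * _)%E.
elim: s => [|z s IH]; first by rewrite /cross !big_nil oppe0 expeR0.
rewrite /cross !big_cons expeR_oppD ?cross_ge0// EFinM -IH; congr (_ * _)%E.
by have [<-] := expo (sum0 eta z).
Qed.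

Lemma gexp_field lam eta F : gexp phi lam eta F = gexp phi (field_act lam eta) [::] F.
Proof.
have E : weight phi lam eta = weight phi (field_act lam eta) [::].
  by apply/funext => s; exact: weight_field.
by rewrite /gexp /mass E.
Qed.

(** Any lower bound [rho] on pairwise distances can replace [set_dist], including when the
    activities coincide and the infimum is over an empty set. *)
Lemma tv_restr_le (lambda alpha beta rho v : R) (Lam : set pt) lam lam' :
  0 < alpha -> 0 < beta ->
  (tv_restr phi Lam lam lam' <=
        alpha%:E * vol Lam * expeR (- (beta%:E * set_dist Lam [set x | lam x != lam' x])))%E ->
  (vol Lam <= v%:E)%E -> (0 <= vol Lam)%E ->
  (forall z z', Lam z -> lam z' != lam' z' -> rho <= pnorm (pdiff z z')) ->
  (tv_restr phi Lam lam lam' <= (alpha * v * expR (- (beta * rho)))%:E)%E.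
Proof.
move=> a0 b0 h hv v0 hd; apply: (le_trans h).
rewrite EFinM; apply: lee_pmul.
- by rewrite mule_ge0 ?lee_fin ?(ltW a0).
- exact: expeR_ge0.
- by rewrite EFinM lee_wpmul2l ?lee_fin ?(ltW a0).
rewrite -[leRHS]/(expeR (- (beta * rho)%:E)) lee_expeR leeN2 EFinM lee_wpmul2l ?lee_fin ?(ltW b0)//.
apply: le_ereal_inf_tmp => _ [[z z'] [/= Lz dz] <-]; rewrite lee_fin; exact: hd.
Qed.

Section tv.
Variables (lambda : R) (Lam : set pt) (lam lam' : pt -> R) (t : R).
Hypothesis mLam : measurable Lam.
Hypothesis al : activity lam lambda.
Hypothesis al' : activity lam' lambda.
Hypothesis tvt : (tv_restr phi Lam lam lam' <= t%:E)%E.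

Let restr (Z : seq pt) : seq pt := [seq x <- Z | `[< Lam x >]].

Let mrestr : measurable_fun setT (fun Z : cf => restr Z : cf).
Proof.
have mb : measurable_fun setT (fun p : unit * pt => `[< Lam p.2 >]).
  apply: (measurableT_comp (f := fun x : pt => `[< Lam x >])) => //.
  apply: (@measurable_fun_bool _ _ _ _ true); rewrite setTI.
  rewrite (_ : _ @^-1` _ = Lam)//; apply/seteqP; split => x /=.
    by move/asboolP.
  by move=> ?; apply/asboolP.
exact: (measurableT_comp (measurable_filter_conf mb) (pair1_measurable tt)).
Qed.

Lemma measurable_comp_restr (h : cf -> \bar R) : measurable_fun setT h ->
  measurable_fun setT (fun Z : cf => h (restr Z)).
Proof. by move=> mh; exact: (measurableT_comp mh mrestr). Qed.

Lemma tv_event (B : set (seq pt)) : conf_event B ->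
  (gexp phi lam [::] (fun s => (\1_B (restr s))%:E) <=
   gexp phi lam' [::] (fun s => (\1_B (restr s))%:E) + t%:E)%E.
Proof.
move=> cB.
have mB : measurable_fun setT (fun s : cf => (\1_B (restr s))%:E : \bar R).
  apply: (measurable_comp_restr (h := fun s => (\1_B s)%:E)).
  apply/measurable_EFinP; apply: measurable_indic; apply/conf_measurableP.
  exact: (cB.1).
have B0 s : (0 <= (\1_B (restr s))%:E :> \bar R)%E by rewrite lee_fin.
have B01 s : (0 <= ((\1_B (restr s))%:E : \bar R) <= 1)%E.
  by rewrite !lee_fin indicE lern1 leq_b1 ler0n.
have E : (fun s : seq pt => (\1_(restr_event Lam B) s)%:E : \bar R) =
    (fun s => (\1_B (restr s))%:E).
  apply/funext => s; rewrite !indicE; congr (_%:R%:E).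
have fin l : activity l lambda -> gexp phi l [::] (fun s => (\1_B (restr s))%:E) =
    (gibbs_prob phi l (restr_event Lam B))%:E.
  move=> a; rewrite /gibbs_prob E fineK// ge0_fin_numE.
    by rewrite (le_lt_trans (gexp_le1 mphi phi0 a [::] B01 mB))// ltry.
  exact: (gexp_ge0 mphi phi0 a).
rewrite !fin// -EFinD lee_fin -lerBlDl.
have : (`|gibbs_prob phi lam (restr_event Lam B) - gibbs_prob phi lam' (restr_event Lam B)|%:E <= t%:E)%E.
  apply: le_trans tvt; apply: ereal_sup_ubound; by exists B.
by rewrite lee_fin; apply: le_trans; exact: ler_norm.
Qed.

(* Layer-cake discretisation of [h] at the levels [k / m]. *)
Lemma tv_unit_fun (h : cf -> \bar R) : (forall s, 0 <= h s <= 1)%E ->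
  measurable_fun setT h -> perm_inv h ->
  (gexp phi lam [::] (fun s => h (restr s)) <=
   gexp phi lam' [::] (fun s => h (restr s)) + t%:E)%E.
Proof.
move=> h01 mh ph.
have h0 s : (0 <= h s)%E by case/andP: (h01 s).
pose hr s := fine (h s).
have hrE s : h s = (hr s)%:E.
  rewrite /hr fineK// ge0_fin_numE//; case/andP: (h01 s) => _ h1.
  by rewrite (le_lt_trans h1)// ltry.
have hr01 s : 0 <= hr s <= 1 by rewrite -!lee_fin -hrE.
have mhR : measurable_fun setT (fun s : cf => h (restr s)) by exact: measurable_comp_restr.
suff main m : (gexp phi lam [::] (fun s => h (restr s)) <=
   gexp phi lam' [::] (fun s => h (restr s)) + t%:E + (m.+1%:R^-1)%:E)%E.
  apply/lee_addgt0Pr => e e0.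
  have [m me] : exists m, m.+1%:R^-1 <= e.
    exists (Num.truncn e^-1); rewrite -[leRHS](invrK e) lef_pV2 ?posrE ?invr_gt0//.
    have /andP[_ eh] : (Num.truncn e^-1)%:R <= e^-1 < (Num.truncn e^-1).+1%:R.
      by apply: truncn_itv; rewrite invr_ge0 ltW.
    exact: ltW.
  by apply: (le_trans (main m)); apply: leeD => //; rewrite lee_fin.
pose B (k : nat) : set (seq pt) := [set s | k.+1%:R / m.+1%:R <= hr s].
have cB k : conf_event (B k).
  split.
    apply/conf_measurableP.
    have mr : measurable_fun setT (fun s : cf => k.+1%:R / m.+1%:R <= hr s).
      apply: measurable_fun_ler; first exact: measurable_cst.
      exact: (measurableT_comp (fine_measurable measurableT) mh).
    have := mr measurableT [set true] Logic.I; rewrite setTI.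
    by congr measurable; apply/seteqP; split.
  by move=> s t' st; rewrite /B/= /hr (ph _ _ st).
pose c : R := m.+1%:R^-1.
have c0 : 0 <= c by rewrite invr_ge0.
pose H s : \bar R := (\sum_(k < m.+1) c%:E * (\1_(B k) (restr s))%:E)%E.
have mBk k : measurable_fun setT (fun s : cf => (\1_(B k) (restr s))%:E : \bar R).
  apply: (measurable_comp_restr (h := fun s => (\1_(B k) s)%:E)).
  apply/measurable_EFinP; apply: measurable_indic; apply/conf_measurableP.
  exact: ((cB k).1).
have Bk0 k s : (0 <= (\1_(B k) (restr s))%:E :> \bar R)%E by rewrite lee_fin.
have mH : measurable_fun setT (fun s : cf => H s).
  by apply: emeasurable_sum => k; exact: emeasurable_funM.
have H0 s : (0 <= H s)%E by apply: sume_ge0 => k _; rewrite mule_ge0// lee_fin.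
have gH l : activity l lambda -> gexp phi l [::] H =
   (\sum_(k < m.+1) c%:E * gexp phi l [::] (fun s => (\1_(B k) (restr s))%:E))%E.
  move=> a.
  rewrite (gexpE mphi phi0 a)//.
  transitivity (\int[confmeas]_s \sum_(k < m.+1) (c%:E * (\1_(B k) (restr s))%:E *
     (gdens phi l [::] s * ((partition_fun phi l [::])^-1)%:E)))%E.
    apply: eq_integral => s _; rewrite /H ge0_sume_distrl// => k _.
    by rewrite mule_ge0 ?lee_fin.
  have Z0 : 0 <= (partition_fun phi l [::])^-1.
    by rewrite invr_ge0 (le_trans _ (partition_fun_ge1 mphi phi0 a [::])).
  have l0 x : 0 <= l x by case: a => _ /(_ x)/andP[].
  have ml : measurable_fun setT l by case: a.
  have D0 s : (0 <= gdens phi l [::] s * ((partition_fun phi l [::])^-1)%:E)%E.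
    by rewrite mule_ge0 ?lee_fin// gdens_ge0.
  have mD : measurable_fun setT (fun s : cf => gdens phi l [::] s * ((partition_fun phi l [::])^-1)%:E)%E.
    by apply: emeasurable_funM => //; exact: measurable_gdens.
  rewrite ge0_integral_sum//; last 2 first.
  - by move=> k; apply: emeasurable_funM => //; exact: emeasurable_funM.
  - by move=> k s _; rewrite mule_ge0// mule_ge0// lee_fin.
  apply: eq_bigr => k _; rewrite -(gexpZ mphi phi0 a)// (gexpE mphi phi0 a)//.
  - by move=> s; rewrite mule_ge0// lee_fin.
  - exact: emeasurable_funM.
(* Exactly the first [j] levels are reached, [j] being the integer part of [x * m.+1]: [H s] is the
   value rounded down to a multiple of [c]. *)
have Hle s : (H s <= h (restr s))%E /\ (h (restr s) <= H s + c%:E)%E.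
  pose x := hr (restr s).
  have /andP[x0 x1] : 0 <= x <= 1 by exact: hr01.
  pose j := Num.truncn (x * m.+1%:R).
  have xm : 0 <= x * m.+1%:R by rewrite mulr_ge0.
  have /andP[j1 j2] : j%:R <= x * m.+1%:R < j.+1%:R by exact: truncn_itv.
  have jm : (j <= m.+1)%N.
    by rewrite -(ler_nat R) (le_trans j1)// ler_piMl.
  have HE : H s = (c * j%:R)%:E.
    rewrite /H.
    transitivity (\sum_(k < m.+1) (c * (k < j)%N%:R)%:E)%E.
      apply: eq_bigr => k _; rewrite -EFinM indicE; congr ((c * _%:R)%:E).
      congr nat_of_bool; rewrite /B; apply/idP/idP.
        rewrite inE /= -/x ler_pdivrMr// => kx.
        by rewrite -ltnS -(ltr_nat R) (le_lt_trans kx).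
      move=> kj; rewrite inE /= -/x ler_pdivrMr// (le_trans _ j1)//.
      by rewrite ler_nat.
    rewrite sumEFin -mulr_sumr; congr ((c * _)%:E).
    rewrite -natr_sum; congr (_%:R).
    rewrite (eq_bigr (fun k : 'I_m.+1 => if (k < j)%N then 1%N else 0%N)); last by move=> k _; case: ltnP.
    by rewrite -big_mkcond -(big_ord_widen _ (fun=> 1%N) jm) sum_nat_const card_ord muln1.
  rewrite HE hrE -/x -EFinD !lee_fin; split.
    by rewrite mulrC ler_pdivrMr.
  rewrite -[X in _ + X]mulr1 -mulrDr natr1 mulrC -ler_pdivrMr /c ?invr_gt0// invrK; exact: ltW.
apply: (@le_trans _ _ (gexp phi lam [::] (fun s => H s + c%:E)%E)).
  apply: (gexp_le mphi phi0 al) => //.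
  - by move=> s; rewrite adde_ge0 ?lee_fin.
  - exact: emeasurable_funD.
  - by move=> s _; case: (Hle s).
rewrite (gexpD mphi phi0 al)//; rewrite (gexp_cst mphi phi0 al)// leeD2r//.
rewrite gH//.
(* Each level costs [t] but carries the weight [c = 1 / m.+1], so all [m.+1] levels together cost
   [t]. *)
apply: (@le_trans _ _ (\sum_(k < m.+1) (c%:E * gexp phi lam' [::] (fun s => (\1_(B k) (restr s))%:E) + (c * t)%:E))%E).
  apply: lee_sum => k _; rewrite EFinM -muleDr; last 2 first.
  - by [].
  - by rewrite fin_num_adde_defl.
  by apply: lee_wpmul2l; rewrite ?lee_fin//; exact: tv_event.
rewrite big_split/= -gH//; apply: leeD.
  by apply: (gexp_le mphi phi0 al') => // s _; case: (Hle s).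
rewrite sumEFin lee_fin sumr_const card_ord -mulr_natl mulrA divff ?mul1r//.
Qed.

(** An affine change of scale brings a function within [D] of [u] to values in [0, 1], at the price
    of a factor [2 * D]. This is what makes the mixing error proportional to the oscillation. *)
Lemma tv_osc (h : cf -> \bar R) (u D : R) : (forall s, 0 <= h s <= 1)%E ->
  measurable_fun setT h -> perm_inv h -> 0 <= D ->
  (forall s : seq pt, all (fun x => lam x != 0)%R s ->
    h (restr s) <= u%:E + D%:E /\ u%:E <= h (restr s) + D%:E)%E ->
  (forall s : seq pt, all (fun x => lam' x != 0)%R s ->
    h (restr s) <= u%:E + D%:E /\ u%:E <= h (restr s) + D%:E)%E ->
  (gexp phi lam [::] (fun s => h (restr s)) <=
   gexp phi lam' [::] (fun s => h (restr s)) + (2 * D * t)%:E)%E.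
Proof.
move=> h01 mh ph; rewrite le_eqVlt => /predU1P[<-|D0] hl hl'.
  (* For [D = 0] the rescaling used below would divide by 0; here both expectations equal [u]. *)
  have h0 s : (0 <= h s)%E by case/andP: (h01 s).
  have u0 : 0 <= u.
    have [_] := hl [::] isT; have [] := hl [::] isT; rewrite !adde0 => e1 e2.
    by rewrite -lee_fin (le_trans (h0 (restr [::]))).
  rewrite mulr0 mul0r adde0 (@le_trans _ _ u%:E)//.
    rewrite -(gexp_cst mphi phi0 al [::] u0); apply: (gexp_le mphi phi0 al) => //.
    - exact: measurable_comp_restr.
    - by move=> s /hl[]; rewrite adde0.
  rewrite -(gexp_cst mphi phi0 al' [::] u0); apply: (gexp_le mphi phi0 al') => //.
  - exact: measurable_comp_restr.
  - by move=> s /hl'[_]; rewrite adde0.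
have h0 s : (0 <= h s)%E by case/andP: (h01 s).
pose hr s := fine (h s).
have hrE s : h s = (hr s)%:E.
  rewrite /hr fineK// ge0_fin_numE//; case/andP: (h01 s) => _ h1.
  by rewrite (le_lt_trans h1)// ltry.
(* [c] is kept nonnegative because expectations are handled for nonnegative functions only. Clipping
   puts [g] in [0, 1] at every configuration, while [h = c + 2 * D * g] is needed only where all
   activities are nonzero. *)
pose c := Num.max (u - D) 0.
have c0 : 0 <= c by rewrite le_max lexx orbT.
pose g s : R := (Num.min (Num.max (hr s) c) (c + 2 * D) - c) / (2 * D).
have g01 s : 0 <= g s <= 1.
  have D2 : 0 < 2 * D by lra.
  rewrite /g divr_ge0 ?ler_pdivrMr ?(ltW D2)//= ?mul1r.
    by rewrite lerBlDl ge_min lexx orbT.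
  by rewrite subr_ge0 le_min le_max lexx orbT/=; lra.
pose ge s : \bar R := (g s)%:E.
have ge01 s : (0 <= ge s <= 1)%E by rewrite /ge !lee_fin.
have ge0 s : (0 <= ge s)%E by case/andP: (ge01 s).
have mge : measurable_fun setT (fun s : cf => ge s).
  apply/measurable_EFinP; apply: measurable_funM => //.
  apply: measurable_funB => //; apply: measurable_minr => //; apply: measurable_maxr => //.
  exact: (measurableT_comp (fine_measurable measurableT) mh).
have pge : perm_inv ge by move=> s s' ss; rewrite /ge /g /hr (ph _ _ ss).
have E (l : pt -> R) : (forall s : seq pt, all (fun x => l x != 0)%R s ->
    h (restr s) <= u%:E + D%:E /\ u%:E <= h (restr s) + D%:E)%E ->
   activity l lambda ->
   gexp phi l [::] (fun s => h (restr s)) =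
   (c%:E + (2 * D)%:E * gexp phi l [::] (fun s => ge (restr s)))%E.
  move=> hs a.
  have mgr := measurable_comp_restr mge.
  have mhr := measurable_comp_restr mh.
  have D2 : 0 <= 2 * D by lra.
  rewrite -(gexpZ mphi phi0 a)// -(gexp_cst mphi phi0 a [::] c0) -(gexpD mphi phi0 a)//; last 2 first.
  - by move=> s; rewrite mule_ge0.
  - exact: emeasurable_funM.
  have eqs (s : seq pt) : all (fun x => l x != 0) s ->
      h (restr s) = (c%:E + (2 * D)%:E * ge (restr s))%E.
    move=> /hs[]; rewrite hrE /ge -EFinM -!EFinD !lee_fin => h1 h2; congr (_%:E).
    have hr0 : 0 <= hr (restr s) by rewrite -lee_fin -hrE.
    have hc : c <= hr (restr s) by rewrite ge_max hr0 andbT; lra.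
    have hcD : hr (restr s) <= c + 2 * D.
      have : u - D <= c by rewrite le_max lexx.
      by lra.
    rewrite /g (max_idPl hc) (min_idPl hcD) mulrC divfK; last by rewrite gt_eqF//; lra.
    by rewrite addrC subrK.
  by apply/eqP; rewrite eq_le; apply/andP; split; apply: (gexp_le mphi phi0 a) => //;
    try (by move=> s; rewrite adde_ge0// mule_ge0);
    try (by apply: emeasurable_funD => //; exact: emeasurable_funM);
    move=> s /eqs ->.
rewrite (E _ hl al) (E _ hl' al').
have := tv_unit_fun ge01 mge pge.
have D2 : 0 <= 2 * D by lra.
move=> /(lee_wpmul2l (_ : (0 <= (2 * D)%:E)%E)) => /(_ D2).
rewrite -addeA muleDr//; last by rewrite fin_num_adde_defl.
by rewrite -EFinM => tv; rewrite leeD2l.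
Qed.

End tv.
End Absorb.

(** * Cells and oscillations *)

Section Cells.
Context {R : realType} {dim : nat}.
Notation pt := (dim.-tuple R).
Variable n : nat.
Hypothesis n0 : (0 < n)%N.

Notation I := {ffun 'I_dim -> 'I_(2 * n)}.

Lemma cidx_subproof (t : R) : (minn (Num.truncn (t + n%:R)) (2 * n).-1 < 2 * n)%N.
Proof. by rewrite gtn_min ltn_predL muln_gt0 n0 orbT. Qed.

(** The [minn] sends the face [t = n] to the last interval, so that [2 * n] unit intervals cover the
    closed side of the box. *)
Definition cidx (t : R) : 'I_(2 * n) := Ordinal (cidx_subproof t).

Definition cell (x : pt) : I := [ffun k => cidx (tnth x k)].

Definition cell_mid (a : I) : pt := [tuple (a k)%:R + 2^-1 - n%:R | k < dim].

Lemma cidx_center t : - n%:R <= t <= n%:R ->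
  `|t - ((cidx t)%:R + 2^-1 - n%:R)| <= 2^-1.
Proof.
move=> /andP[t1 t2].
have cE : cidx t = minn (Num.truncn (t + n%:R)) (2 * n).-1 :> nat by [].
rewrite cE.
have x0 : 0 <= t + n%:R by lra.
have /andP[k1 k2] := truncn_itv x0.
set k := Num.truncn _ in k1 k2 *.
have [kn|kn] := leqP k (2 * n).-1.
  rewrite ler_norml; apply/andP.
  by move: k2; rewrite -natr1 => k2; split; lra.
have e : (2 * n).-1.+1 = (2 * n)%N by rewrite prednK// muln_gt0.
have : (2 * n)%:R <= k%:R :> R by rewrite ler_nat -e.
have : (2 * n).-1%:R + 1 = (2 * n)%:R :> R by rewrite natr1 e.
rewrite natrM => e1 e2.
by rewrite ler_norml; apply/andP; split; lra.
Qed.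

Lemma cell_coord (x : pt) k : box n x -> `|tnth x k - tnth (cell_mid (cell x)) k| <= 2^-1.
Proof. by move=> bx; rewrite tnth_mktuple ffunE; exact: cidx_center. Qed.

Lemma cell_center (x : pt) : box n x -> pnorm (pdiff x (cell_mid (cell x))) <= dim%:R.
Proof.
move=> bx; rewrite -[leRHS]mulr1; apply: pnorm_le_coord => // k.
rewrite tnth_mktuple (le_trans (cell_coord k bx))//; lra.
Qed.

Lemma cell_mid_box a : box n (cell_mid a).
Proof.
move=> k; rewrite tnth_mktuple.
have a0 : 0 <= (a k)%:R :> R by [].
have a1 : (a k)%:R + 1 <= 2 * n%:R :> R by rewrite natr1 -natrM ler_nat.
by apply/andP; split; lra.
Qed.

(** Sup-distance at most [m] between indices, written with additions to avoid truncated
    subtraction. *)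
Definition cells_near (m : nat) (i : I) : {set I} :=
  [set j : I | [forall k, (j k <= i k + m)%N && (i k <= j k + m)%N]].

Lemma cells_nearC m i j : (j \in cells_near m i) = (i \in cells_near m j).
Proof. by rewrite !inE; apply: eq_forallb => k; rewrite andbC. Qed.

Lemma card_cells_near m i : (#|cells_near m i| <= (2 * m).+1 ^ dim)%N.
Proof.
pose f (j : I) : {ffun 'I_dim -> 'I_(2 * m).+1} := [ffun k => inord (j k + m - i k)%N].
have fi : {in cells_near m i &, injective f}.
  move=> j j'; rewrite !inE => /forallP h /forallP h' /ffunP e.
  apply/ffunP => k; apply: val_inj => /=.
  have := e k; rewrite !ffunE => /(congr1 val) /=.
  have /andP[a1 a2] := h k; have /andP[b1 b2] := h' k.
  rewrite !inordK; [lia | lia | lia].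
rewrite -(card_in_imset fi) (leq_trans (max_card _))//.
by rewrite card_ffun !card_ord.
Qed.

(** After exchanging the sums, [delta j] is counted once for each [i] near [j]; nearness is
    symmetric, so there are at most [(2 * m + 1)^dim] such [i]. *)
Lemma sum_cells_near m (delta : I -> R) : (forall i, 0 <= delta i) ->
  \sum_i \sum_(j in cells_near m i) delta j <= ((2 * m).+1 ^ dim)%:R * \sum_i delta i.
Proof.
move=> d0; rewrite (exchange_big_dep xpredT)//= mulr_sumr; apply: ler_sum => j _.
rewrite (eq_bigl (fun i => i \in cells_near m j)); last by move=> i; rewrite cells_nearC.
rewrite sumr_const -[leLHS]mulr_natl ler_wpM2r// ler_nat; exact: card_cells_near.
Qed.

(** [x] is within [1/2] of the midpoint of its own cell, so the indices differ by less than [m + 1],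
    hence by at most [m]. *)
Lemma cells_near_coord (x : pt) i (m : nat) : box n x ->
  (forall k, `|tnth x k - tnth (cell_mid i) k| < m%:R + 2^-1) -> cell x \in cells_near m i.
Proof.
move=> bx h; rewrite inE; apply/forallP => k.
have := cell_coord k bx; have := h k; rewrite /cell_mid !tnth_mktuple.
rewrite ltr_norml ler_norml => /andP[h1 h2] /andP[h3 h4].
set a := cell x k in h3 h4 *; set b := i k in h1 h2 *.
have e1 : (a%:R < b%:R + m%:R + 1 :> R) by lra.
have e2 : (b%:R < a%:R + m%:R + 1 :> R) by lra.
by apply/andP; split; rewrite -ltnS -(ltr_nat R) -natr1 natrD.
Qed.

Definition inbox (X : seq pt) := forall x, x \in X -> box n x.

Lemma inbox_cat X Y : inbox X -> inbox Y -> inbox (X ++ Y).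
Proof. by move=> hX hY x; rewrite mem_cat => /orP[/hX|/hY]. Qed.

Lemma inbox_filter p X : inbox X -> inbox [seq x <- X | p x].
Proof. by move=> hX x; rewrite mem_filter => /andP[_ /hX]. Qed.

Definition off (i : I) (X : seq pt) : seq pt := [seq z <- X | cell z != i].

Lemma off_cat i X Y : off i (X ++ Y) = off i X ++ off i Y.
Proof. exact: filter_cat. Qed.

(** One inequality is enough, since [X] and [Y] can be exchanged. Only configurations in the box are
    compared, because [cell] clips outer points into boundary cells. *)
Definition local_lip (f : seq pt -> \bar R) (delta : I -> R) :=
  forall i X Y, inbox X -> inbox Y -> off i X = off i Y -> (f X <= f Y + (delta i)%:E)%E.

(** Unwanted points are erased one cell of [J] at a time, each cell costing [delta j] however many
    points it contains. [Zl l] is what remains once the cells of [l] have been treated. *)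
Lemma lip_remove f delta (p : pt -> bool) U Z (J : {set I}) :
  local_lip f delta -> inbox U -> inbox Z ->
  (forall z, z \in Z -> ~~ p z -> cell z \in J) ->
  (f (U ++ Z) <= f (U ++ [seq z <- Z | p z]) + (\sum_(j in J) delta j)%:E)%E /\
  (f (U ++ [seq z <- Z | p z]) <= f (U ++ Z) + (\sum_(j in J) delta j)%:E)%E.
Proof.
move=> lf bU bZ hJ.
pose Zl l := [seq z <- Z | p z || (cell z \notin (l : seq I))].
have bl l : inbox (U ++ Zl l) by apply: inbox_cat => //; exact: inbox_filter.
have main l : (f (U ++ Z) <= f (U ++ Zl l) + (\sum_(j <- l) delta j)%:E)%E /\
   (f (U ++ Zl l) <= f (U ++ Z) + (\sum_(j <- l) delta j)%:E)%E.
  elim: l => [|j l [IH1 IH2]].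
    rewrite (_ : Zl [::] = Z) ?big_nil ?adde0//.
    by apply/all_filterP/allP => z _; rewrite in_nil orbT.
  have o : off j (U ++ Zl l) = off j (U ++ Zl (j :: l)).
    rewrite !off_cat; congr (_ ++ _); rewrite /off /Zl -!filter_predI.
    apply: eq_filter => z /=; rewrite in_cons negb_or.
    by case: (cell z == j) => //=.
  have o1 := lf j _ _ (bl l) (bl (j :: l)) o.
  have o2 := lf j _ _ (bl (j :: l)) (bl l) (esym o).
  rewrite big_cons EFinD; split.
    by apply: (le_trans IH1); rewrite addeA leeD2r.
  by apply: (le_trans o2); rewrite [X in (_ <= _ + X)%E]addeC addeA leeD2r.
have := main (enum J); rewrite big_enum /=.
rewrite (_ : Zl (enum J) = [seq z <- Z | p z])//.
rewrite /Zl; apply: eq_in_filter => z zZ.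
case: (boolP (p z)) => //= pz; rewrite mem_enum.
by rewrite (hJ z).
Qed.

(** Both configurations are compared with the empty one, hence the factor 2. *)
Lemma lip_global f delta X Y : local_lip f delta -> inbox X -> inbox Y ->
  (f X <= f Y + (2 * \sum_i delta i)%:E)%E.
Proof.
move=> lf bX bY.
have b0 : inbox [::] by [].
have S : \sum_(j in [set: I]%SET) delta j = \sum_i delta i by apply: eq_bigl => j; rewrite inE.
have [h1 _] := lip_remove (p := pred0) (U := [::]) (J := [set: I]%SET) lf b0 bX (fun _ _ _ => finset.in_setT _).
have [_ h2] := lip_remove (p := pred0) (U := [::]) (J := [set: I]%SET) lf b0 bY (fun _ _ _ => finset.in_setT _).
move: h1 h2; rewrite !filter_pred0 /= S => h1 h2.
apply: (le_trans h1); rewrite mulr_natl mulr2n EFinD addeA leeD2r//.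
Qed.

End Cells.

(** * One resampling from two configurations that differ in a single cell *)

Section Compare.
Context {R : realType} {dim : nat}.
Notation pt := (dim.-tuple R).
Notation cf := (@confT R dim).
Variable phi : pt -> \bar R.
Variable r : R.
Hypothesis r0 : 0 < r.
Hypothesis mphi : measurable_fun setT phi.
Hypothesis phi0 : forall x, (0 <= phi x)%E.
Hypothesis phir : forall x, r < pnorm x -> phi x = 0%E.
Variables (lam : pt -> R) (lambda : R).
Hypothesis alam : activity lam lambda.
Variable n : nat.
Hypothesis n0 : (0 < n)%N.
Hypothesis suplam : forall x, ~ box n x -> lam x = 0.
Variable L : R.
Hypothesis L0 : 0 <= L.

Notation I := {ffun 'I_dim -> 'I_(2 * n)}.
Notation cell := (cell n0).
Notation off := (off n0).
Notation cell_mid := (@cell_mid R dim n).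

Lemma ball_act_neq0 (y : pt) (Z : seq pt) : all (fun x => ball_act lam L y x != 0) Z ->
  inbox n Z /\ (forall z, z \in Z -> pnorm (pdiff z y) <= L).
Proof.
move=> /allP h; split => z /h; rewrite /ball_act.
  case: ifPn => [_|_]; last by rewrite eqxx.
  by move=> lz; apply: contrapT => nb; rewrite suplam ?eqxx in lz.
by case: ifPn => [/asboolP//|_]; rewrite eqxx.
Qed.

(** Points of cell [i] are within [dim] of its midpoint, so they lie in the ball and are erased from
    both configurations. *)
Lemma outside_covered (y : pt) i (X Y : seq pt) :
  pnorm (pdiff y (cell_mid i)) <= L - dim%:R -> inbox n X -> inbox n Y ->
  off i X = off i Y -> outside L y X = outside L y Y :> seq pt.
Proof.
move=> yi bX bY e.
have E W : inbox n W -> outside L y W = outside L y (off i W).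
  move=> bW; rewrite /outside /off -filter_predI; apply: eq_in_filter => z zW /=.
  case: (boolP (cell z == i)) => [/eqP ci|]; last by rewrite andbT.
  rewrite andbF; apply/negbTE; rewrite negbK; apply/asboolP; rewrite /ball_pt /=.
  have := cell_center n0 (bW z zW); rewrite ci => h.
  by apply: (le_trans (pnorm_triangle _ (cell_mid i) _)); rewrite [X in _ + X]pnorm_pdiffC; lra.
by rewrite (E X)// (E Y)// e.
Qed.

Lemma off_outside (y : pt) i (X Y : seq pt) : off i X = off i Y ->
  off i (outside L y X) = off i (outside L y Y).
Proof.
move=> e; rewrite /off /outside -!filter_predI.
rewrite (eq_filter (a2 := predI (fun z => ~~ `[< ball_pt y L z >]) (fun z => cell z != i))); last first.
  by move=> z /=; rewrite andbC.
rewrite [RHS](eq_filter (a2 := predI (fun z => ~~ `[< ball_pt y L z >]) (fun z => cell z != i))); last first.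
  by move=> z /=; rewrite andbC.
by rewrite [LHS]filter_predI [RHS]filter_predI; move: e; rewrite /off => ->.
Qed.

Lemma sum_phi_off i (z : pt) (U : seq pt) :
  (forall x, x \in U -> cell x = i -> phi (pdiff z x) = 0%E) ->
  (\sum_(x <- U) phi (pdiff z x) = \sum_(x <- off i U) phi (pdiff z x))%E.
Proof.
move=> h; rewrite /off big_filter [RHS]big_mkcond/= big_seq [RHS]big_seq.
by apply: eq_bigr => x xU; case: ifPn => //; rewrite negbK => /eqP /(h x xU).
Qed.

(** Sampled points are within [L] of [y] and points of cell [i] within [dim] of its midpoint, so the
    two kinds are more than [r] apart and do not interact. *)
Lemma weight_far (y : pt) i (U V Z : seq pt) :
  L + r + dim%:R < pnorm (pdiff y (cell_mid i)) -> inbox n U -> inbox n V ->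
  off i U = off i V ->
  weight phi (ball_act lam L y) U Z = weight phi (ball_act lam L y) V Z.
Proof.
move=> yi bU bV e.
have [h|h] := boolP (all (fun x => ball_act lam L y x != 0) Z); last by rewrite !weight_eq0.
have [_ hZ] := ball_act_neq0 h.
rewrite /weight; congr (_ * expeR (- (_ + _)))%E.
rewrite /cross; apply: eq_big_seq => z /hZ zy.
have far x : box n x -> cell x = i -> phi (pdiff z x) = 0%E.
  move=> bx cx; apply: phir; have := cell_center n0 bx; rewrite cx => h1.
  have h2 := pnorm_triangle y z (cell_mid i); have h3 := pnorm_triangle z x (cell_mid i).
  by move: h2; rewrite [pnorm (pdiff y z)]pnorm_pdiffC => h2; lra.
rewrite (@sum_phi_off i)//; last by move=> x /bU; exact: far.
by rewrite e -sum_phi_off// => x /bV; exact: far.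
Qed.

Variables (f : cf -> \bar R) (delta : I -> R).
Hypothesis f01 : forall s, (0 <= f s <= 1)%E.
Hypothesis mf : measurable_fun setT f.
Hypothesis pf : perm_inv f.
Hypothesis d0 : forall i, 0 <= delta i.
Hypothesis lf : local_lip n0 f delta.

Let f0 s : (0 <= f s)%E. Proof. by case/andP: (f01 s). Qed.

Let mfU (U : seq pt) : measurable_fun setT (fun Z : cf => f (U ++ (Z : seq pt))).
Proof. exact: (measurable_cat_out U mf). Qed.

Lemma gexp_le_add l eta (F G : cf -> \bar R) (c : R) : activity l lambda -> 0 <= c ->
  (forall s, 0 <= F s)%E -> measurable_fun setT F ->
  (forall s, 0 <= G s)%E -> measurable_fun setT G ->
  (forall s : cf, all (fun x => l x != 0) (s : seq pt) -> (F s <= G s + c%:E)%E) ->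
  (gexp phi l eta F <= gexp phi l eta G + c%:E)%E.
Proof.
move=> al c0 F0 mF G0 mG FG.
rewrite -(gexp_cst mphi phi0 al eta c0) -(gexpD mphi phi0 al)//.
apply: (gexp_le mphi phi0 al) => //.
- by move=> s; rewrite adde_ge0 ?lee_fin.
- exact: emeasurable_funD.
Qed.

Lemma resample_far (y : pt) i (X Y : seq pt) :
  L + r + dim%:R < pnorm (pdiff y (cell_mid i)) -> inbox n X -> inbox n Y ->
  off i X = off i Y ->
  (resample phi lam L f y X <= resample phi lam L f y Y + (delta i)%:E)%E.
Proof.
move=> yi bX bY e.
have bU : inbox n (outside L y X) by exact: inbox_filter.
have bV : inbox n (outside L y Y) by exact: inbox_filter.
have eUV := off_outside y e.
rewrite /resample.
have -> F : gexp phi (ball_act lam L y) (outside L y X) F =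
    gexp phi (ball_act lam L y) (outside L y Y) F.
  have E : weight phi (ball_act lam L y) (outside L y X) =
           weight phi (ball_act lam L y) (outside L y Y).
    by apply/funext => Z; exact: (weight_far _ yi).
  by rewrite /gexp /mass E.
apply: gexp_le_add => //; [exact: ball_activity|].
move=> Z /ball_act_neq0[bZ _]; apply: lf; try exact: inbox_cat.
by rewrite !off_cat eUV.
Qed.

Variables (m M : nat) (alpha beta : R).
Hypothesis alpha0 : 0 < alpha.
Hypothesis beta0 : 0 < beta.
Hypothesis ssm : forall (Lam : set pt) (lam lam' : pt -> R),
      measurable Lam -> bounded_pt Lam ->
      activity lam lambda -> activity lam' lambda ->
      (tv_restr phi Lam lam lam' <=
        alpha%:E * vol Lam * expeR (- (beta%:E * set_dist Lam [set x | lam x != lam' x])))%E.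
Hypothesis M_ge : 2 * L + r + dim%:R <= M%:R.

(** The part cut out of the ball is a cube in the sup-norm, so that the dropped points fall in
    [cells_near m i]. *)
Definition far_ball (y : pt) (i : I) : set pt :=
  [set z | (pnorm (pdiff z y) <= L) && ~~ [forall k, `|tnth z k - tnth (cell_mid i) k| <= m%:R]].

Lemma measurable_forall_coord d (T : measurableType d) (F : 'I_dim -> T -> bool) :
  (forall k, measurable_fun setT (F k)) ->
  measurable_fun setT (fun x => [forall k, F k x]).
Proof.
move=> mF; rewrite (_ : (fun x => _) = (fun x => all (fun k => F k x) (enum 'I_dim))); last first.
  apply/funext => x; apply/forallP/allP => h k; first by move=> _; exact: h.
  by apply: h; rewrite mem_enum.
by elim: (enum 'I_dim) => [|i l IH] //=; apply: measurable_and.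
Qed.

Lemma measurable_pred_set d (T : measurableType d) (p : T -> bool) :
  measurable_fun setT p -> measurable [set x | p x].
Proof.
move=> mp; have := mp measurableT [set true] Logic.I; rewrite setTI.
by congr measurable; apply/seteqP; split.
Qed.

Lemma measurable_dist_to (y : pt) : measurable_fun setT (fun z : pt => pnorm (pdiff z y)).
Proof.
have mz : measurable_fun setT (fun z : pt => (z, y)).
  by apply/measurable_fun_pair; [exact: measurable_id|exact: measurable_cst].
exact: (measurableT_comp measurable_pdist mz).
Qed.

Lemma measurable_far_ball y i : measurable (far_ball y i).
Proof.
apply: measurable_pred_set; apply: measurable_and.
  by apply: measurable_fun_ler; [exact: measurable_dist_to|exact: measurable_cst].
apply: measurable_neg; apply: measurable_forall_coord => k.
apply: measurable_fun_ler; last exact: measurable_cst.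
apply: measurableT_comp => //; apply: measurable_funB; last exact: measurable_cst.
exact: measurable_tnth.
Qed.

Lemma vol_far_ball y i : (0 <= vol (far_ball y i) <= ((2 * L) ^+ dim)%:E)%E.
Proof.
have mi : measurable_fun setT (fun x : pt => (\1_(far_ball y i) x)%:E : \bar R).
  by apply/measurable_EFinP; apply: measurable_indic; exact: measurable_far_ball.
apply/andP; split.
  rewrite /vol intR_ptmeas//.
  by apply: integral_ge0 => z _; rewrite lee_fin.
have -> : ((2 * L) ^+ dim)%:E =
    intR (fun x : pt => ind [forall k, tnth y k - L <= tnth x k <= tnth y k + L]).
  rewrite intR_box => [|k]; last by have := L0; lra.
  rewrite (eq_bigr (fun=> 2 * L)); last by move=> k _; ring.
  by rewrite big_const card_ord iter_mulr_1.
apply: le_intR => //.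
- apply: measurable_ind; apply: measurable_forall_coord => k; apply: measurable_and.
    by apply: measurable_fun_ler; [exact: measurable_cst|exact: measurable_tnth].
  by apply: measurable_fun_ler; [exact: measurable_tnth|exact: measurable_cst].
move=> x; rewrite indicE /ind lee_fin ler_nat.
case: (boolP (x \in far_ball y i)) => //; rewrite inE => /andP[h _].
rewrite lt0b; apply/forallP => k.
have := le_trans (coord_diff_le x y k) h; rewrite ler_norml => /andP[h1 h2].
by apply/andP; split; lra.
Qed.

(** The mixing bound for a volume at most that of a cube of side [2 * L] and a distance at least
    [m - r - 1]; the loss is the range [r] plus the half-width of a cell, rounded up to 1. *)
Definition tvbound : R := alpha * (2 * L) ^+ dim * expR (- (beta * (m%:R - r - 1))).

Lemma tvbound_ge0 : 0 <= tvbound.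
Proof.
by rewrite mulr_ge0 ?expR_ge0// mulr_ge0 ?(ltW alpha0)// exprn_ge0// mulr_ge0.
Qed.

(** If the absorbed activities differ at [z'], some point of cell [i] lies within [r] of [z']:
    otherwise cell [i] contributes nothing to the field there, and the rest of the boundary is
    common. A point of [far_ball] has a coordinate more than [m] away from the midpoint, and the
    triangle inequality in that coordinate gives the distance. *)
Lemma tv_far (y : pt) i (X Y : seq pt) : inbox n X -> inbox n Y -> off i X = off i Y ->
  (tv_restr phi (far_ball y i) (field_act phi (ball_act lam L y) (outside L y X))
     (field_act phi (ball_act lam L y) (outside L y Y)) <= tvbound%:E)%E.
Proof.
move=> bX bY e.
have aB := ball_activity alam L y.
have bb : bounded_pt (far_ball y i).
  exists (L + pnorm y) => x /andP[h _].
  pose o : pt := [tuple 0 | k < dim].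
  have E (z : pt) : pnorm (pdiff z o) = pnorm z.
    by congr pnorm; apply: eq_from_tnth => k; rewrite !tnth_mktuple subr0.
  by have := pnorm_triangle x y o; rewrite !E; lra.
have /andP[v0 v1] := vol_far_ball y i.
have := ssm (measurable_far_ball y i) bb (field_activity mphi phi0 (outside L y X) aB)
  (field_activity mphi phi0 (outside L y Y) aB).
move=> /tv_restr_le; apply => //.
move=> z z' /andP[zy /forallPn[k zk]] zz'.
rewrite -ltNge in zk.
have [x [bx cx xz']] : exists x, [/\ box n x, cell x = i & pnorm (pdiff z' x) <= r].
  apply: contrapT => no; move/negP: zz'; apply; apply/eqP.
  rewrite /field_act; congr (_ * fine (expeR (- _))).
  have far x : box n x -> cell x = i -> phi (pdiff z' x) = 0%E.
    move=> bx cx; apply: phir; rewrite ltNge; apply/negP => h; apply: no.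
    by exists x.
  rewrite (@sum_phi_off i); last first.
    by move=> x; rewrite mem_filter => /andP[_ /bX]; exact: far.
  rewrite (off_outside y e) -sum_phi_off//.
  by move=> x; rewrite mem_filter => /andP[_ /bY]; exact: far.
have h1 := coord_diff_le z z' k; have h2 := le_trans (coord_diff_le z' x k) xz'.
have h3 := cell_coord n0 k bx; rewrite cx in h3.
have h4 : `|tnth z k - tnth (cell_mid i) k| <= `|tnth z k - tnth z' k| +
    (`|tnth z' k - tnth x k| + `|tnth x k - tnth (cell_mid i) k|).
  rewrite (_ : tnth z k - tnth (cell_mid i) k = (tnth z k - tnth z' k) +
    ((tnth z' k - tnth x k) + (tnth x k - tnth (cell_mid i) k))); last by ring.
  by apply: (le_trans (ler_normD _ _)); rewrite lerD2l ler_normD.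
by lra.
Qed.

(** The points near cell [i] are dropped before the change of law and restored after it, hence the
    first factor 2; the second factor 2 is that of [tv_osc]. *)
Definition shell_err (i : I) : R :=
  2 * \sum_(j in cells_near m i) delta j + 2 * tvbound * \sum_(j in cells_near M i) delta j.

Lemma shell_err_ge0 i : 0 <= shell_err i.
Proof.
have S m' : 0 <= \sum_(j in cells_near m' i) delta j by apply: sumr_ge0.
by apply: addr_ge0; apply: mulr_ge0 => //; rewrite mulr_ge0 ?tvbound_ge0.
Qed.

Lemma resample_near (y : pt) i (X Y : seq pt) :
  pnorm (pdiff y (cell_mid i)) <= L + r + dim%:R -> inbox n X -> inbox n Y ->
  off i X = off i Y ->
  (resample phi lam L f y X <= resample phi lam L f y Y + (delta i + shell_err i)%:E)%E.
Proof.
move=> yi bX bY e.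
have bU : inbox n (outside L y X) by exact: inbox_filter.
have bV : inbox n (outside L y Y) by exact: inbox_filter.
have eUV := off_outside y e.
have aB := ball_activity alam L y.
set U := outside L y X in bU eUV *; set V := outside L y Y in bV eUV *.
set lU := field_act phi (ball_act lam L y) U.
set lV := field_act phi (ball_act lam L y) V.
have aU : activity lU lambda by exact: field_activity.
have aV : activity lV lambda by exact: field_activity.
have sup W Z : all (fun x => field_act phi (ball_act lam L y) W x != 0) Z ->
    inbox n Z /\ (forall z, z \in Z -> pnorm (pdiff z y) <= L).
  move=> h; apply: (@ball_act_neq0 y); apply: sub_all h => x.
  by rewrite /field_act mulf_eq0 negb_or => /andP[].
pose h (Z : cf) := f (V ++ (Z : seq pt)).
pose hr (Z : cf) := h [seq x <- (Z : seq pt) | `[< far_ball y i x >]].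
have mL := measurable_far_ball y i.
have mh : measurable_fun setT h by exact: mfU.
have mhr : measurable_fun setT hr by exact: (measurable_comp_restr mL).
have h01 Z : (0 <= h Z <= 1)%E by exact: f01.
have h0 Z : (0 <= h Z)%E by exact: f0.
have hr0 Z : (0 <= hr Z)%E by exact: f0.
have ph : perm_inv h by move=> s t st; apply: pf; rewrite perm_cat2l.
pose SN := \sum_(j in cells_near m i) delta j.
pose SB := \sum_(j in cells_near M i) delta j.
have SN0 : 0 <= SN by exact: sumr_ge0.
have SB0 : 0 <= SB by exact: sumr_ge0.
have rem (Z : seq pt) : inbox n Z -> (forall z, z \in Z -> pnorm (pdiff z y) <= L) ->
    (h Z <= hr Z + SN%:E)%E /\ (hr Z <= h Z + SN%:E)%E.
  move=> bZ hZ; apply: (lip_remove lf bV bZ) => z zZ /asboolPn nz.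
  apply: cells_near_coord; first exact: bZ.
  move=> k; have [h1|h1] := leP `|tnth z k - tnth (cell_mid i) k| m%:R; first by lra.
  exfalso; apply: nz; apply/andP; split; first exact: hZ.
  by apply/forallPn; exists k; rewrite -ltNge.
(* Every sampled point is within [2 * L + r + dim <= M] of the midpoint, so dropping all of them
   costs at most [SB] and leaves [f V], the centre [u] for [tv_osc]. *)
have all_ (W Z : seq pt) : all (fun x => field_act phi (ball_act lam L y) W x != 0) Z ->
    (hr Z <= f V + SB%:E)%E /\ (f V <= hr Z + SB%:E)%E.
  move=> /sup[bZ hZ].
  have bZ' : inbox n [seq x <- Z | `[< far_ball y i x >]] by exact: inbox_filter.
  have [] := lip_remove (p := pred0) (J := cells_near M i) lf bV bZ'; last first.
    by rewrite filter_pred0 cats0.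
  move=> z; rewrite mem_filter => /andP[_ zZ] _.
  apply: cells_near_coord; first exact: bZ.
  move=> k; have h1 := coord_diff_le z (cell_mid i) k.
  have h2 := pnorm_triangle z y (cell_mid i); have h3 := hZ z zZ.
  by have := M_ge; lra.
have fV : f V = (fine (f V))%:E.
  rewrite fineK// ge0_fin_numE//; case/andP: (f01 V) => _ h1.
  by rewrite (le_lt_trans h1)// ltry.
rewrite /resample -/U -/V (gexp_field phi0 (ball_act lam L y) U) (gexp_field phi0 (ball_act lam L y) V) -/lU -/lV.
(* [delta i] pays for replacing [U] by [V] inside [f]; the law is still the one with boundary
   [U]. *)
have s1 : (gexp phi lU [::] (fun Z => f (U ++ Z)) <= gexp phi lU [::] h + (delta i)%:E)%E.
  apply: gexp_le_add => // Z /sup[bZ _]; apply: lf; try exact: inbox_cat.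
  by rewrite !off_cat eUV.
have s2 : (gexp phi lU [::] h <= gexp phi lU [::] hr + SN%:E)%E.
  by apply: gexp_le_add => // Z /sup[bZ hZ]; have [] := rem Z bZ hZ.
(* The only change of law; [hr] looks at the points of [far_ball] alone, where the two laws are
   close. *)
have s3 : (gexp phi lU [::] hr <= gexp phi lV [::] hr + (2 * SB * tvbound)%:E)%E.
  apply: (tv_osc mphi phi0 mL aU aV (tv_far y bX bY e) h01 mh ph SB0 (u := fine (f V))).
  - by move=> Z /all_[h1 h2]; rewrite -fV.
  - by move=> Z /all_[h1 h2]; rewrite -fV.
have s4 : (gexp phi lV [::] hr <= gexp phi lV [::] h + SN%:E)%E.
  by apply: gexp_le_add => // Z /sup[bZ hZ]; have [] := rem Z bZ hZ.
apply: (le_trans s1).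
apply: (@le_trans _ _ (gexp phi lV [::] h + SN%:E + (2 * SB * tvbound)%:E + SN%:E + (delta i)%:E)%E).
  rewrite leeD2r// (le_trans s2)// leeD2r// (le_trans s3)// leeD2r//.
rewrite -!addeA -!EFinD; apply: leeD => //; rewrite lee_fin /shell_err -/SN -/SB; lra.
Qed.

End Compare.

(** * Choice of the radii *)

Section Asymptotics.
Context {R : realType}.

Lemma expR_ge_pow (q : nat) (x : R) : (0 < q)%N -> 0 <= x -> (x / q%:R) ^+ q <= expR x.
Proof.
move=> q0 x0; have qn : q%:R != 0 :> R by rewrite pnatr_eq0 -lt0n.
have -> : expR x = expR (x / q%:R) ^+ q.
  by rewrite -expRM_natl mulrC divfK.
rewrite ler_pXn2r ?nnegrE ?expR_ge0 ?divr_ge0//.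
by rewrite (le_trans _ (expR_ge1Dx _))// lerDr.
Qed.

(** With [q = p + 1], the bound [(x / q)^q <= expR x] leaves one power of [m] in reserve, which
    beats the constant [K] once [m >= K]. *)
Lemma pow_expR_small (p : nat) (B beta : R) : 0 <= B -> 0 < beta ->
  exists m0 : nat, forall m : nat, (m0 <= m)%N -> B * m%:R ^+ p * expR (- (beta * m%:R)) <= 1.
Proof.
move=> B0 b0.
pose q := p.+1; pose K : R := B * (q%:R / beta) ^+ q.
have q0 : 0 < q%:R :> R by rewrite ltr0n.
have K0 : 0 <= K by rewrite mulr_ge0// exprn_ge0// divr_ge0// ltW.
have /andP[_ hK] := truncn_itv K0.
exists (Num.truncn K).+1 => m mK.
have m1 : (0 < m)%N by exact: leq_trans mK.
have mR : 0 < m%:R :> R by rewrite ltr0n.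
have Km : K <= m%:R by rewrite ltW// (lt_le_trans hK)// ler_nat.
rewrite expRN ler_pdivrMr ?expR_gt0// mul1r.
have := @expR_ge_pow q (beta * m%:R) isT (mulr_ge0 (ltW b0) (ltW mR)).
apply: le_trans.
rewrite -(@ler_pM2r _ ((q%:R / beta) ^+ q)); last by rewrite exprn_gt0// divr_gt0.
rewrite -exprMn (_ : beta * m%:R / q%:R * (q%:R / beta) = m%:R); last first.
  by field; rewrite !gt_eqF.
rewrite mulrAC -/K exprS ler_wpM2r// exprn_ge0//.
Qed.

Lemma root_nat (q : nat) (L : R) : (0 < q)%N -> 1 <= L ->
  exists m : nat, [/\ (0 < m)%N, m%:R ^+ q <= L & L < m.+1%:R ^+ q].
Proof.
move=> q0 L1.
have L0 : 0 <= L by exact: le_trans L1.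
have /andP[_ hL] := truncn_itv L0.
pose P (m : nat) := m%:R ^+ q <= L.
have P1 : P 1%N by rewrite /P expr1n.
have bd m : P m -> (m <= (Num.truncn L).+1)%N.
  move=> Pm; rewrite -(ler_nat R) ltW// (le_lt_trans _ hL)// (le_trans _ Pm)//.
  case: m {Pm} => [|m]; first by rewrite exprn_ge0.
  by rewrite -natrX ler_nat -[X in (X <= _)%N]expn1 leq_pexp2l.
have ex : exists m, P m by exists 1%N.
case: (ex_maxnP ex bd) => m Pm mmax.
exists m; split => //; first exact: mmax.
rewrite ltNge; apply/negP => h; have := mmax _ h; by rewrite ltnn.
Qed.

(* [m] of order [L^(1/(4 d))] makes the shell term, of order [L^(d-1/2) m^d], negligible
   against the covered volume [L^d], while [exp (- beta m)] beats every power of [L]. *)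
Lemma radius_choice (d : nat) (r alpha beta : R) : (0 < d)%N -> 0 < r -> 0 < alpha -> 0 < beta ->
  exists L0 : R, 0 < L0 /\ forall L : R, L0 <= L -> d%:R <= L /\
    exists m M : nat, 2 * L + r + d%:R <= M%:R /\
     1 + (2 * (L + r + d%:R)) ^+ d.-1 *
         (2 * Num.sqrt ((L + r + d%:R) ^+ 2 - (L - d%:R) ^+ 2)) *
         (2 * ((2 * m).+1 ^ d)%:R +
          2 * (alpha * (2 * L) ^+ d * expR (- (beta * (m%:R - r - 1)))) * ((2 * M).+1 ^ d)%:R)
     <= ((L - d%:R) / d%:R) ^+ d.
Proof.
move=> d0 r0 a0 b0.
have kap : 1 <= d%:R :> R by rewrite ler1n.
set kp : R := d%:R in kap *.
(* The factor [7 ^+ d] comes from [2 M + 1 <= 7 L]. *)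
pose A0 : R := alpha * 2 ^+ d * 7 ^+ d * expR (beta * (r + 1)) * (2 ^+ (4 * d)) ^+ (2 * d).
have A00 : 0 <= A0 by rewrite !mulr_ge0 ?expR_ge0 ?exprn_ge0// ltW.
(* The exponent arises from [L < (m + 1)^(4 d) <= (2 m)^(4 d)], raised to the power [2 d]. *)
have [m0 hm0] := pow_expR_small (4 * d * (2 * d)) A00 b0.
pose c1 : R := (r + 2 * kp) * 3.
have c10 : 0 <= c1 by rewrite /c1; nra.
pose C2 : R := 4 ^+ d.-1 * (2 * Num.sqrt c1) * (2 * 5 ^+ d + 2).
have C20 : 0 <= C2 by rewrite !mulr_ge0 ?sqrtr_ge0 ?exprn_ge0// addr_ge0 ?mulr_ge0 ?exprn_ge0.
pose C3 : R := (2 * kp) ^+ d * (1 + C2).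
have C30 : 0 <= C3 by rewrite mulr_ge0 ?exprn_ge0; lra.
have /andP[_ hC3] := truncn_itv C30.
(* [m >= m0] makes the mixing term at most 1; [m >= C3] absorbs all remaining constants. *)
pose ms := maxn m0 (Num.truncn C3).+1.
pose q := (4 * d)%N.
have q0 : (0 < q)%N by rewrite muln_gt0.
pose L0 : R := ms%:R ^+ q + (1 + r + 2 * kp).
exists L0; split; first by rewrite ltr_wpDl ?exprn_ge0//; lra.
move=> L LL0.
have msq : 0 <= ms%:R ^+ q :> R by rewrite exprn_ge0.
have Lr : 1 + r + 2 * kp <= L by rewrite (le_trans _ LL0)// /L0 lerDr.
have L1 : 1 <= L by lra.
split; first by lra.
have [m [m1 mL Lm]] := root_nat q0 L1.
have mms : (ms <= m)%N.
  rewrite leqNgt; apply/negP => h.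
  have : L < ms%:R ^+ q.
    apply: (lt_le_trans Lm); rewrite ler_pXn2r ?nnegrE// ler_nat//.
  by rewrite ltNge => /negP; apply; rewrite (le_trans _ LL0)// /L0 lerDl; lra.
have mm0 : (m0 <= m)%N by rewrite (leq_trans _ mms)// leq_maxl.
have mC3 : C3 <= m%:R.
  by rewrite ltW// (lt_le_trans hC3)// ler_nat (leq_trans _ mms)// leq_maxr.
have mR : 1 <= m%:R :> R by rewrite ler1n.
have M0 : 0 <= 2 * L + r + kp by lra.
have /andP[M1 M2] := truncn_itv M0.
set M := (Num.truncn (2 * L + r + kp)).+1 in M2.
exists m.
exists M.
split.
  by lra.
have M3 : (2 * M).+1%:R <= 7 * L.
  rewrite -natr1 natrM /M -natr1; move: M1; lra.
set w := Num.sqrt L.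
have w0 : 0 <= w by exact: sqrtr_ge0.
have w2 : w ^+ 2 = L by rewrite sqr_sqrtr//; lra.
set y : R := m%:R ^+ d.
have y1 : 1 <= y by rewrite exprn_ege1.
have ym : m%:R <= y by rewrite -[leLHS]expr1 ler_weXn2l.
(* The choice [q = 4 d] enters here: [y^4 = m^(4 d) <= L = w^2]. *)
have yw : y ^+ 2 <= w.
  have y0 : 0 <= y by lra.
  rewrite -(@ler_pXn2r _ 2) ?nnegrE ?exprn_ge0//.
  have y4 : (y ^+ 2) ^+ 2 = m%:R ^+ q by rewrite -exprM /y -exprM /q (mulnC d).
  by rewrite w2 y4.
have near_le : ((2 * m).+1 ^ d)%:R <= 5 ^+ d * y :> R.
  rewrite natrX -exprMn ler_pXn2r ?nnegrE ?mulr_ge0//.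
  by rewrite -natr1 natrM; lra.
have tv_le : alpha * (2 * L) ^+ d * expR (- (beta * (m%:R - r - 1))) * ((2 * M).+1 ^ d)%:R <= 1.
  apply: le_trans (hm0 m mm0).
  have -> : expR (- (beta * (m%:R - r - 1))) = expR (beta * (r + 1)) * expR (- (beta * m%:R)).
    by rewrite -expRD; congr expR; ring.
  have hM : ((2 * M).+1 ^ d)%:R <= 7 ^+ d * L ^+ d :> R.
    by rewrite natrX -exprMn ler_pXn2r ?nnegrE//; lra.
  have d2 : (0 < 2 * d)%N by rewrite muln_gt0.
  have d4 : (0 < 4 * d)%N by rewrite muln_gt0.
  have hLm : L ^+ (2 * d) <= (2 ^+ (4 * d)) ^+ (2 * d) * m%:R ^+ (4 * d * (2 * d)).
    rewrite [X in _ * X]exprM -exprMn ler_pXn2r ?nnegrE ?mulr_ge0 ?exprn_ge0//; last by lra.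
    rewrite -exprMn (le_trans (ltW Lm))// ler_pXn2r ?nnegrE ?mulr_ge0//.
    by rewrite -natr1; lra.
  have e0 : 0 <= expR (beta * (r + 1)) * expR (- (beta * m%:R)) by rewrite mulr_ge0 ?expR_ge0.
  set e1 := expR (beta * (r + 1)) in e0 *; set e2 := expR (- _) in e0 *.
  apply: (@le_trans _ _ (alpha * (2 * L) ^+ d * (e1 * e2) * (7 ^+ d * L ^+ d))).
    by rewrite ler_wpM2l// !mulr_ge0 ?exprn_ge0 ?expR_ge0 ?(ltW a0)//; lra.
  have -> : alpha * (2 * L) ^+ d * (e1 * e2) * (7 ^+ d * L ^+ d) =
     (alpha * 2 ^+ d * 7 ^+ d * e1 * e2) * L ^+ (2 * d).
    by rewrite exprMn mul2n -addnn exprD; ring.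
  apply: (@le_trans _ _ ((alpha * 2 ^+ d * 7 ^+ d * e1 * e2) * ((2 ^+ (4 * d)) ^+ (2 * d) * m%:R ^+ (4 * d * (2 * d))))).
    by rewrite ler_wpM2l// !mulr_ge0 ?exprn_ge0 ?expR_ge0 ?(ltW a0).
  by rewrite /A0 -/e1 le_eqVlt; apply/orP; left; apply/eqP; ring.
have shell : Num.sqrt ((L + r + kp) ^+ 2 - (L - kp) ^+ 2) <= Num.sqrt c1 * w.
  rewrite -sqrtrM// ler_wsqrtr//.
  rewrite (_ : _ - _ = (r + 2 * kp) * (2 * L + r)); last by ring.
  by rewrite /c1 -mulrA ler_wpM2l//; nra.
have b_le : (2 * (L + r + kp)) ^+ d.-1 <= 4 ^+ d.-1 * L ^+ d.-1.
  by rewrite -exprMn; case: (d.-1) => // e; rewrite ler_pXn2r ?nnegrE//; lra.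
have s_ge : (L / (2 * kp)) ^+ d <= ((L - kp) / kp) ^+ d.
  have k0 : 0 < kp by lra.
  rewrite ler_pXn2r ?nnegrE ?divr_ge0//; try lra.
  rewrite ler_pdivrMr; last lra.
  rewrite (_ : (L - kp) / kp * (2 * kp) = 2 * (L - kp)); last by field; rewrite gt_eqF.
  by lra.
apply: le_trans s_ge.
set X : R := L ^+ d.-1.
have X1 : 1 <= X by rewrite exprn_ege1.
have X0 : 0 <= X by lra.
have rhs : (L / (2 * kp)) ^+ d = X * w ^+ 2 / (2 * kp) ^+ d.
  by rewrite expr_div_n w2 /X -exprSr prednK.
rewrite rhs ler_pdivlMr ?exprn_gt0//; last by lra.
have lhs : (2 * (L + r + kp)) ^+ d.-1 *
         (2 * Num.sqrt ((L + r + kp) ^+ 2 - (L - kp) ^+ 2)) *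
         (2 * ((2 * m).+1 ^ d)%:R +
          2 * (alpha * (2 * L) ^+ d * expR (- (beta * (m%:R - r - 1)))) * ((2 * M).+1 ^ d)%:R)
   <= (4 ^+ d.-1 * X) * (2 * (Num.sqrt c1 * w)) * ((2 * 5 ^+ d + 2) * y).
  apply: ler_pM.
  - by rewrite mulr_ge0 ?exprn_ge0 ?mulr_ge0 ?sqrtr_ge0//; lra.
  - by rewrite addr_ge0 ?mulr_ge0 ?expR_ge0 ?exprn_ge0 ?(ltW a0)//; lra.
  - apply: ler_pM => //; first by rewrite exprn_ge0//; lra.
    by rewrite ler_wpM2l.
  - rewrite [leRHS]mulrDl; apply: lerD; first by rewrite -mulrA ler_wpM2l.
    by rewrite -mulrA; apply: (@le_trans _ _ (2 * 1)); [rewrite ler_wpM2l|lra].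
have lhs2 : (4 ^+ d.-1 * X) * (2 * (Num.sqrt c1 * w)) * ((2 * 5 ^+ d + 2) * y) = C2 * (X * w * y).
  by rewrite /C2; ring.
rewrite lhs2 in lhs.
set T := (X in 1 + X) in lhs *.
apply: (@le_trans _ _ ((1 + C2) * (X * w * y) * (2 * kp) ^+ d)).
  rewrite ler_wpM2r ?exprn_ge0//; first by lra.
  rewrite mulrDl mul1r lerD//.
  have w1 : 1 <= w by rewrite (le_trans _ yw)// exprn_ege1.
  by rewrite -[leLHS]mulr1 ler_pM// -[leLHS]mulr1 ler_pM.
rewrite mulrAC [X in X * _ <= _]mulrC -/C3.
have Xw : 0 <= X * w * y by rewrite !mulr_ge0//; lra.
(* [C3 <= m <= y] trades the constants for one factor [y], and [y^2 <= w] turns the shell order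
   [X w y] into the covered order [X w^2 = L^d]. *)
apply: (@le_trans _ _ (y * (X * w * y))).
  by rewrite ler_wpM2r// (le_trans mC3).
rewrite (_ : y * (X * w * y) = X * w * (y ^+ 2)); last by ring.
rewrite (_ : X * w ^+ 2 = X * w * w); last by ring.
by apply: ler_wpM2l => //; rewrite mulr_ge0.
Qed.

End Asymptotics.

(** * Contraction of oscillations *)

Section Volumes.
Context {R : realType}.

Lemma intR_add dim (f g : dim.-tuple R -> \bar R) :
  (forall x, 0 <= f x)%E -> (forall x, 0 <= g x)%E ->
  measurable_fun setT f -> measurable_fun setT g ->
  intR (fun x => f x + g x)%E = (intR f + intR g)%E.
Proof.
move=> f0 g0 mf mg; rewrite !intR_ptmeas//; last 2 first.
- by move=> x; rewrite adde_ge0.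
- exact: emeasurable_funD.
by rewrite ge0_integralD.
Qed.

Lemma intR_mulr dim (f : dim.-tuple R -> \bar R) (c : R) :
  (forall x, 0 <= f x)%E -> measurable_fun setT f -> 0 <= c ->
  intR (fun x => f x * c%:E)%E = (intR f * c%:E)%E.
Proof.
move=> f0 mf c0; rewrite !intR_ptmeas//; last 2 first.
- by move=> x; rewrite mule_ge0.
- exact: emeasurable_funM.
by rewrite ge0_integralZr.
Qed.

Lemma shell_vol dim (c : dim.-tuple R) (a b : R) : (0 < dim)%N -> 0 <= a -> a <= b ->
  (intR (fun y : dim.-tuple R => ind (a < pnorm (pdiff y c) <= b)%R)
    <= ((2 * b) ^+ dim.-1 * (2 * Num.sqrt (b ^+ 2 - a ^+ 2)))%:E)%E.
Proof.
case: dim c => // m c _ a0 ab.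
have b0 : 0 <= b by exact: le_trans ab.
have ab2 : a ^+ 2 <= b ^+ 2 by rewrite ler_pXn2r ?nnegrE.
have := shell_le c (lexx (0 : R)) (sqr_ge0 b) ab2.
rewrite sqrtr_sqr ger0_norm// => h; apply: le_trans h.
rewrite le_eqVlt; apply/orP; left; apply/eqP; congr intR.
apply/funext => y; congr ind.
have -> : \sum_(i < m.+1) (tnth y i - tnth c i) ^+ 2 = pnorm (pdiff y c) ^+ 2.
  by rewrite pnorm_sqr; apply: eq_bigr => i _; rewrite tnth_mktuple.
by rewrite add0r ltr_pXn2r ?nnegrE ?pnorm_ge0// ler_pXn2r ?nnegrE ?pnorm_ge0.
Qed.

End Volumes.

Section Contraction.
Context {R : realType} {dim : nat}.
Notation pt := (dim.-tuple R).
Notation cf := (@confT R dim).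
Hypothesis dim0 : (0 < dim)%N.
Variable phi : pt -> \bar R.
Variable r : R.
Hypothesis r0 : 0 < r.
Hypothesis mphi : measurable_fun setT phi.
Hypothesis phi0 : forall x, (0 <= phi x)%E.
Hypothesis phiN : forall x, phi (popp x) = phi x.
Hypothesis phir : forall x, r < pnorm x -> phi x = 0%E.
Variables (lam : pt -> R) (lambda : R).
Hypothesis alam : activity lam lambda.
Variable n : nat.
Hypothesis n0 : (0 < n)%N.
Hypothesis suplam : forall x, ~ box n x -> lam x = 0.
Variable L : R.
Hypothesis Lk : dim%:R <= L.
Variables (m M : nat) (alpha beta : R).
Hypothesis alpha0 : 0 < alpha.
Hypothesis beta0 : 0 < beta.
Hypothesis ssm : forall (Lam : set pt) (lam lam' : pt -> R),
      measurable Lam -> bounded_pt Lam ->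
      activity lam lambda -> activity lam' lambda ->
      (tv_restr phi Lam lam lam' <=
        alpha%:E * vol Lam * expeR (- (beta%:E * set_dist Lam [set x | lam x != lam' x])))%E.
Hypothesis M_ge : 2 * L + r + dim%:R <= M%:R.

Notation I := {ffun 'I_dim -> 'I_(2 * n)}.
Notation cell_mid := (@cell_mid R dim n).
Notation N := (@boxvol R dim n).

Let L0 : 0 <= L. Proof. exact: le_trans Lk. Qed.

Let N0 : 0 < N. Proof. exact: boxvol_gt0. Qed.

Let bx (y : pt) : \bar R := (\1_(box n) y)%:E.

Let bx0 y : (0 <= bx y)%E. Proof. by rewrite lee_fin. Qed.

Let mbx : measurable_fun setT bx. Proof. exact: measurable_ind_box. Qed.

Lemma intR_fin (g : pt -> \bar R) : measurable_fun setT g ->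
  (forall y, 0 <= g y <= bx y)%E -> exists2 v : R, intR g = v%:E & 0 <= v <= N.
Proof.
move=> mg gb.
have g0 y : (0 <= g y)%E by case/andP: (gb y).
have i0 : (0 <= intR g)%E by rewrite intR_ptmeas//; exact: integral_ge0.
have iN : (intR g <= N%:E)%E.
  by rewrite -intR_ind_box; apply: le_intR => // y; case/andP: (gb y).
have fg : intR g \is a fin_num by rewrite ge0_fin_numE// (le_lt_trans iN)// ltry.
by exists (fine (intR g)); rewrite ?fineK// -!lee_fin fineK// i0 iN.
Qed.

Section step.
Variables (f : cf -> \bar R) (delta : I -> R).
Hypothesis f01 : forall s, (0 <= f s <= 1)%E.
Hypothesis mf : measurable_fun setT f.
Hypothesis pf : perm_inv f.
Hypothesis d0 : forall i, 0 <= delta i.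
Hypothesis lf : local_lip n0 f delta.

Let f0 s : (0 <= f s)%E. Proof. by case/andP: (f01 s). Qed.

Let res := resample phi lam L f.

Let res0 y x : (0 <= res y x)%E. Proof. exact: (resample_ge0 mphi phi0 alam). Qed.

Let res1 y x : (res y x <= 1)%E. Proof. exact: (resample_le1 mphi phi0 alam). Qed.

Let mres x : measurable_fun setT (fun y : pt => res y x).
Proof.
have mr := measurable_resample mphi phi0 alam L f0 mf.
have m' : measurable_fun setT (fun y : pt => (y, x : cf)).
  by apply/measurable_fun_pair; [exact: measurable_id|exact: measurable_cst].
exact: (measurableT_comp mr m').
Qed.

Let mbres x : measurable_fun setT (fun y : pt => bx y * res y x)%E.
Proof. exact: emeasurable_funM. Qed.

Let bres01 x y : (0 <= bx y * res y x <= bx y)%E.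
Proof. by rewrite mule_ge0//= -[leRHS]mule1 lee_wpmul2l. Qed.

Lemma block_step_real x : exists2 v : R,
  intR (fun y => bx y * res y x)%E = v%:E & block_step phi lam n L f x = (v / N)%:E /\ 0 <= v <= N.
Proof.
have [v vE v01] := intR_fin (mbres x) (bres01 x).
by exists v => //; rewrite block_stepE vE -EFinM mulrC.
Qed.

Lemma block_step_01 x : (0 <= block_step phi lam n L f x <= 1)%E.
Proof.
have [v _ [-> /andP[v0 v1]]] := block_step_real x.
by rewrite !lee_fin divr_ge0 ?(ltW N0)// ler_pdivrMr// mul1r.
Qed.

Let cov i (y : pt) : \bar R := (bx y * ind (pnorm (pdiff y (cell_mid i)) <= L - dim%:R)%R)%E.

Let shl i (y : pt) : \bar R :=
  (bx y * ind (L - dim%:R < pnorm (pdiff y (cell_mid i)) <= L + r + dim%:R)%R)%E.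

Let E := shell_err r L delta m M alpha beta.

Let mcov i : measurable_fun setT (cov i).
Proof.
apply: emeasurable_funM => //; apply: measurable_ind.
by apply: measurable_fun_ler; [exact: measurable_dist_to|exact: measurable_cst].
Qed.

Let mshl i : measurable_fun setT (shl i).
Proof.
apply: emeasurable_funM => //; apply: measurable_ind; apply: measurable_and.
  by apply: measurable_fun_ltr; [exact: measurable_cst|exact: measurable_dist_to].
by apply: measurable_fun_ler; [exact: measurable_dist_to|exact: measurable_cst].
Qed.

Let cov0 i y : (0 <= cov i y)%E. Proof. by rewrite mule_ge0 ?ind_ge0. Qed.

Let shl0 i y : (0 <= shl i y)%E. Proof. by rewrite mule_ge0 ?ind_ge0. Qed.

Let E0 i : 0 <= E i.
Proof. by apply: shell_err_ge0. Qed.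

(** [va] bounds from below the volume of the centres whose ball covers the cell, where the
    difference vanishes, and [vc] bounds the shell from above. The three pointwise cases are
    integrated over the centre and divided by [N]. *)
Lemma block_lip (va vc : R) : 
  (forall i, va%:E <= intR (cov i))%E -> (forall i, intR (shl i) <= vc%:E)%E ->
  local_lip n0 (block_step phi lam n L f) (fun i => (1 - va / N) * delta i + vc / N * E i).
Proof.
move=> hva hvc i X Y bX bY e.
(* The gain from covered centres stands on the left, so that no subtraction of extended reals
   occurs. *)
have pw y : (bx y * res y X + cov i y * (delta i)%:E <=
    bx y * res y Y + (bx y * (delta i)%:E + shl i y * (E i)%:E))%E.
  rewrite /cov /shl /bx indicE.
  case: (boolP (y \in box n)) => yb; last by rewrite !mul0e !adde0.
  rewrite !mul1e; set p := pnorm _.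
  have [h1|h1] := leP p (L - dim%:R).
    rewrite /ind/= !mul1e !mul0e adde0 leeD2r//.
    rewrite le_eqVlt; apply/orP; left; apply/eqP.
    rewrite /res /resample.
    by rewrite (outside_covered h1 bX bY e).
  have [h2|h2] := leP p (L + r + dim%:R).
    rewrite /ind/= !mul0e adde0 !mul1e -EFinD.
    exact: (resample_near mphi phi0 phir alam suplam L0 f01 mf pf d0 lf m alpha0 beta0 ssm M_ge h2 bX bY e).
  rewrite /ind/= !mul0e !adde0.
  exact: (resample_far mphi phi0 phir alam suplam f01 mf d0 lf h2 bX bY e).
have [vX vXE [-> /andP[vX0 vX1]]] := block_step_real X.
have [vY vYE [-> /andP[vY0 vY1]]] := block_step_real Y.
have ib (P : pt -> bool) y : (0 <= bx y * ind (P y) <= bx y)%E.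
  by rewrite mule_ge0 ?ind_ge0//= -[leRHS]mule1 lee_wpmul2l// ind_le1.
have [c cE c01] := intR_fin (mcov i) (ib _).
have [w wE w01] := intR_fin (mshl i) (ib _).
have mb2 : measurable_fun setT (fun y => bx y * (delta i)%:E)%E by exact: emeasurable_funM.
have ms2 : measurable_fun setT (fun y => shl i y * (E i)%:E)%E by exact: emeasurable_funM.
have mc2 : measurable_fun setT (fun y => cov i y * (delta i)%:E)%E by exact: emeasurable_funM.
have di : (0 <= (delta i)%:E)%E by rewrite lee_fin.
have Ei : (0 <= (E i)%:E)%E by rewrite lee_fin E0.
have b20 y : (0 <= bx y * (delta i)%:E)%E by rewrite mule_ge0.
have s20 y : (0 <= shl i y * (E i)%:E)%E by rewrite mule_ge0.
have c20 y : (0 <= cov i y * (delta i)%:E)%E by rewrite mule_ge0.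
have r20 x y : (0 <= bx y * res y x)%E by rewrite mule_ge0.
have : (intR (fun y => bx y * res y X + cov i y * (delta i)%:E) <=
  intR (fun y => bx y * res y Y + (bx y * (delta i)%:E + shl i y * (E i)%:E)))%E.
  apply: le_intR => //.
  - exact: emeasurable_funD.
  - by apply: emeasurable_funD => //; exact: emeasurable_funD.
  - by move=> y; rewrite adde_ge0.
rewrite (intR_add (r20 X) c20)// (intR_add (r20 Y) (fun y => adde_ge0 (b20 y) (s20 y)))//; last first.
  exact: emeasurable_funD.
rewrite (intR_add b20 s20)// !intR_mulr// vXE vYE cE wE.
rewrite (@intR_ind_box R dim n : intR bx = N%:E).
rewrite -!EFinM -!EFinD !lee_fin => h.
have := hva i; rewrite cE lee_fin => hc; have := hvc i; rewrite wE lee_fin => hw.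
rewrite ler_pdivrMr//.
have -> : (vY / N + ((1 - va / N) * delta i + vc / N * E i)) * N =
   vY + (N * delta i + vc * E i - va * delta i).
  by field; rewrite gt_eqF.
have h1 : va * delta i <= c * delta i by rewrite ler_wpM2r.
have h2 : w * E i <= vc * E i by rewrite ler_wpM2r// E0.
by lra.
Qed.

Let vc0 : R := (2 * (L + r + dim%:R)) ^+ dim.-1 *
         (2 * Num.sqrt ((L + r + dim%:R) ^+ 2 - (L - dim%:R) ^+ 2)).

Hypothesis choice_ok : 1 + vc0 * (2 * ((2 * m).+1 ^ dim)%:R +
          2 * (alpha * (2 * L) ^+ dim * expR (- (beta * (m%:R - r - 1)))) * ((2 * M).+1 ^ dim)%:R)
     <= ((L - dim%:R) / dim%:R) ^+ dim.

Let k0 : 0 < dim%:R :> R. Proof. by rewrite ltr0n. Qed.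

Let N1 : 1 <= N.
Proof. by rewrite /boxvol exprn_ege1// ler1n muln_gt0. Qed.

Let s : R := (L - dim%:R) / dim%:R.

(** The ball of radius [L - dim] contains a cube of half-side [s]. For a cell in a corner of the
    box, little more than half of the cube may survive along each axis, hence [s^dim] and not
    [(2 s)^dim]. *)
Lemma cov_small i : s <= 2 * n%:R -> ((s ^+ dim)%:E <= intR (cov i))%E.
Proof.
move=> s2n.
have s0 : 0 <= s by rewrite divr_ge0 ?subr_ge0// ltW.
have cb k := cell_mid_box (R := R) i k.
pose a k : R := Num.max (- n%:R) (tnth (cell_mid i) k - s).
pose b k : R := Num.min n%:R (tnth (cell_mid i) k + s).
have ab k : s <= b k - a k.
  have /andP[c1 c2] := cb k; rewrite /a /b minEle maxEle.
  by case: ifP => _; case: ifP => _; lra.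
have ab' k : a k <= b k by have := ab k; lra.
apply: (@le_trans _ _ (intR (fun y : pt => ind [forall k, a k <= tnth y k <= b k]))).
  rewrite intR_box// lee_fin -[leLHS]mulr1 -[X in s ^+ X]card_ord -prodr_const mulr1.
  by apply: ler_prod => k _; rewrite s0 ab.
apply: le_intR => //.
- apply: measurable_ind; apply: measurable_forall_coord => k; apply: measurable_and.
    by apply: measurable_fun_ler; [exact: measurable_cst|exact: measurable_tnth].
  by apply: measurable_fun_ler; [exact: measurable_tnth|exact: measurable_cst].
- by move=> y; exact: ind_ge0.
move=> y; case: (boolP [forall k, _]) => [/forallP h|_]; last exact: cov0.
have hk k : [/\ - n%:R <= tnth y k, tnth y k <= n%:R,
    tnth (cell_mid i) k - s <= tnth y k & tnth y k <= tnth (cell_mid i) k + s].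
  by have := h k; rewrite /a /b ge_max le_min => /andP[/andP[? ?] /andP[? ?]].
have yb : box n y by move=> k; have [-> -> _ _] := hk k.
rewrite /cov /bx indicE mem_set// mul1e.
suff -> : pnorm (pdiff y (cell_mid i)) <= L - dim%:R by [].
rewrite (_ : L - dim%:R = dim%:R * s); last by rewrite /s mulrC divfK// gt_eqF.
apply: pnorm_le_coord => // k; rewrite tnth_mktuple ler_norml.
by have [_ _ h1 h2] := hk k; apply/andP; split; lra.
Qed.

Lemma cov_all i (y : pt) : 2 * n%:R <= s -> box n y ->
  pnorm (pdiff y (cell_mid i)) <= L - dim%:R.
Proof.
move=> s2n yb.
have -> : L - dim%:R = dim%:R * s by rewrite /s mulrC divfK// gt_eqF.
apply: (@le_trans _ _ (dim%:R * (2 * n%:R))); last by rewrite ler_wpM2l// ltW.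
apply: pnorm_le_coord; first by rewrite mulr_ge0.
move=> k; rewrite tnth_mktuple ler_norml.
have /andP[c1 c2] := cell_mid_box (R := R) i k; have /andP[y1 y2] := yb k.
by apply/andP; split; lra.
Qed.

Lemma block_contract : exists delta' : I -> R,
  [/\ (forall i, 0 <= delta' i), local_lip n0 (block_step phi lam n L f) delta' &
      \sum_i delta' i <= (1 - N^-1) * \sum_i delta i].
Proof.
have sd0 : 0 <= \sum_i delta i by exact: sumr_ge0.
have vc00 : 0 <= vc0.
  have h : 0 <= L + r + dim%:R by have := L0; have := r0; have := k0; lra.
  by rewrite mulr_ge0 ?exprn_ge0 ?mulr_ge0 ?sqrtr_ge0.
have Ni0 : 0 <= N^-1 by rewrite invr_ge0 ltW.
have Ni1 : N^-1 <= 1 by rewrite invf_le1.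
(* When [s] exceeds the side of the box, every ball covers every cell: one step makes the function
   constant on the box, and the zero vector certifies it. *)
have [s2n|s2n] := leP s (2 * n%:R); last first.
  exists (fun i => (1 - N / N) * delta i + 0 / N * E i).
  have z i : (1 - N / N) * delta i + 0 / N * E i = 0.
    by rewrite divff ?gt_eqF// subrr !mul0r addr0.
  split.
  - by move=> i; rewrite z.
  - apply: block_lip => i.
      rewrite -intR_ind_box; apply: le_intR => // y; rewrite /cov /bx indicE.
      case: (boolP (y \in box n)) => [|_]; last by rewrite mul0e.
      by rewrite inE => yb; rewrite (cov_all i (ltW s2n) yb) mul1e.
    suff -> : shl i = (fun=> 0%E) by rewrite intR0.
    apply/funext => y; rewrite /shl /bx indicE.
    case: (boolP (y \in box n)) => [|_]; last by rewrite mul0e.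
    by rewrite inE => yb; rewrite mul1e ltNge (cov_all i (ltW s2n) yb).
  - rewrite big1; last by move=> i _; rewrite z.
    by rewrite mulr_ge0// subr_ge0.
have s0 : 0 <= s by rewrite divr_ge0 ?subr_ge0// ltW.
have sN : s ^+ dim <= N by rewrite /boxvol ler_pXn2r ?nnegrE// natrM.
exists (fun i => (1 - s ^+ dim / N) * delta i + vc0 / N * E i); split.
- move=> i; rewrite addr_ge0// mulr_ge0//.
    by rewrite subr_ge0 ler_pdivrMr// mul1r.
  by rewrite divr_ge0// ltW.
- apply: block_lip => i; first exact: cov_small.
  have h : L - dim%:R <= L + r + dim%:R by have := r0; have := k0; lra.
  have h0 : 0 <= L - dim%:R by rewrite subr_ge0.
  apply: le_trans (shell_vol (cell_mid i) dim0 h0 h).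
  apply: le_intR => //.
    apply: measurable_ind; apply: measurable_and.
      by apply: measurable_fun_ltr; [exact: measurable_cst|exact: measurable_dist_to].
    by apply: measurable_fun_ler; [exact: measurable_dist_to|exact: measurable_cst].
  move=> y; rewrite /shl -[leRHS]mul1e lee_wpmul2r ?ind_ge0//.
  by rewrite /bx lee_fin indicE lern1 leq_b1.
rewrite big_split/= -!mulr_sumr.
have cok := choice_ok.
set K1 : R := ((2 * m).+1 ^ dim)%:R in cok *.
set K2 : R := ((2 * M).+1 ^ dim)%:R in cok *.
have t0 : 0 <= @tvbound R dim r L m alpha beta by exact: tvbound_ge0.
have sE : \sum_i E i <= (2 * K1 + 2 * @tvbound R dim r L m alpha beta * K2) * \sum_i delta i.
  rewrite /E /shell_err big_split/= -!mulr_sumr [leRHS]mulrDl; apply: lerD.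
    rewrite -mulrA ler_wpM2l//; exact: sum_cells_near.
  rewrite -[leRHS]mulrA; apply: ler_wpM2l; last exact: sum_cells_near.
  by apply: mulr_ge0.
have h1 : vc0 * \sum_i E i <=
    vc0 * ((2 * K1 + 2 * @tvbound R dim r L m alpha beta * K2) * \sum_i delta i).
  by rewrite ler_wpM2l.
(* The 1 on the left of [choice_ok] is what is left over as the gain [1 / N]. *)
have h2 : vc0 * (2 * K1 + 2 * @tvbound R dim r L m alpha beta * K2) <= s ^+ dim - 1.
  by rewrite /tvbound; lra.
have h3 : vc0 * \sum_i E i <= (s ^+ dim - 1) * \sum_i delta i.
  by rewrite (le_trans h1)// mulrA ler_wpM2r.
set S := \sum_i delta i in sd0 h3 *; set SE := \sum_i E i in h3 *.
rewrite -(@ler_pM2r _ N)//.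
have -> : ((1 - s ^+ dim / N) * S + vc0 / N * SE) * N = (N - s ^+ dim) * S + vc0 * SE.
  by field; rewrite gt_eqF.
have -> : (1 - N^-1) * S * N = (N - 1) * S by field; rewrite gt_eqF.
lra.
Qed.

End step.

Hypothesis choice_ok : 1 + (2 * (L + r + dim%:R)) ^+ dim.-1 *
         (2 * Num.sqrt ((L + r + dim%:R) ^+ 2 - (L - dim%:R) ^+ 2)) *
   (2 * ((2 * m).+1 ^ dim)%:R +
          2 * (alpha * (2 * L) ^+ dim * expR (- (beta * (m%:R - r - 1)))) * ((2 * M).+1 ^ dim)%:R)
     <= ((L - dim%:R) / dim%:R) ^+ dim.

(** * Iterating the contraction *)

Section iterate.
Variable f : cf -> \bar R.
Hypothesis f01 : forall s, (0 <= f s <= 1)%E.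
Hypothesis mf : measurable_fun setT f.
Hypothesis pf : perm_inv f.

Let P j : cf -> \bar R := iter j (block_step phi lam n L) f.

Lemma iter_block j : [/\ (forall s, (0 <= P j s <= 1)%E), measurable_fun setT (P j),
   perm_inv (P j), gexp phi lam [::] (P j) = gexp phi lam [::] f &
   exists delta : I -> R, [/\ forall i, 0 <= delta i, local_lip n0 (P j) delta &
     \sum_i delta i <= (1 - N^-1) ^+ j * N]].
Proof.
elim: j => [|j [h01 mh ph gh [delta [d0 ld sd]]]].
  (* Initially each cell has oscillation at most 1, and there are [(2 * n)^dim = N] cells. *)
  split => //; exists (fun=> 1); split => //.
    move=> i X Y _ _ _; apply: (@le_trans _ _ 1%E); first by case/andP: (f01 X).
    by rewrite leeDr//; case/andP: (f01 Y).
  by rewrite expr0 mul1r sumr_const card_ffun !card_ord /boxvol -natrX.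
have h0 s : (0 <= P j s)%E by case/andP: (h01 s).
have [delta' [d0' ld' sd']] := block_contract h01 mh ph d0 ld choice_ok.
split.
- exact: block_step_01.
- exact: (measurable_block_step mphi phi0 alam).
- exact: block_step_perm.
- by rewrite /P iterS (gexp_block_step mphi phi0 phiN alam).
exists delta'; split => //.
apply: (le_trans sd'); rewrite exprS -mulrA ler_wpM2l// subr_ge0 invf_le1//.
by rewrite /boxvol exprn_ege1// ler1n muln_gt0.
Qed.

(** By stationarity the Gibbs expectation of [f] is that of [P j], an average over configurations in
    the box, each of which gives a value within [2 * \sum_i delta i] of [P j X]. *)
Lemma iter_block_osc j (X : seq pt) : inbox n X ->
  (P j X <= gexp phi lam [::] f + (2 * ((1 - N^-1) ^+ j * N))%:E /\
   gexp phi lam [::] f <= P j X + (2 * ((1 - N^-1) ^+ j * N))%:E)%E.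
Proof.
move=> bX.
have [h01 mh ph gh [delta [d0 ld sd]]] := iter_block j.
set eta := 2 * _.
have h0 s : (0 <= P j s)%E by case/andP: (h01 s).
have eta0 : 0 <= eta.
  have : 0 <= \sum_i delta i by exact: sumr_ge0.
  by rewrite /eta; lra.
have se : ((2 * \sum_i delta i)%:E <= eta%:E)%E by rewrite lee_fin /eta; lra.
have sup (Z : cf) : all (fun x => lam x != 0) (Z : seq pt) -> inbox n Z.
  move=> /allP h x /h lx; apply: contrapT => nb.
  by rewrite suplam ?eqxx in lx.
have PX : P j X = (fine (P j X))%:E.
  rewrite fineK// ge0_fin_numE//; case/andP: (h01 X) => _ h1.
  by rewrite (le_lt_trans h1)// ltry.
have pX0 : 0 <= fine (P j X) by rewrite -lee_fin -PX.
rewrite -gh; split.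
  rewrite {1}PX -(gexp_cst mphi phi0 alam [::] pX0).
  apply: (gexp_le_add mphi phi0) => //; first exact: alam.
  move=> Z /sup bZ; rewrite -PX; apply: (le_trans (lip_global ld bX bZ)).
  by rewrite leeD2l.
rewrite PX -(gexp_cst mphi phi0 alam [::] pX0).
apply: (gexp_le_add mphi phi0) => //; first exact: alam.
move=> Z /sup bZ; rewrite -PX; apply: (le_trans (lip_global ld bZ bX)).
by rewrite leeD2l.
Qed.

Lemma measurable_inbox : measurable [set s : cf | forall x, x \in (s : seq pt) -> box n x].
Proof.
have mb : measurable_fun setT (fun p : unit * pt => `[< box n p.2 >]).
  apply: (measurableT_comp (f := fun x : pt => `[< box n x >])) => //.
  apply: (@measurable_fun_bool _ _ _ _ true); rewrite setTI.
  rewrite (_ : _ @^-1` _ = box n); first exact: measurable_box.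
  by apply/seteqP; split => x /=; [move/asboolP|move=> ?; apply/asboolP].
have m1 : measurable_fun setT (fun s : cf => all (fun x => `[< box n x >]) (s : seq pt)).
  exact: (measurableT_comp (measurable_all_conf mb) (pair1_measurable tt)).
have := measurable_pred_set m1; congr measurable; apply/seteqP; split => s /=.
  by move=> /allP h x /h /asboolP.
by move=> h; apply/allP => x /h ?; apply/asboolP.
Qed.

Lemma iter_block_law j (mu0 : probability cf R) :
  mu0 [set s : cf | forall x, x \in (s : seq pt) -> box n x] = 1%E ->
  `|fine (\int[mu0]_(x in [set: cf]) P j x) - fine (gexp phi lam [::] f)|
    <= 2 * ((1 - N^-1) ^+ j * N).
Proof.
move=> mu1.
have [h01 mh ph gh [delta [d0 ld sd]]] := iter_block j.
set S := [set s : cf | _] in mu1.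
have mS : measurable S by exact: measurable_inbox.
set eta := 2 * _.
have h0 s : (0 <= P j s)%E by case/andP: (h01 s).
have f0 s : (0 <= f s)%E by case/andP: (f01 s).
have eta0 : 0 <= eta.
  have : 0 <= \sum_i delta i by exact: sumr_ge0.
  by rewrite /eta; lra.
have g1 : (gexp phi lam [::] f <= 1)%E by exact: (gexp_le1 mphi phi0 alam).
have g0 : (0 <= gexp phi lam [::] f)%E by exact: (gexp_ge0 mphi phi0 alam).
have gE : gexp phi lam [::] f = (fine (gexp phi lam [::] f))%:E.
  by rewrite fineK// ge0_fin_numE// (le_lt_trans g1)// ltry.
set g := fine (gexp phi lam [::] f) in gE *.
have gr0 : 0 <= g by rewrite -lee_fin -gE.
(* The initial law charges only configurations in the box, so bounds valid there hold almost
   everywhere. *)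
have ae (Q : cf -> Prop) : (forall s, S s -> Q s) -> {ae mu0, forall s, [set: cf] s -> Q s}.
  move=> SQ; exists (~` S); split.
  - exact: measurableC.
  - by rewrite probability_setC// mu1 subee.
  - by move=> s /= nQ Ss; apply: nQ => _; exact: SQ.
have osc s : S s -> inbox n s by [].
have i0 : (0 <= \int[mu0]_(x in [set: cf]) P j x)%E by exact: integral_ge0.
have up : (\int[mu0]_(x in [set: cf]) P j x <= (g + eta)%:E)%E.
  apply: (@le_trans _ _ (\int[mu0]_(x in [set: cf]) (g + eta)%:E)%E).
    apply: ae_ge0_le_integral => //.
    - by move=> s _; rewrite lee_fin addr_ge0.
    - by apply: ae => s /osc /(iter_block_osc j)[+ _]; rewrite gE -EFinD.
  by rewrite integral_cst//= probability_setT mule1.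
have lo : (g%:E <= \int[mu0]_(x in [set: cf]) P j x + eta%:E)%E.
  apply: (@le_trans _ _ (\int[mu0]_(x in [set: cf]) (P j x + eta%:E))%E).
    rewrite -[leLHS]mule1 -(@probability_setT _ _ _ mu0) -integral_cst//.
    apply: ae_ge0_le_integral => //.
    - by move=> s _; rewrite adde_ge0.
    - exact: emeasurable_funD.
    - by apply: ae => s /osc /(iter_block_osc j)[_]; rewrite gE.
  by rewrite ge0_integralD// integral_cst//= probability_setT mule1.
have iE : (\int[mu0]_(x in [set: cf]) P j x)%E = (fine (\int[mu0]_(x in [set: cf]) P j x))%:E.
  by rewrite fineK// ge0_fin_numE// (le_lt_trans up)// ltry.
move: up lo; rewrite iE -EFinD !lee_fin => up lo.
by rewrite ler_norml; apply/andP; split; lra.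
Qed.

End iterate.

Lemma block_tv_le j (mu0 : probability cf R) :
  mu0 [set s : cf | forall x, x \in (s : seq pt) -> box n x] = 1%E ->
  (block_tv phi lam n L mu0 j <= (2 * ((1 - N^-1) ^+ j * N))%:E)%E.
Proof.
move=> mu1; apply: ge_ereal_sup => _ [A cA <-]; rewrite lee_fin.
have mA : measurable_fun setT (fun s : cf => (\1_A s)%:E : \bar R).
  apply/measurable_EFinP; apply: measurable_indic; apply/conf_measurableP; exact: cA.1.
apply: iter_block_law => //.
- by move=> s; rewrite !lee_fin indicE lern1 leq_b1 ler0n.
- move=> s t st; rewrite !indicE; congr (_%:R%:E); congr nat_of_bool.
  apply/idP/idP; rewrite !inE; first exact: cA.2.
  by apply: cA.2; rewrite perm_sym.
Qed.

End Contraction.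

(** Taking [j > N ln(4 N / eps)], the bound [1 - 1/N <= exp(-1/N)] leaves an error of at most
    [eps / 2]. The constant 4 absorbs [ln 4] and the rounding: with [l = ln(N / eps) >= ln 2 >= 1/2]
    and [N >= 2], one has [2 ln 2 <= 2 l] and [1 <= N l]. *)
Lemma mixing_steps (R : realType) (N eps : R) : 2 <= N -> 0 < eps < 1 ->
  exists j : nat, j%:R <= 4 * N * ln (N / eps) /\ 2 * ((1 - N^-1) ^+ j * N) < eps.
Proof.
move=> N2 /andP[e0 e1].
have N0 : 0 < N by lra.
have Ne : 2 <= N / eps by rewrite ler_pdivlMr//; nra.
have Ne0 : 0 < N / eps by lra.
have ln2 : 2^-1 <= ln (2 : R).
  have h : ln (2^-1 : R) <= 2^-1 - 1 by apply: le_trans (le_ln1Dx _); rewrite ?subrKC//; lra.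
  by move: h; rewrite lnV ?posrE//; lra.
have lNe : ln (2 : R) <= ln (N / eps) by rewrite ler_ln ?posrE.
set l := ln (N / eps) in lNe *.
pose T := N * ln (4 * (N / eps)).
have ln4 : ln (4 * (N / eps)) = 2 * ln 2 + l.
  rewrite lnM ?posrE//; congr (_ + _).
  by rewrite (_ : 4 = 2 * 2 :> R) ?lnM ?posrE//; lra.
have T0 : 0 <= T by rewrite /T ln4; nra.
have /andP[T1 T2] := truncn_itv T0.
exists (Num.truncn T).+1; split.
  rewrite -natr1 (le_trans (y := T + 1))// ?lerD2r// /T ln4; nra.
set j := (Num.truncn T).+1 in T2 *.
have h1 : (1 - N^-1) ^+ j <= expR (- (j%:R / N)).
  have -> : expR (- (j%:R / N)) = expR (- N^-1) ^+ j.
    by rewrite -expRM_natl; congr expR; ring.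
  have Ni : N^-1 <= 1 by rewrite invf_le1//; lra.
  rewrite ler_pXn2r ?nnegrE ?expR_ge0 ?subr_ge0//.
  exact: expR_ge1Dx.
have h2 : expR (- (j%:R / N)) <= eps / (4 * N).
  have -> : eps / (4 * N) = expR (- ln (4 * (N / eps))).
    have p4 : 0 < 4 * (N / eps) by rewrite mulr_gt0.
    rewrite expRN lnK ?posrE//.
    by field; rewrite !gt_eqF.
  by rewrite ler_expR lerN2 ler_pdivlMr// mulrC ltW.
have h3 : (1 - N^-1) ^+ j * N <= eps / 4.
  have -> : eps / 4 = eps / (4 * N) * N by field; rewrite gt_eqF.
  by rewrite ler_wpM2r ?(ltW N0)// (le_trans h1).
by lra.
Qed.

Theorem theorem29 (R : realType) (dim : nat) (phi : dim.-tuple R -> \bar R)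
    (r lambda : R) :
  (0 < dim)%N -> 0 < r -> repulsive_range phi r ->
  strong_spatial_mixing phi lambda ->
  exists L0 : R, 0 < L0 /\
    forall L : R, L0 <= L ->
      exists C : R, 0 < C /\
        forall (n : nat) (lam : dim.-tuple R -> R),
          (0 < n)%N -> activity lam lambda ->
          (forall x, ~ box n x -> lam x = 0) ->
          forall eps : R, 0 < eps < 1 ->
            mixing_time_le phi lam n L eps
              (C * @boxvol R dim n * ln (@boxvol R dim n / eps)).
Proof.
move=> dim0 r0 [mphi phiN phi0 phir] [alpha [beta [a0 b0 ssm]]].
have [L0 [L00 hL]] := radius_choice dim0 r0 a0 b0.
(* The constant 4 is the same for all [L >= L0], because the contraction factor [1 - 1/N] does not
   depend on [L]. *)
exists L0; split => // L LL; exists 4; split => // n lam n0 alam suplam eps e01 mu0 mu1.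
have [Lk [m [M [M_ge ok]]]] := hL L LL.
have N2 : 2 <= @boxvol R dim n.
  have n1 : 2 <= (2 * n)%:R :> R by rewrite natrM ler_peMr// ler1n.
  rewrite /boxvol -(prednK dim0) exprS (le_trans n1)// ler_peMr//.
  by rewrite exprn_ege1// (le_trans _ n1)// ler1n.
have [j [j1 j2]] := mixing_steps N2 e01.
exists j; split => //.
have := block_tv_le dim0 r0 mphi phi0 phiN phir alam n0 suplam Lk a0 b0 ssm M_ge ok j mu1.
by move=> h; apply: (le_lt_trans h); rewrite lte_fin.
Qed.
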